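(* Let $\mathbf k$ be a field of characteristic $c$ and let $n,N$ be positive integers. Write $N=\theta n+r$ with integers $\theta,r$ and $0\le r\le n-1$. Then $\operatorname{pd}_{R_{\mathbf k,n}}Q_{\mathbf k,n,N}=\infty$ if and only if $\theta\in S_c$ and $1\le r$.
   Context: $R_{\mathbf k,n}=\mathbf k[x,y,z]/(x^n+y^n+z^n)$ and $Q_{\mathbf k,n,N}=R_{\mathbf k,n}/(x^N,y^N,z^N)$ as an $R_{\mathbf k,n}$-module. The sets $S_c$ of non-negative integers ($c=0$ or $c$ a prime) are defined as follows. $S_0$ is the set of all non-negative integers. $S_2=\{0\}$. $S_3$ is the smallest set of non-negative integers containing $0$ such that whenever $a$ is an even element of $S_3$, the integers $3a,3a+1,3a+4,3a+5$ all lie in $S_3$. For a prime $p\ge5$, let $\pi_p$ be the largest integer with $\pi_p<p/3$; $S_p$ is the smallest set of non-negative integers containing the interval of integers $[0,2\pi_p]$ such that whenever $\theta$ is a non-negative even element of $S_p$, all non-negative integers in $[p\theta-2\pi_p-1,\,p\theta+2\pi_p]$ lie in $S_p$. *)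

(* Defs.v *)
From HB Require Import structures.
From mathcomp Require Import all_boot all_order all_algebra.
From Stdlib Require Import ClassicalEpsilon.

Set Implicit Arguments.
Unset Strict Implicit.
Unset Printing Implicit Defensive.

Import GRing.Theory.
Local Open Scope ring_scope.
Local Open Scope quotient_scope.

Definition pbool (P : Prop) : bool :=
  if excluded_middle_informative P then true else false.

Lemma pboolP (P : Prop) : reflect P (pbool P).
Proof. by rewrite /pbool; case: excluded_middle_informative => h; constructor. Qed.

(* The polynomial ring k[x,y,z], encoded as k[x][y][z].               *)
Definition P3 (k : fieldType) := {poly {poly {poly k}}}.

Section Rings.
Variable k : fieldType.

Definition varx : P3 k := ('X%:P)%:P.
Definition vary : P3 k := ('X)%:P.
Definition varz : P3 k := 'X.

(* the defining polynomial x^n + y^n + z^n (n is positive in the theorem;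
   for the excluded value n = 0 we use the junk value 0 so that the ideal
   below is always proper) *)
Definition Fpoly (n : nat) : P3 k :=
  if n == 0%N then 0 else varx ^+ n + vary ^+ n + varz ^+ n.

Definition Fideal (n : nat) : {pred P3 k} :=
  fun p => pbool (exists q : P3 k, p = q * Fpoly n).

Lemma Fpoly_monic_form (n : nat) : (0 < n)%N ->
  Fpoly n = 'X^n + ((('X%:P) ^+ n + 'X ^+ n) : {poly {poly k}})%:P.
Proof.
move=> n0; rewrite /Fpoly eqn0Ngt n0 /= /varx /vary /varz.
by rewrite -!rmorphXn /= -rmorphD /= addrC.
Qed.

Lemma Fideal_closed (n : nat) : idealr_closed (Fideal n).
Proof.
split.
- by apply/pboolP; exists 0; rewrite mul0r.
- apply/negP => /pboolP [q Hq].
  case: (posnP n) Hq => [->|n0] Hq.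
    by move: Hq; rewrite /Fpoly eqxx mulr0 => /eqP; rewrite oner_eq0.
  have hm : Fpoly n \is monic by rewrite Fpoly_monic_form // monicXnaddC.
  have hs : size (Fpoly n) = n.+1 by rewrite Fpoly_monic_form // size_XnaddC.
  have [q00|q0] := eqVneq q 0.
    by move: Hq => /eqP; rewrite q00 mul0r oner_eq0.
  have := size_Mmonic q0 hm; rewrite -Hq size_poly1 hs addnS /=.
  have sq : (0 < size q)%N by rewrite size_poly_gt0.
  by move=> h; have := leq_add sq n0; rewrite -h.
- move=> a u v /pboolP [qu ->] /pboolP [qv ->].
  by apply/pboolP; exists (a * qu + qv); rewrite mulrDl mulrA.
Qed.

HB.instance Definition _ (n : nat) :=
  isIdealr.Build (P3 k) (Fideal n) (Fideal_closed n).

Definition Rkn (n : nat) := {ideal_quot (Fideal n)}.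

End Rings.

Section Ideal3.
Variables (R : comNzRingType) (g1 g2 g3 : R).

Definition ideal3 : {pred R} :=
  fun r => pbool (exists a b c : R, r = a * g1 + b * g2 + c * g3).

Lemma ideal3_zmod : zmod_closed ideal3.
Proof.
split.
- by apply/pboolP; exists 0, 0, 0; rewrite !mul0r !addr0.
- move=> u v /pboolP [a [b [c ->]]] /pboolP [a' [b' [c' ->]]].
  apply/pboolP; exists (a - a'), (b - b'), (c - c').
  rewrite !mulrBl.
  set A := a * g1; set A' := a' * g1; set B := b * g2; set B' := b' * g2.
  set C := c * g3; set C' := c' * g3.
  by rewrite !opprD [A - A' + _]addrACA [_ + (C - C')]addrACA.
Qed.

Lemma ideal3M (a r : R) : r \in ideal3 -> a * r \in ideal3.
Proof.
move=> /pboolP [u [v [w ->]]]; apply/pboolP.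
by exists (a * u), (a * v), (a * w); rewrite !mulrDr !mulrA.
Qed.

HB.instance Definition _ := GRing.isZmodClosed.Build R ideal3 ideal3_zmod.
End Ideal3.

Section QuotMod.
Variables (R : comNzRingType) (g1 g2 g3 : R).
Local Notation I := (ideal3 g1 g2 g3).

Local Notation QuotMod := (@Quotient.quot R I).

Definition Qscale (r : R) (q : QuotMod) : QuotMod := \pi_QuotMod (r * repr q).

Lemma Qpi_eq (a b : R) : a - b \in I -> \pi_QuotMod a = \pi_QuotMod b.
Proof. by move=> h; apply/eqP; rewrite -Quotient.idealrBE. Qed.

Lemma repr_pi_in (a : R) : repr (\pi_QuotMod a) - a \in I.
Proof. by rewrite Quotient.idealrBE reprK. Qed.

Lemma QscaleA a b v : Qscale a (Qscale b v) = Qscale (a * b) v.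
Proof.
rewrite /Qscale; apply: Qpi_eq; rewrite -mulrA -mulrBr; apply: ideal3M.
exact: repr_pi_in.
Qed.

Lemma Qscale1 v : Qscale 1 v = v.
Proof. by rewrite /Qscale mul1r reprK. Qed.

Lemma QscaleDr a u v : Qscale a (u + v) = Qscale a u + Qscale a v.
Proof.
rewrite /Qscale -pi_addr; apply: Qpi_eq.
rewrite -mulrDr -mulrBr; apply: ideal3M.
have -> : u + v = \pi_QuotMod (repr u + repr v).
  by rewrite pi_addr !reprK.
exact: repr_pi_in.
Qed.

Lemma QscaleDl v a b : Qscale (a + b) v = Qscale a v + Qscale b v.
Proof. by rewrite /Qscale -pi_addr mulrDl. Qed.

HB.instance Definition _ :=
  GRing.Zmodule_isLmodule.Build R QuotMod QscaleA Qscale1 QscaleDr QscaleDl.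
End QuotMod.

Definition xR (k : fieldType) (n : nat) : Rkn k n := \pi_(Rkn k n) (varx k).
Definition yR (k : fieldType) (n : nat) : Rkn k n := \pi_(Rkn k n) (vary k).
Definition zR (k : fieldType) (n : nat) : Rkn k n := \pi_(Rkn k n) (varz k).

Definition Qkn (k : fieldType) (n N : nat) : lmodType (Rkn k n) :=
  @Quotient.quot (Rkn k n) (ideal3 (xR k n ^+ N) (yR k n ^+ N) (zR k n ^+ N)).

Section Proj.
Variable R : comNzRingType.

Definition projective (P : lmodType R) : Prop :=
  forall (A B : lmodType R) (g : {linear A -> B}) (h : {linear P -> B}),
    (forall b : B, exists a : A, g a = b) ->
    exists h' : {linear P -> A}, forall p : P, g (h' p) = h p.

(* pd_R M < infinity: M has a projective resolution of finite length
     0 -> P_n -> ... -> P_1 -> P_0 -> M -> 0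
   (encoded with P_i = 0 for i > n). *)
Definition finite_pd (M : lmodType R) : Prop :=
  exists (n : nat) (P : nat -> lmodType R)
         (d : forall i : nat, {linear P i.+1 -> P i}) (e : {linear P 0%N -> M}),
    [/\ forall i, projective (P i),
        forall i, (n < i)%N -> forall x : P i, x = 0,
        forall m : M, exists x : P 0%N, e x = m,
        forall x : P 0%N, e x = 0 <-> exists y, d 0%N y = x
      & forall i (x : P i.+1), d i x = 0 <-> exists y, d i.+1 y = x].

Definition pd_infinite (M : lmodType R) : Prop := ~ finite_pd M.
End Proj.

Inductive S3 : nat -> Prop :=
| S3_0 : S3 0
| S3_step (a m : nat) : S3 a -> ~~ odd a ->
    m \in [:: 3 * a; 3 * a + 1; 3 * a + 4; 3 * a + 5]%N -> S3 m.

(* pi_p = largest integer < p/3 *)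
Definition pi_p (p : nat) : nat := (p.-1 %/ 3)%N.

Inductive Sp (p : nat) : nat -> Prop :=
| Sp_base (m : nat) : (m <= 2 * pi_p p)%N -> Sp p m
| Sp_step (t m : nat) : Sp p t -> ~~ odd t ->
    (p * t <= m + 2 * pi_p p + 1)%N -> (m <= p * t + 2 * pi_p p)%N -> Sp p m.

Definition S (c t : nat) : Prop :=
  if c == 0%N then True
  else if c == 2%N then t = 0%N
  else if c == 3%N then S3 t
  else Sp c t.

(* Main.v *)
Require Import Defs.
From HB Require Import structures.
From mathcomp Require Import all_boot all_order all_algebra.
From mathcomp Require Import zify ring.
From Stdlib Require Classical_Prop.

(** Put X = x^n, Y = y^n, Z = z^n. The ring R is free over k[X, Y, Z]/(X + Y + Z),
    a polynomial ring in two variables, so the syzygies of (x^N, y^N, z^N) are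
    assembled from the syzygies of (X^a, Y^b, Z^c) with a, b, c in
    {theta, theta + 1}. Over a polynomial ring in two variables these are free on
    two generators, and Han's syzygy gap delta(a, b, c) is the difference of their
    degrees. If r = 0, or if delta(theta, theta, theta) or
    delta(theta+1, theta+1, theta+1) is at least 2, the syzygies of
    (x^N, y^N, z^N) over R are free, and R^2 -> R^3 -> R resolves Q. Otherwise they
    are isomorphic to the syzygies of (x^i, y^j, z^l) for some 0 < i, j, l < n.
    These have a periodic resolution given by a 4x4 matrix factorization of
    x^n + y^n + z^n with entries in (x, y, z), so the identity is never
    null-homotopic and the projective dimension is infinite.

    It remains to find the theta for which both gaps are at most 1. The gap is
    1-Lipschitz in each argument and is multiplied by p under Frobenius; if it is
    at least 2, then a Wronskian vanishes, and this forces delta(a) to equal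
    p delta(u) - |a - p u| for some u. In characteristic 0 the gap on the diagonal
    is thus at most 1, and in characteristic p the recursion is the one defining
    S_p.

    A form of degree d in X, Y is encoded by a univariate polynomial of size at
    most d + 1, by setting Y = 1; hence Z becomes -(X + 1), and divisibility by a
    power of Y becomes a bound on the size. *)

Set Implicit Arguments.
Unset Strict Implicit.
Unset Printing Implicit Defensive.

Import GRing.Theory.
Local Open Scope ring_scope.
Local Open Scope quotient_scope.

(** * Syzygy gaps *)

(** Gap 2 is the threshold because there are three points. The substitution X -> Y -> Z -> X
    permutes the syzygies of (X^t, Y^t, Z^t) as well as the points where X, Y or Z vanishes, so a
    syzygy of least degree, if unique up to scalars, vanishes at all three points or at none. In the
    latter case the other generator may be corrected by a multiple of it, the factor being a form
    whose degree is the gap: degree 2 or more prescribes values at three points, degree 1 only at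
    two. This yields the normal forms in [rigid], which is equivalent to both gaps, at t and t + 1,
    being at most 1.

    The constant in S_p comes from descent: if t is even and rigid, the gap at p t + j stays below 2
    as long as 3 j < 2 p + 2, and likewise at p (t + 1) - j for t odd and rigid. For p >= 5 this
    means j <= 2 pi_p + 1; the pair x, x + 1 must fit into the band, which shortens its right end by
    one. For p = 3 the bound is j <= 2 while 2 pi_3 + 1 = 1, hence the separate rule for S_3. *)

Section SyzygyGap.
Variable k : fieldType.
Implicit Types A B p q s : {poly k}.

(** This is -Z at Y = 1, in the shape to which the results on linear factors apply. *)
Definition xp1 : {poly k} := 'X - (-1)%:P.

(* Library facts restated over a field, so that every [size] is elaborated with the
   same structure on [{poly k}] and [lia] identifies equal sizes. *)
Lemma fsize_gt0 A : (0 < size A)%N = (A != 0).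
Proof. exact: size_poly_gt0. Qed.

Lemma fsizeM A B : A != 0 -> B != 0 -> size (A * B) = (size A + size B).-1.
Proof. exact: size_mul. Qed.

Lemma fsize_comp A B : (size (A \Po B)).-1 = ((size A).-1 * (size B).-1)%N.
Proof. exact: size_comp_poly. Qed.

Lemma fsizeN A : size (- A) = size A.
Proof. exact: size_polyN. Qed.

Lemma fsizeZ (x : k) A : x != 0 -> size (x *: A) = size A.
Proof. exact: size_scale. Qed.

Lemma fdvdp_leq A B : B != 0 -> A %| B -> (size A <= size B)%N.
Proof. exact: dvdp_leq. Qed.

(* (A, B, -(A + B)) are forms of degree d with sum 0, divisible by X^a, Y^b and Z^c. *)
Definition elt (a b c d : nat) A B : Prop :=
  [/\ 'X^a %| A, xp1 ^+ c %| A + B, (size A <= d.+1)%N & (size B <= d.+1 - b)%N].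

(* The gap of (X^a, Y^b, Z^c) is at least m: the degrees of the two generators of
   the syzygy module add up to a + b + c. *)
Definition gapge (a b c m : nat) : Prop :=
  exists d A B, [/\ elt a b c d A B, (A != 0) || (B != 0) & (2 * d + m <= a + b + c)%N].

Lemma xp1E : xp1 = 'X + 1. Proof. by rewrite /xp1 polyCN opprK. Qed.

Lemma xp1_neq0 : xp1 != 0. Proof. by rewrite /xp1 polyXsubC_eq0. Qed.

Lemma size_xp1X n : size (xp1 ^+ n) = n.+1.
Proof. exact: size_exp_XsubC. Qed.

Lemma X_xp1_coprime i j : coprimep 'X^i (xp1 ^+ j).
Proof.
apply: coprimep_expl; apply: coprimep_expr.
by rewrite coprimep_XsubC rootX oppr_eq0 oner_eq0.
Qed.

Lemma gapge_le a b c m m' : (m' <= m)%N -> gapge a b c m -> gapge a b c m'.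
Proof.
by move=> h [d [A [B [e n0 hd]]]]; exists d, A, B; split=> //; lia.
Qed.

Lemma size_mul_le p q i j : (size p <= i.+1)%N -> (size q <= j)%N ->
  (size (p * q)%R <= i + j)%N.
Proof.
move=> hp hq; have [->|q0] := eqVneq q 0; first by rewrite mulr0 size_poly0.
apply: leq_trans (size_polyMleq _ _) _; move: q0; rewrite -size_poly_gt0; lia.
Qed.

Lemma gapge_incX a b c m : gapge a b c m.+1 -> gapge a.+1 b c m.
Proof.
move=> [d [A [B [[h1 h2 h3 h4] n0 hd]]]].
(* For b > d + 1 the truncated bound [d.+1 - b] need not grow with d, but then B is zero. *)
have [hb|hb] := leqP b d.+1; last first.
  have B0 : B = 0 by apply/eqP; rewrite -size_poly_leq0; lia.
  exists d.+1, ('X * A), 0; rewrite B0 addr0 eqxx orbF in h2 n0.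
  rewrite eqxx orbF.
  split; [|by rewrite mulf_eq0 polyX_eq0 (negPf n0)|by lia].
  split; [by rewrite exprS dvdp_mul2l ?polyX_eq0|by rewrite addr0 dvdp_mull| |by rewrite size_poly0].
  by rewrite -[d.+2]add1n size_mul_le ?size_polyX.
exists d.+1, ('X * A), ('X * B); split; [|by rewrite !mulf_eq0 !polyX_eq0 /=|by lia].
split; [by rewrite exprS dvdp_mul2l ?polyX_eq0|by rewrite -mulrDr dvdp_mull| |].
  by rewrite -[d.+2]add1n size_mul_le ?size_polyX.
have -> : (d.+2 - b = 1 + (d.+1 - b))%N by lia.
by rewrite size_mul_le ?size_polyX.
Qed.

Lemma gapge_incY a b c m : gapge a b c m.+1 -> gapge a b.+1 c m.
Proof.
move=> [d [A [B [[h1 h2 h3 h4] n0 hd]]]]; exists d.+1, A, B.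
by split=> //; [split=> //|]; lia.
Qed.

Lemma gapge_incZ a b c m : gapge a b c m.+1 -> gapge a b c.+1 m.
Proof.
move=> [d [A [B [[h1 h2 h3 h4] n0 hd]]]].
have sz : (size xp1 <= 2)%N by rewrite /xp1 size_XsubC.
have [hb|hb] := leqP b d.+1; last first.
  have B0 : B = 0 by apply/eqP; rewrite -size_poly_leq0; lia.
  exists d.+1, (xp1 * A), 0; rewrite B0 addr0 eqxx orbF in h2 n0.
  rewrite eqxx orbF.
  split; [|by rewrite mulf_eq0 (negPf xp1_neq0) (negPf n0)|by lia].
  split; [by rewrite dvdp_mull|by rewrite addr0 exprS dvdp_mul2l ?xp1_neq0| |by rewrite size_poly0].
  by rewrite -[d.+2]add1n size_mul_le.
exists d.+1, (xp1 * A), (xp1 * B); split; [|by rewrite !mulf_eq0 (negPf xp1_neq0)|by lia].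
split; [by rewrite dvdp_mull|by rewrite -mulrDr exprS dvdp_mul2l ?xp1_neq0| |].
  by rewrite -[d.+2]add1n size_mul_le.
have -> : (d.+2 - b = 1 + (d.+1 - b))%N by lia.
by rewrite size_mul_le.
Qed.

Lemma gapge_decX a b c m : gapge a.+1 b c m.+1 -> gapge a b c m.
Proof.
move=> [d [A [B [[h1 h2 h3 h4] n0 hd]]]]; exists d, A, B.
split=> //; [split=> //|by lia].
by apply: dvdp_trans h1; rewrite dvdp_exp2l.
Qed.

Lemma gapge_decY a b c m : gapge a b.+1 c m.+1 -> gapge a b c m.
Proof.
move=> [d [A [B [[h1 h2 h3 h4] n0 hd]]]]; exists d, A, B.
by split=> //; [split=> //|]; lia.
Qed.

Lemma gapge_decZ a b c m : gapge a b c.+1 m.+1 -> gapge a b c m.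
Proof.
move=> [d [A [B [[h1 h2 h3 h4] n0 hd]]]]; exists d, A, B.
split=> //; [split=> //|by lia].
by apply: dvdp_trans h2; rewrite dvdp_exp2l.
Qed.

(** The sum of the two truncated differences is |a - a'|; the hypotheses are the unit steps in
    either direction. *)
Lemma lipschitz (P : nat -> nat -> Prop) :
  (forall a m, P a m.+1 -> P a.+1 m) -> (forall a m, P a.+1 m.+1 -> P a m) ->
  forall a a' m, P a (m + ((a - a') + (a' - a)))%N -> P a' m.
Proof.
move=> inc dec.
have up j : forall a m, P a (m + j)%N -> P (a + j)%N m.
  elim: j => [|j IH] a m; first by rewrite !addn0.
  by rewrite !addnS -addSn => h; apply: inc; apply: IH.
have dn j : forall a m, P (a + j)%N (m + j)%N -> P a m.
  elim: j => [|j IH] a m; first by rewrite !addn0.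
  by rewrite !addnS => /dec; apply: IH.
move=> a a' m; have [le_a|le_a] := leqP a a'.
  by rewrite (_ : _ + _ = m + (a' - a))%N; [move/up; rewrite subnKC|lia].
rewrite (_ : _ + _ = m + (a - a'))%N; last by lia.
by rewrite -{1}(subnKC (ltnW le_a)) => /dn.
Qed.

Lemma gapge_lipschitz a b c a' b' c' m M :
  (m + ((a - a') + (a' - a)) + ((b - b') + (b' - b)) + ((c - c') + (c' - c)) <= M)%N ->
  gapge a b c M -> gapge a' b' c' m.
Proof.
move=> hM /(gapge_le hM) h.
have {}h := lipschitz (P := fun c m => gapge a b c m) (@gapge_incZ a b) (@gapge_decZ a b) h.
have {}h := lipschitz (P := fun b m => gapge a b c' m)
  (fun b => @gapge_incY a b c') (fun b => @gapge_decY a b c') h.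
exact: (lipschitz (P := fun a m => gapge a b' c' m)
  (fun a => @gapge_incX a b' c') (fun a => @gapge_decX a b' c') h).
Qed.

Section PositiveCharacteristic.
Variable p : nat.
Hypothesis pcharp : p \in [pchar k].

Lemma frob_polyD A B : (A + B) ^+ p = A ^+ p + B ^+ p.
Proof.
apply: exprDn_pchar; apply/pnatP => [|q pq].
  by rewrite prime_gt0 // (pcharf_prime pcharp).
rewrite dvdn_prime2 // ?(pcharf_prime pcharp) // => /eqP ->.
by rewrite pchar_poly.
Qed.

Lemma gapge_frobenius a b c m : gapge a b c m -> gapge (p * a) (p * b) (p * c) (p * m).
Proof.
have p_gt0 : (0 < p)%N by rewrite prime_gt0 // (pcharf_prime pcharp).
move=> [d [A [B [[h1 h2 h3 h4] n0 hd]]]]; exists (p * d)%N, (A ^+ p), (B ^+ p).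
split; last by have : (p * (2 * d + m) <= p * (a + b + c))%N by [rewrite leq_mul]; lia.
  split; first by rewrite mulnC exprM dvdp_exp2r.
  - by rewrite -frob_polyD mulnC exprM dvdp_exp2r.
  - have l : ((size A).-1 * p <= p * d)%N by rewrite mulnC leq_mul //; lia.
    by rewrite -size_exp in l; apply: leq_trans (leqSpred _) _.
  - have [->|B0] := eqVneq B 0; first by rewrite expr0n -[(p == 0)%N]negbK -lt0n p_gt0 size_poly0.
    have sB : (0 < size B)%N by rewrite size_poly_gt0.
    have l : ((size B).-1 * p <= p * (d - b))%N by rewrite mulnC leq_mul //; lia.
    have l2 : (p * b <= p * d)%N by rewrite leq_mul //; lia.
    rewrite -size_exp in l; apply: leq_trans (leqSpred _) _.
    by apply: leq_trans (_ : (p * (d - b)).+1 <= _)%N; [exact: l|rewrite mulnBr; lia].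
by rewrite !expf_eq0 p_gt0.
Qed.
End PositiveCharacteristic.
End SyzygyGap.

(** * Wronskians and Frobenius descent *)

Lemma ceil_divn p j : (0 < p)%N ->
  (j <= p * ((j + p.-1) %/ p))%N && (p * ((j + p.-1) %/ p) < j + p)%N.
Proof.
move=> p0; have := divn_eq (j + p.-1) p; have := ltn_pmod (j + p.-1) p0.
by rewrite [(p * _)%N]mulnC; move: ((j + p.-1) %/ p * p)%N ((j + p.-1) %% p)%N => x y; lia.
Qed.

(** Write g2 for d + 1 - sG - p e, so that g1 + g2 + g3 <= d - p e. Since a - p u <= g1, one has |a
    - p u| <= p u - a + 2 g1, and likewise for b and c; summing the three and using 2 d + m <= a + b
    + c gives the claim. *)
Lemma descent_arith p a b c d m e g1 g3 sG u v w : (0 < p)%N -> (g1 + g3 < sG)%N ->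
  (sG + p * e <= d.+1)%N -> (2 * d + m <= a + b + c)%N ->
  (a - g1 <= p * u)%N -> (b - (d.+1 - sG - p * e) <= p * v)%N -> (c - g3 <= p * w)%N ->
  (2 * e <= u + v + w)%N /\
  (m + ((a - p * u) + (p * u - a)) + ((b - p * v) + (p * v - b))
     + ((c - p * w) + (p * w - c)) <= p * (u + v + w - 2 * e))%N.
Proof.
move=> p0 hG hd hm h1 h2 h3.
have pe : (p * (2 * e) = 2 * (p * e))%N by rewrite mulnCA.
have h : (p * (2 * e) <= p * (u + v + w))%N.
  rewrite pe !mulnDr; move: (p * u)%N (p * v)%N (p * w)%N (p * e)%N h1 h2 h3 hd => U V W E.
  by move: hG hm; clear; lia.
split; first by rewrite leq_pmul2l in h.
rewrite mulnBr pe !mulnDr.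
move: (p * u)%N (p * v)%N (p * w)%N (p * e)%N h1 h2 h3 hd {h} => U V W E.
by move: hG hm; clear; lia.
Qed.

(** Divisibility of b1 by Y^v in terms of sizes: Y occurs in the pullback of b1 with exponent p (e -
    deg b1), which is at least b - g2, and v is the ceiling of (b - g2) / p. *)
Lemma descent_size p b d e sG sb v : (0 < sb)%N -> (sb.-1 <= e)%N ->
  (sG + p * sb.-1 + b <= d.+1)%N -> (sG + p * e <= d.+1)%N ->
  (p * v < b - (d.+1 - sG - p * e) + p)%N -> (sb <= e.+1 - v)%N.
Proof.
case: sb => // n _ /= le h1 h2 h3.
suff : (n + v <= e)%N by lia.
rewrite leqNgt; apply/negP => gt.
have : (p * e.+1 <= p * (n + v))%N by rewrite leq_mul2l gt orbT.
have : (p * n <= p * e)%N by rewrite leq_mul2l le orbT.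
rewrite mulnS mulnDr; move: (p * n)%N (p * e)%N (p * v)%N h1 h2 h3 => X Y Z.
by clear; lia.
Qed.

Section Wronskian.
Variable k : fieldType.
Implicit Types A B D G p q s : {poly k}.
Local Notation xp1 := (xp1 k).

Lemma dvdp_deriv D A n : D ^+ n %| A -> D ^+ n.-1 %| A^`().
Proof.
move=> /dvdpP [Q ->]; rewrite derivM; apply: dvdp_add; apply: dvdp_mull.
  by rewrite dvdp_exp2l // leq_pred.
by rewrite deriv_exp -mulrnAl dvdp_mull.
Qed.

(** The Wronskian is divisible by X^(a-1) and Z^(c-1), while the size bound on B keeps its degree
    below 2 d - b. A gap of at least 2 leaves no room for a nonzero one. *)
Lemma wronskian_eq0 a b c d A B : elt a b c d A B -> (2 * d + 2 <= a + b + c)%N ->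
  A * B^`() = A^`() * B.
Proof.
move=> [h1 h2 h3 h4] hd; apply/eqP; rewrite -subr_eq0; apply/negPn/negP => w0.
set w : {poly k} := A * _ - _ in w0.
have dX : 'X^(a.-1) %| w.
  apply: dvdp_sub; last by rewrite dvdp_mulr // dvdp_deriv.
  by rewrite dvdp_mulr // (dvdp_trans _ h1) // dvdp_exp2l // leq_pred.
have dZ : xp1 ^+ c.-1 %| w.
  have -> : w = A * (A + B)^`() - A^`() * (A + B).
    by rewrite derivD /w; ring.
  apply: dvdp_sub; first by rewrite dvdp_mull // dvdp_deriv.
  by rewrite dvdp_mull // (dvdp_trans _ h2) // dvdp_exp2l // leq_pred.
have : 'X^(a.-1) * xp1 ^+ c.-1 %| w by rewrite Gauss_dvdp ?dX ?dZ // X_xp1_coprime.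
move/(fdvdp_leq w0); rewrite fsizeM ?expf_neq0 ?polyX_eq0 ?xp1_neq0 //.
rewrite size_polyXn size_xp1X => lw.
have B0 : B != 0 by apply: contraNneq w0 => B0; rewrite /w B0 deriv0 !mulr0 subr0.
have A0 : A != 0 by apply: contraNneq w0 => A0; rewrite /w A0 deriv0 !mul0r subr0.
have sB : (0 < size B)%N by rewrite fsize_gt0.
have sB' := lt_size_deriv B0; have sA' := lt_size_deriv A0.
have b1 : (size (A * B^`())%R <= d + (d - b))%N by apply: size_mul_le => //; lia.
have b2 : (size (A^`() * B)%R <= d + (d - b))%N.
  by rewrite mulrC addnC; apply: size_mul_le; lia.
have : (size w <= d + (d - b))%N.
  by apply: leq_trans (size_polyD _ _) _; rewrite size_polyN geq_max b1 b2.
by move/(leq_trans lw); lia.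
Qed.

Lemma deriv_eq0_of_dvdp A : A %| A^`() -> A^`() = 0.
Proof.
have [->|A0] := eqVneq A 0; first by rewrite deriv0.
move=> h; apply/eqP; apply/negPn/negP => A'0.
by have := dvdp_leq A'0 h; rewrite leqNgt lt_size_deriv.
Qed.

(** The Wronskian of G a and G b is G^2 times that of a and b. For coprime a and b its vanishing
    makes a divide a', so a' = 0 by degree, and likewise for b. *)
Lemma wronskian_eq0_gcd A B : (A != 0) || (B != 0) -> A * B^`() = A^`() * B ->
  exists G a b, [/\ A = G * a, B = G * b, G != 0 & [/\ coprimep a b, a^`() = 0 & b^`() = 0]].
Proof.
move=> n0 w; set G := gcdp A B.
have G0 : G != 0 by rewrite gcdp_eq0 negb_and.
have eA : A = G * (A %/ G) by rewrite mulrC divpK ?dvdp_gcdl.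
have eB : B = G * (B %/ G) by rewrite mulrC divpK ?dvdp_gcdr.
have cop := coprimep_div_gcd n0; rewrite -/G in cop.
exists G, (A %/ G), (B %/ G); move: (A %/ G) (B %/ G) eA eB cop => a b eA eB cop.
have ww : a * b^`() = a^`() * b.
  apply: (mulfI G0); apply: (mulfI G0).
  have : A * B^`() - A^`() * B = G * (G * (a * b^`())) - G * (G * (a^`() * b)).
    by rewrite eA eB !derivM; ring.
  by rewrite w subrr => /esym/eqP; rewrite subr_eq0 => /eqP.
split=> //; split=> //; apply: deriv_eq0_of_dvdp.
  by rewrite -(Gauss_dvdpl _ cop) -ww dvdp_mulr.
by rewrite -(@Gauss_dvdpr _ _ a) 1?coprimep_sym // ww dvdp_mull.
Qed.

Lemma root_multiplicities G : G != 0 -> exists g1 g3 G', 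
  [/\ G = 'X^g1 * xp1 ^+ g3 * G', coprimep 'X G', coprimep xp1 G' & (g1 + g3 < size G)%N].
Proof.
move=> G0; have [g1 [G1]] := multiplicity_XsubC G 0.
rewrite G0 subr0 /= => r1 e1.
have G10 : G1 != 0 by apply: contraNneq G0 => e; rewrite e1 e mul0r.
have [g3 [G2]] := multiplicity_XsubC G1 (-1).
rewrite G10 /= => r2 e2; exists g1, g3, G2.
have G20 : G2 != 0 by apply: contraNneq G10 => e; rewrite e2 e mul0r.
have eG : G = 'X^g1 * xp1 ^+ g3 * G2 by rewrite e1 e2 /xp1; ring.
split=> //.
- rewrite coprimep_sym -['X]subr0 coprimep_XsubC.
  by apply: contra r1; rewrite e2 rootM => ->.
- by rewrite coprimep_sym coprimep_XsubC.
- rewrite eG !fsizeM ?mulf_neq0 ?expf_neq0 ?polyX_eq0 ?xp1_neq0 //.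
  rewrite size_polyXn size_xp1X; move: G20; rewrite -fsize_gt0; lia.
Qed.

Section Descent.
Variable p : nat.
Hypothesis pcharp : p \in [pchar k].

Let p_gt0 : (0 < p)%N. Proof. by rewrite prime_gt0 // (pcharf_prime pcharp). Qed.

(** Composition with X^p replaces a p-th power, so no p-th roots of coefficients are taken and k may
    be imperfect. *)
Lemma deriv_eq0_comp_Xn A : A^`() = 0 -> exists a, A = a \Po 'X^p.
Proof.
move=> dA; exists (\poly_(i < size A) A`_(p * i)); apply/polyP => i.
rewrite coef_comp_poly_Xn //; case: ifP => [/dvdnP [j ->]|ndv].
  rewrite mulnK // coef_poly; case: ltnP => hj; first by rewrite mulnC.
  by rewrite nth_default // (leq_trans hj) // leq_pmulr.
case: i ndv => [|i] ndv; first by rewrite dvdn0 in ndv.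
have := congr1 (fun q : {poly k} => q`_i) dA; rewrite coef_deriv coef0.
move/eqP; rewrite -mulr_natr mulf_eq0 -(dvdn_pcharf pcharp) ndv orbF.
by move/eqP.
Qed.

(** Pulling back along X^p multiplies the multiplicity of a root fixed by Frobenius by p; the
    hypothesis on u says that u is at most the ceiling of m / p. The roots that matter are 0 and
    -1. *)
Lemma dvdp_comp_Xn (x : k) a m u : x ^+ p = x -> (p * u < m + p)%N ->
  ('X - x%:P) ^+ m %| a \Po 'X^p -> ('X - x%:P) ^+ u %| a.
Proof.
move=> xp; elim: u => [|u IH] hu dv; first by rewrite expr0 dvd1p.
have /dvdpP [b eb] : ('X - x%:P) ^+ u %| a by apply: IH => //; lia.
have Xp : ('X - x%:P) \Po 'X^p = ('X - x%:P) ^+ p.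
  rewrite comp_polyB comp_polyX comp_polyC -{1}xp polyC_exp.
  have := frob_polyD pcharp ('X - x%:P) x%:P; rewrite subrK => ->.
  by rewrite addrK.
rewrite eb exprSr [b * _]mulrC dvdp_mul2l ?expf_neq0 ?polyXsubC_eq0 //.
move: dv; rewrite eb rmorphM rmorphXn /= Xp -exprM.
have [v ->] : exists v, m = (p * u + v.+1)%N by exists (m - p * u).-1; lia.
rewrite exprD [X in _ %| X]mulrC dvdp_mul2l ?expf_neq0 ?polyXsubC_eq0 // => dv.
have : ('X - x%:P) %| b \Po 'X^p.
  by apply: dvdp_trans dv; rewrite exprS dvdp_mulr.
by rewrite !dvdp_XsubCl !rootE horner_comp hornerXn xp.
Qed.

(* The gap function is governed by its values on p Z^3: a gap at least 2 forces
   the Wronskian to vanish, so the syzygy is, up to a common factor, a p-th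
   Frobenius pullback. *)
Lemma gapge_descent a b c m : (2 <= m)%N -> gapge k a b c m ->
  exists u v w M, gapge k u v w M /\
  (m + ((a - p * u) + (p * u - a)) + ((b - p * v) + (p * v - b))
     + ((c - p * w) + (p * w - c)) <= p * M)%N.
Proof.
move=> m2 [d [A [B [[h1 h2 h3 h4] n0 hd]]]].
have w0 : A * B^`() = A^`() * B.
  by apply: (@wronskian_eq0 a b c d) => //; lia.
have [G [a0 [b0 [eA eB G0 [cop /deriv_eq0_comp_Xn [a1 ea] /deriv_eq0_comp_Xn [b1 eb]]]]]]
  := wronskian_eq0_gcd n0 w0.
have [g1 [g3 [G' [eG cX cZ sG]]]] := root_multiplicities G0.
have sXn : (size ('X^p : {poly k})).-1 = p by rewrite size_polyXn.
have sa : a0 != 0 -> (size G + p * (size a1).-1 <= d.+1)%N.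
  move=> a00; have := h3; rewrite eA fsizeM //.
  have := fsize_comp a1 'X^p; rewrite -ea sXn mulnC => <-.
  by move: a00; rewrite -fsize_gt0; clear; lia.
have sb : b0 != 0 -> (size G + p * (size b1).-1 + b <= d.+1)%N.
  move=> b00; have := h4; rewrite eB fsizeM //.
  have := fsize_comp b1 'X^p; rewrite -eb sXn mulnC => <-.
  by move: b00; rewrite -fsize_gt0; move: G0; rewrite -fsize_gt0; clear; lia.
have n1 : (a0 != 0) || (b0 != 0).
  by move: n0; rewrite eA eB !mulf_eq0 (negPf G0).
have na : (a1 == 0) = (a0 == 0) by rewrite ea comp_poly_eq0 // size_polyXn ltnS.
have nb : (b1 == 0) = (b0 == 0) by rewrite eb comp_poly_eq0 // size_polyXn ltnS.
(* The degree in which a1 and b1 are read as forms; their pullbacks then have degree p e. *)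
pose e := maxn (size a1).-1 (size b1).-1.
have se : (size G + p * e <= d.+1)%N.
  have [e1|e1] : e = (size a1).-1 \/ e = (size b1).-1.
  - by rewrite /e /maxn; case: ifP; [right|left].
  - rewrite e1; have [a00|a00] := eqVneq a0 0; last exact: sa.
    have a10 : a1 = 0 by apply/eqP; rewrite na a00.
    have b00 : b0 != 0 by move: n1; rewrite a00 eqxx.
    by rewrite a10 size_poly0 muln0 addn0 (leq_trans _ (sb b00)) // -addnA leq_addr.
  - rewrite e1; have [b00|b00] := eqVneq b0 0; last exact: leq_trans (leq_addr _ _) (sb b00).
    have b10 : b1 = 0 by apply/eqP; rewrite nb b00.
    have a00 : a0 != 0 by move: n1; rewrite b00 eqxx orbF.
    by rewrite b10 size_poly0 muln0 addn0 (leq_trans _ (sa a00)) // leq_addr.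
(* The exponent of Y in the common factor: what remains of d after deg G and p e. It is invisible at
   Y = 1. *)
pose g2 := (d.+1 - size G - p * e)%N.
pose ceil j := ((j + p.-1) %/ p)%N.
have ceilP j : (j <= p * ceil j)%N && (p * ceil j < j + p)%N.
  exact: ceil_divn.
have X0 : ('X : {poly k}) = 'X - 0%:P by rewrite subr0.
have d1 : 'X^(ceil (a - g1)%N) %| a1.
  rewrite X0; apply: (@dvdp_comp_Xn _ _ (a - g1)%N); first by rewrite expr0n -[(p == 0)%N]negbK -lt0n p_gt0.
    by have /andP[] := ceilP (a - g1)%N.
  rewrite -ea -X0; have [le|lt] := leqP a g1.
    by rewrite (eqP (_ : a - g1 == 0)%N) ?expr0 ?dvd1p // subn_eq0.
  move: h1; rewrite eA eG -{1}(subnKC (ltnW lt)) exprD -!mulrA.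
  rewrite dvdp_mul2l ?expf_neq0 ?polyX_eq0 //.
  rewrite Gauss_dvdpr ?X_xp1_coprime // Gauss_dvdpr //.
  by apply: coprimep_expl.
have d3 : xp1 ^+ ceil (c - g3)%N %| a1 + b1.
  apply: (@dvdp_comp_Xn _ _ (c - g3)%N).
  - have [e2|o2] := boolP (odd p); first by rewrite -signr_odd e2 expr1.
    have p2 : p = 2 by case: (even_prime (pcharf_prime pcharp)) => // op; rewrite op in o2.
    have /eqP := pcharf0 pcharp; rewrite p2 natrD => /eqP e1.
    by rewrite -signr_odd /= expr0; apply/eqP; rewrite -subr_eq0 opprK -e1.
  - by have /andP[] := ceilP (c - g3)%N.
  rewrite comp_polyD -ea -eb -/(xp1); have [le|lt] := leqP c g3.
    by rewrite (eqP (_ : c - g3 == 0)%N) ?expr0 ?dvd1p // subn_eq0.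
  move: h2; rewrite eA eB -mulrDr eG -{1}(subnKC (ltnW lt)) exprD.
  rewrite ['X^_ * _]mulrC -!mulrA dvdp_mul2l ?expf_neq0 ?xp1_neq0 //.
  rewrite Gauss_dvdpr; last by rewrite coprimep_sym X_xp1_coprime.
  by rewrite Gauss_dvdpr //; apply: coprimep_expl.
have /andP[cx1 cx2] := ceilP (a - g1)%N.
have /andP[cy1 cy2] := ceilP (b - g2)%N.
have /andP[cz1 cz2] := ceilP (c - g3)%N.
have hA := @descent_arith p a b c d m e g1 g3 (size G) (ceil (a - g1)%N) (ceil (b - g2)%N)
  (ceil (c - g3)%N) p_gt0 sG se hd cx1 cy1 cz1.
exists (ceil (a - g1)%N), (ceil (b - g2)%N), (ceil (c - g3)%N),
  (ceil (a - g1) + ceil (b - g2) + ceil (c - g3) - 2 * e)%N; split; last by case: hA.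
exists e, a1, b1; split; [|by rewrite na nb|by case: hA => h _; rewrite subnKC].
split=> //; first by rewrite (leq_trans (leqSpred _)) // ltnS /e leq_maxl.
have [b10|b10] := eqVneq b1 0; first by rewrite b10 size_poly0.
have b00 : b0 != 0 by rewrite -nb.
have sb1 : (0 < size b1)%N by rewrite fsize_gt0.
have le_e : ((size b1).-1 <= e)%N by rewrite /e leq_maxr.
by apply: (@descent_size p b d e (size G)) => //; exact: sb.
Qed.
End Descent.

(** A syzygy with zero Wronskian is G times a pair of constants a', b'. At least two of a', b', a' +
    b' are nonzero, so two of X^t, Y^t, Z^t divide G as a form of degree d; thus 2 t <= d, which
    contradicts 2 d + 2 <= 3 t. *)
Lemma char0_gapge t : [pchar k] =i pred0 -> ~ gapge k t t t 2.
Proof.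
move=> ch [d [A [B [[h1 h2 h3 h4] n0 hd]]]].
have w0 : A * B^`() = A^`() * B.
  by apply: (@wronskian_eq0 t t t d) => //; lia.
have [G [a [b [eA eB G0 [cop da db]]]]] := wronskian_eq0_gcd n0 w0.
have cst q : q^`() = 0 -> q = (q`_0)%:P.
  move=> dq; apply/polyP => [[|i]]; rewrite coefC //=.
  have := congr1 (fun q : {poly k} => q`_i) dq; rewrite coef_deriv coef0 => /eqP.
  by rewrite -mulr_natr mulf_eq0 (pcharf0P k).1 //= orbF => /eqP.
move: (cst _ da) (cst _ db) eA eB; move: (a`_0) (b`_0) => {}a' b' -> -> eA eB.
have sXZ : 'X^t * xp1 ^+ t %| G -> (2 * t < size G)%N.
  move/(fdvdp_leq G0); rewrite fsizeM ?expf_neq0 ?polyX_eq0 ?xp1_neq0 //.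
  by rewrite size_polyXn size_xp1X; lia.
have sX : 'X^t %| G -> (t < size G)%N by move/(fdvdp_leq G0); rewrite size_polyXn.
have sZ : xp1 ^+ t %| G -> (t < size G)%N by move/(fdvdp_leq G0); rewrite size_xp1X.
have mC c : c != 0 -> forall D, (D %| G * c%:P) = (D %| G).
  by move=> c0 D; rewrite mulrC mul_polyC dvdpZr.
have mS c : c != 0 -> size (G * c%:P) = size G.
  by move=> c0; rewrite mulrC mul_polyC size_scale.
move: h2; rewrite eA eB -mulrDr -polyCD => h2.
rewrite eA in h1 h3; rewrite eB in h4; rewrite eA eB in n0.
have [b0|b0] := eqVneq b' 0.
  rewrite b0 mulr0 eqxx orbF mulf_eq0 polyC_eq0 negb_or in n0.
  have /andP[_ a0] := n0; rewrite b0 addr0 in h2; move: h1 h2 h3.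
  rewrite !mC // mS // => h1 h2 h3.
  by have := sXZ; rewrite Gauss_dvdp ?X_xp1_coprime // h1 h2 => /(_ isT); lia.
move: h4; rewrite mS // => h4.
have [a0|a0] := eqVneq a' 0; last by move: h1; rewrite mC // => /sX; lia.
by move: h2; rewrite a0 add0r mC // => /sZ; lia.
Qed.
End Wronskian.

(** * Syzygies of (X^t, Y^t, Z^t) *)

Section DiagonalSyzygies.
Variable k : fieldType.
Implicit Types (c p q r s : {poly k}) (t m : nat).
Local Notation xp1 := (xp1 k).

Definition mz : {poly k} := - xp1.

(* (p, qof t p s, s) is a syzygy of (X^t, Y^t, Z^t); its components are forms of
   degree m in [dsyz t m p s]. Their values at the points X = 0, Y = 0 and Z = 0 are
   p.[0], vY t m p s and s.[-1]: they vanish when X | p, Y | q and Z | s. *)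
Definition qof t p s := - (p * 'X^t + s * mz ^+ t).

Definition dsyz t m p s : Prop :=
  [/\ (size p <= m.+1)%N, (size s <= m.+1)%N & (size (qof t p s) <= m.+1)%N].

Definition vY t m p s : k := (qof t p s)`_m.

Lemma qofD t c1 c2 p1 s1 p2 s2 :
  qof t (c1 * p1 + c2 * p2) (c1 * s1 + c2 * s2) = c1 * qof t p1 s1 + c2 * qof t p2 s2.
Proof. by rewrite /qof; ring. Qed.

Lemma mz_neq0 : mz != 0. Proof. by rewrite /mz oppr_eq0 xp1_neq0. Qed.

Lemma mzX t : mz ^+ t = (-1) ^+ t *: xp1 ^+ t.
Proof. by rewrite /mz -mul_polyC polyC_exp polyCN polyC1 -exprNn. Qed.

Lemma size_mzX t : size (mz ^+ t) = t.+1.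
Proof. by rewrite mzX size_scale ?signr_eq0 // size_xp1X. Qed.

Lemma coefM_top i j p q : (size p <= i.+1)%N -> (size q <= j.+1)%N ->
  (p * q)`_(i + j) = p`_i * q`_j.
Proof.
move=> hp hq; have hi : (i < (i + j).+1)%N by lia.
rewrite coefM (bigD1 (Ordinal hi)) //= addKn big1 ?addr0 // => l nl.
have : nat_of_ord l != i by apply: contra nl => /eqP e; apply/eqP/val_inj.
rewrite neq_ltn => /orP[lt|gt].
  by rewrite [q`__]nth_default ?mulr0 // (leq_trans hq) //; lia.
by rewrite nth_default ?mul0r // (leq_trans hp).
Qed.

Lemma dsyz_comb t m m1 m2 c1 c2 p1 s1 p2 s2 :
  dsyz t m1 p1 s1 -> dsyz t m2 p2 s2 -> (m1 <= m)%N -> (m2 <= m)%N ->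
  (size c1 <= (m - m1).+1)%N -> (size c2 <= (m - m2).+1)%N ->
  dsyz t m (c1 * p1 + c2 * p2) (c1 * s1 + c2 * s2) /\
  vY t m (c1 * p1 + c2 * p2) (c1 * s1 + c2 * s2) =
    c1`_(m - m1) * vY t m1 p1 s1 + c2`_(m - m2) * vY t m2 p2 s2.
Proof.
move=> [a1 a2 a3] [b1 b2 b3] l1 l2 h1 h2.
have sz (u v : {poly k}) : (size u <= m1.+1)%N -> (size v <= m2.+1)%N ->
    (size (c1 * u + c2 * v)%R <= m.+1)%N.
  move=> hu hv; apply: leq_trans (size_polyD _ _) _; rewrite geq_max.
  apply/andP; split; [apply: leq_trans (size_mul_le h1 hu) _|apply: leq_trans (size_mul_le h2 hv) _];
    by rewrite addnS subnK.
split; first by split; rewrite ?qofD; apply: sz.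
rewrite /vY qofD coefD -{1}(subnK l1) -{2}(subnK l2) !coefM_top //.
Qed.

Lemma dsyz_shift t m j p s : dsyz t m p s -> dsyz t (m + j) ('X^j * p) ('X^j * s) /\
  vY t (m + j) ('X^j * p) ('X^j * s) = vY t m p s.
Proof.
move=> h; have := @dsyz_comb t (m + j) m m 'X^j 0 p s p s h h.
rewrite !mul0r !addr0 coef0 mul0r addr0 addKn coefXn eqxx mul1r.
by apply; rewrite ?leq_addr ?size_polyXn ?size_poly0.
Qed.

(** Take A = p X^t, B = q Y^t. A syzygy with entries of degree m has degree t + m, so the term 3 t
    in the gap condition drops to t; each zero at a point raises the matching exponent by one. *)
Lemma dsyz_gapge t m p s (i j l : bool) M :
  dsyz t m p s -> (p != 0) || (s != 0) ->
  (i -> p.[0] = 0) -> (j -> vY t m p s = 0) -> (l -> s.[-1] = 0) ->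
  (2 * m + M <= t + i + j + l)%N -> gapge k (t + i) (t + j) (t + l) M.
Proof.
move=> [h1 h2 h3] n0 hi hj hl hM.
exists (t + m)%N, (p * 'X^t), (qof t p s); split; last by lia.
  split.
  - rewrite addnC exprD dvdp_mul2r ?expf_neq0 ?polyX_eq0 //.
    case: i hi {hM} => /= hi; last by rewrite expr0 dvd1p.
    by rewrite expr1 -['X]subr0 dvdp_XsubCl; apply/eqP/hi.
  - have -> : p * 'X^t + qof t p s = - (s * mz ^+ t) by rewrite /qof; ring.
    rewrite dvdpNr mzX -scalerAr dvdpZr ?signr_eq0 //.
    rewrite addnC exprD dvdp_mul2r ?expf_neq0 ?xp1_neq0 //.
    case: l hl {hM} => /= hl; last by rewrite expr0 dvd1p.
    by rewrite expr1 dvdp_XsubCl; apply/eqP/hl.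
  - by rewrite mulrC -addnS size_mul_le ?size_polyXn.
  - rewrite -addnS subnDl; case: j hj {hM} => /= hj; last by rewrite subn0.
    rewrite subn1 /=; apply/leq_sizeP => u; rewrite leq_eqVlt => /orP[/eqP <-|lt].
      exact: hj.
    by rewrite nth_default // (leq_trans h3).
have [p0|p0] := eqVneq p 0; last by rewrite mulf_neq0 ?expf_neq0 ?polyX_eq0.
rewrite p0 eqxx /= in n0; rewrite /qof p0 mul0r eqxx add0r /=.
by rewrite oppr_eq0 mulf_neq0 ?expf_neq0 ?mz_neq0.
Qed.

Lemma gapge_dsyz t (i j l : bool) M : gapge k (t + i) (t + j) (t + l) M ->
  exists m p s, [/\ dsyz t m p s, (p != 0) || (s != 0), (2 * m + M <= t + i + j + l)%N
    & [/\ i -> p.[0] = 0, j -> vY t m p s = 0 & l -> s.[-1] = 0]].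
Proof.
move=> [d [A [B [[h1 h2 h3 h4] n0 hd]]]].
have /dvdpP [p eA] : 'X^t %| A by apply: dvdp_trans h1; rewrite dvdp_exp2l ?leq_addr.
have /dvdpP [s0 eB] : xp1 ^+ t %| A + B by apply: dvdp_trans h2; rewrite dvdp_exp2l ?leq_addr.
pose s := - ((-1) ^+ t *: s0).
have eB' : A + B = - (s * mz ^+ t).
  rewrite eB /s mzX mulNr opprK -scalerAr -scalerAl scalerA -expr2 -exprM mulnC exprM.
  by rewrite sqrrN expr1n expr1n scale1r.
have eq : B = qof t p s.
  rewrite /qof; apply: (addrI A); rewrite eB' eA; ring.
(* In degree below t, divisibility by X^t and Y^t forces A = B = 0. *)
have ltd : (t <= d)%N.
  rewrite leqNgt; apply/negP => lt.
  have A0 : A = 0.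
    apply/eqP/negPn/negP => A0; have := fdvdp_leq A0 h1; rewrite size_polyXn.
    by move: h3 lt; clear; lia.
  have B0 : B = 0 by apply/eqP; rewrite -size_poly_leq0 (leq_trans h4) //; move: lt; clear; lia.
  by move: n0; rewrite A0 B0 eqxx.
have szC (u D : {poly k}) : size D = t.+1 -> (size (u * D)%R <= d.+1)%N -> (size u <= (d - t).+1)%N.
  move=> sD; have [->|u0] := eqVneq u 0; first by rewrite size_poly0.
  have D0 : D != 0 by rewrite -fsize_gt0 sD.
  by rewrite fsizeM // sD; move: ltd; clear; lia.
have sAB : (size (A + B)%R <= d.+1)%N.
  apply: leq_trans (size_polyD _ _) _; rewrite geq_max h3 (leq_trans h4) //.
  by rewrite leq_subr.
exists (d - t)%N, p, s; split.
- split; first by apply: (szC _ 'X^t); rewrite ?size_polyXn -?eA.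
    by apply: (szC _ (mz ^+ t)); rewrite ?size_mzX // -size_polyN -eB'.
  by rewrite -eq (leq_trans h4) //; move: ltd; clear; lia.
- apply/negPn/negP; rewrite negb_or !negbK => /andP[/eqP p0 /eqP s_0].
  by move: n0; rewrite eq eA /qof p0 s_0 !mul0r addr0 oppr0 eqxx.
- by move: hd ltd; clear; lia.
split.
- move=> i1; move: h1; rewrite i1 eA addnC exprD dvdp_mul2r ?expf_neq0 ?polyX_eq0 //.
  by rewrite expr1 -{1}['X]subr0 dvdp_XsubCl => /eqP.
- move=> j1; rewrite /vY -eq nth_default // (leq_trans h4) // j1.
  by move: ltd; clear; lia.
- move=> l1; move: h2; rewrite l1 eB' dvdpNr mzX -scalerAr dvdpZr ?signr_eq0 //.
  rewrite addnC exprD dvdp_mul2r ?expf_neq0 ?xp1_neq0 //.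
  by rewrite expr1 dvdp_XsubCl => /eqP.
Qed.

(** The Hilbert-Burch condition: the 2x2 minors are kap times X^t, Y^t, Z^t. Only the minor for Y^t
    is recorded, a constant because Y = 1; the other two follow from [qof]. *)
Definition dbasis t m1 p1 s1 m2 p2 s2 (kap : k) : Prop :=
  [/\ (m1 + m2)%N = t, dsyz t m1 p1 s1, dsyz t m2 p2 s2, kap != 0
    & s1 * p2 - s2 * p1 = kap%:P].

Lemma dbasis_swap t m1 p1 s1 m2 p2 s2 kap :
  dbasis t m1 p1 s1 m2 p2 s2 kap -> dbasis t m2 p2 s2 m1 p1 s1 (- kap).
Proof.
move=> [h1 h2 h3 h4 h5]; split; rewrite ?oppr_eq0 // 1?addnC //.
by rewrite polyCN -h5 opprB.
Qed.

(* Consecutive rows of the extended Euclidean algorithm on X^t and (-1-X)^t,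
   stopped when the degrees of cofactors and remainders cross. *)
Lemma dbasis_euclid t n p s p' s' (kap : k) :
  let r := p * 'X^t + s * mz ^+ t in let r' := p' * 'X^t + s' * mz ^+ t in
  (size r' <= n)%N -> (size r' < size r)%N -> (size r <= t.+1)%N ->
  [/\ (size p <= t.+2 - size r)%N, (size s <= t.+2 - size r)%N,
      (size p' <= t.+2 - size r)%N & (size s' <= t.+2 - size r)%N] ->
  (size p <= size r)%N -> (size s <= size r)%N -> kap != 0 -> s * p' - s' * p = kap%:P ->
  exists m1 p1 s1 m2 p2 s2 kap', dbasis t m1 p1 s1 m2 p2 s2 kap'.
Proof.
elim: n p s p' s' kap => [|n IH] p s p' s' kap r r' hn hr hrt [b1 b2 b3 b4] sp ss k0 det;
  have [stop|go] := leqP (size r') (t.+2 - size r)%N.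
- exists (size r).-1, p, s, (t.+1 - size r)%N, p', s', kap; split=> //; first by lia.
    split; rewrite ?prednK //; try lia.
    by rewrite /qof fsizeN -/r; lia.
  by split; try lia; rewrite /qof fsizeN -/r'; lia.
- lia.
- exists (size r).-1, p, s, (t.+1 - size r)%N, p', s', kap; split=> //; first by lia.
    split; rewrite ?prednK //; try lia.
    by rewrite /qof fsizeN -/r; lia.
  by split; try lia; rewrite /qof fsizeN -/r'; lia.
have r'0 : r' != 0 by rewrite -fsize_gt0; lia.
(* One division step; it changes the determinant only by a sign and keeps the cofactor bounds
   relative to the new first remainder. *)
pose c := r %/ r'; pose p'' := p - c * p'; pose s'' := s - c * s'.
have er : p'' * 'X^t + s'' * mz ^+ t = r %% r'.
  rewrite -[r %% r'](addKr (r %/ r' * r')) -divp_eq -/c /p'' /s'' /r /r'; ring.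
have sc : size c = (size r - (size r').-1)%N by exact: size_divp.
have szc (u v : {poly k}) : (size u <= t.+2 - size r)%N -> (size v <= t.+2 - size r)%N ->
    (size (u - c * v)%R <= t.+2 - size r')%N.
  move=> hu hv; apply: leq_trans (size_polyD _ _) _; rewrite size_polyN geq_max.
  apply/andP; split; first lia.
  have -> : (t.+2 - size r' = (size r - size r') + (t.+2 - size r))%N by lia.
  by apply: size_mul_le => //; rewrite sc; lia.
have sr'' : (size (p'' * 'X^t + s'' * mz ^+ t)%R < size r')%N.
  by rewrite er ltn_modpN0.
apply: (IH p' s' p'' s'' (- kap)) => //; rewrite -/r'; try lia.
- by split; [lia|lia|exact: szc|exact: szc].
- by rewrite oppr_eq0.
- by rewrite polyCN -det /p'' /s''; ring.
Qed.

Lemma dbasis_exists t : exists m1 p1 s1 m2 p2 s2 kap,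
  dbasis t m1 p1 s1 m2 p2 s2 kap /\ (m1 <= m2)%N.
Proof.
have [m1 [p1 [s1 [m2 [p2 [s2 [kap h]]]]]]] : exists m1 p1 s1 m2 p2 s2 kap,
    dbasis t m1 p1 s1 m2 p2 s2 kap.
  have e1 : 0 * 'X^t + 1 * mz ^+ t = mz ^+ t :> {poly k} by rewrite mul0r mul1r add0r.
  have sr' : (size (1 * 'X^t + (- ((-1) ^+ t)%:P) * mz ^+ t)%R <= t)%N.
    (* The sign makes the leading coefficients cancel, so the second remainder starts with degree
       below t. *)
    have -> : 1 * 'X^t + (- ((-1) ^+ t)%:P) * mz ^+ t = 'X^t - xp1 ^+ t.
      rewrite mul1r mzX mulNr mul_polyC scalerA -expr2 -exprM mulnC exprM.
      by rewrite sqrrN expr1n expr1n scale1r.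
    apply/leq_sizeP => j; rewrite leq_eqVlt => /orP[/eqP <-|lt].
      rewrite coefB coefXn eqxx.
      have /monicP : xp1 ^+ t \is monic by rewrite monic_exp // monicXsubC.
      by rewrite /lead_coef size_xp1X /= => ->; rewrite subrr.
    by rewrite coefB coefXn gtn_eqF // nth_default ?subrr // size_xp1X.
  apply: (@dbasis_euclid t t 0 1 1 (- ((-1) ^+ t)%:P) 1); rewrite ?e1 ?size_mzX //.
  - by rewrite size_poly0 size_poly1 size_polyN size_polyC; split; rewrite ?subSnn // leq_b1.
  - by rewrite size_poly0.
  - by rewrite size_poly1.
  - by rewrite oner_eq0.
  - by rewrite mulr0 subr0 mulr1.
have [le|lt] := leqP m1 m2; first by exists m1, p1, s1, m2, p2, s2, kap.
exists m2, p2, s2, m1, p1, s1, (- kap); split; [exact: dbasis_swap|exact: ltnW].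
Qed.
End DiagonalSyzygies.

(** * The cyclic symmetry of the syzygies *)

Section Rotation.
Variable k : fieldType.
Implicit Types (a b c p q r s : {poly k}) (t m : nat).
Local Notation xp1 := (xp1 k).
Local Notation mz := (mz k).

(* The substitution X -> Y -> Z -> X with X + Y + Z = 0 on forms of degree m,
   in the dehomogenization Y = 1. *)
Definition rot m a : {poly k} := \sum_(i < m.+1) a`_i *: mz ^+ (m - i).

Lemma rotD m a b : rot m (a + b) = rot m a + rot m b.
Proof.
by rewrite /rot -big_split; apply: eq_bigr => i _; rewrite coefD scalerDl.
Qed.

Lemma rotN m a : rot m (- a) = - rot m a.
Proof.
by rewrite /rot -sumrN; apply: eq_bigr => i _; rewrite coefN scaleNr.
Qed.

Lemma rot_mulX m a : rot m.+1 (a * 'X) = rot m a.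
Proof.
rewrite /rot big_ord_recl coefMX /= scale0r add0r.
by apply: eq_bigr => i _; rewrite coefMX /= subSS.
Qed.

Lemma rot_up m a : (size a <= m.+1)%N -> rot m.+1 a = mz * rot m a.
Proof.
move=> sa; rewrite /rot big_ord_recr /= nth_default // scale0r addr0 mulr_sumr.
by apply: eq_bigr => i _; rewrite -scalerAr -exprS subSn // -ltnS.
Qed.

Lemma rot_mulmz m a : (size a <= m.+1)%N -> rot m.+1 (a * mz) = 'X * rot m a.
Proof.
move=> sa; have -> : a * mz = - (a * 'X) + - a by rewrite /mz xp1E; ring.
by rewrite rotD !rotN rot_mulX rot_up // /mz xp1E; ring.
Qed.

Lemma size_mulX_le m j a (D : {poly k}) : (size D <= 2)%N -> (size a <= m.+1)%N ->
  (size (a * D ^+ j)%R <= (m + j).+1)%N.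
Proof.
move=> sD sa; elim: j => [|j IH]; first by rewrite expr0 mulr1 addn0.
by rewrite exprSr mulrA mulrC addnS -add1n size_mul_le.
Qed.

Lemma size_mz : size mz = 2. Proof. by rewrite -[mz]expr1 size_mzX. Qed.

Lemma rot_mulXn m t a : rot (m + t) (a * 'X^t) = rot m a.
Proof.
elim: t => [|t IH]; first by rewrite expr0 mulr1 addn0.
by rewrite exprSr mulrA addnS rot_mulX.
Qed.

Lemma rot_upn m t a : (size a <= m.+1)%N -> rot (m + t) a = mz ^+ t * rot m a.
Proof.
move=> sa; elim: t => [|t IH]; first by rewrite expr0 mul1r addn0.
by rewrite addnS rot_up ?IH ?mulrA ?exprS // (leq_trans sa) // ltnS leq_addr.
Qed.

Lemma rot_mulmzn m t a : (size a <= m.+1)%N -> rot (m + t) (a * mz ^+ t) = 'X^t * rot m a.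
Proof.
move=> sa; elim: t => [|t IH]; first by rewrite expr0 mulr1 mul1r addn0.
rewrite exprSr mulrA addnS rot_mulmz ?IH; first by rewrite mulrA -exprS.
by rewrite size_mulX_le // size_mz.
Qed.

Lemma size_rot m a : (size (rot m a) <= m.+1)%N.
Proof.
apply: leq_trans (size_sum _ _ _) _; apply/bigmax_leqP => i _.
apply: leq_trans (size_scale_leq _ _) _; rewrite size_mzX; lia.
Qed.

Lemma mz_horner x : mz.[x] = - (x + 1).
Proof. by rewrite /mz xp1E !hornerE. Qed.

Lemma rot_horner0 m a : (size a <= m.+1)%N -> (rot m a).[0] = (-1) ^+ m * a.[-1].
Proof.
move=> sa; rewrite (horner_coef_wide _ sa) mulr_sumr /rot horner_sum.
apply: eq_bigr => i _; rewrite hornerZ horner_exp mz_horner add0r mulrCA.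
congr (_ * _); have le : (i <= m)%N by rewrite -ltnS.
move: (nat_of_ord i) le => j le.
by rewrite -{2}(subnK le) exprD -mulrA -exprD addnn -mul2n exprM sqrrN !expr1n mulr1.
Qed.

Lemma rot_hornerN1 m a : (rot m a).[-1] = a`_m.
Proof.
rewrite /rot horner_sum big_ord_recr /= subnn expr0 hornerZ hornerC mulr1.
rewrite big1 ?add0r // => i _; rewrite hornerZ horner_exp mz_horner addNr oppr0.
by rewrite expr0n subn_eq0 leqNgt ltn_ord mulr0.
Qed.

Lemma rot_lead m a : (rot m a)`_m = (-1) ^+ m * a.[0].
Proof.
rewrite /rot coef_sum big_ord_recl /= subn0 coefZ horner_coef0.
have -> : (mz ^+ m)`_m = (-1) ^+ m.
  rewrite mzX coefZ.
  have /monicP : xp1 ^+ m \is monic by rewrite monic_exp // monicXsubC.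
  by rewrite /lead_coef size_xp1X /= => ->; rewrite mulr1.
rewrite big1 ?addr0; first by rewrite mulrC.
by move=> i _; rewrite coefZ [X in _ * X]nth_default ?mulr0 // size_mzX /bump; have := ltn_ord i; move: (nat_of_ord i) => j; clear; lia.
Qed.

Lemma rot_eq0 m a : (size a <= m.+1)%N -> rot m a = 0 -> a = 0.
Proof.
elim: m a => [|m IH] a sa h.
  have := rot_hornerN1 0 a; rewrite h horner0 => a0.
  by rewrite [a]size1_polyC // -a0.
have sa' : (size a <= m.+1)%N.
  apply/leq_sizeP => j; rewrite leq_eqVlt => /orP[/eqP <-|lt].
    by rewrite -rot_hornerN1 h horner0.
  by rewrite nth_default // (leq_trans sa).
apply: IH => //; move: h; rewrite rot_up // => /eqP.
by rewrite mulf_eq0 (negPf (mz_neq0 k)) => /eqP.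
Qed.

(** Rotation turns p X^t + q Y^t + s Z^t = 0 into a relation with rot s, rot p, rot q in front of
    X^t, Y^t, Z^t. The three values are permuted up to sign. *)
Lemma dsyz_rot t m p s : dsyz t m p s ->
  let p' := rot m s in let s' := rot m (qof t p s) in
  [/\ dsyz t m p' s', p'.[0] = (-1) ^+ m * s.[-1], vY t m p' s' = (-1) ^+ m * p.[0],
      s'.[-1] = vY t m p s & p' = 0 -> s' = 0 -> p = 0 /\ s = 0].
Proof.
move=> [h1 h2 h3] p' s'.
have qE : qof t p' s' = rot m p.
  have e : mz ^+ t * rot m (qof t p s) = - (rot m p + 'X^t * rot m s).
    by rewrite -(rot_upn t h3) -(rot_mulXn m t p) -(rot_mulmzn t h2) -rotD -rotN.
  by rewrite /qof [s' * _]mulrC e /p'; ring.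
split.
- by split; rewrite ?qE size_rot.
- exact: rot_horner0.
- by rewrite /vY qE rot_lead.
- exact: rot_hornerN1.
- move=> /(rot_eq0 h2) s0 /(rot_eq0 h3); rewrite /qof s0 mul0r addr0 => /eqP.
  by rewrite oppr_eq0 mulf_eq0 expf_eq0 polyX_eq0 andbF orbF => /eqP.
Qed.

(** By uniqueness the rotated syzygy is a nonzero multiple of the original one, so the three zero
    conditions are equivalent. *)
Lemma dsyz_symmetric t m p s : dsyz t m p s -> (p != 0) || (s != 0) ->
  (forall p' s', dsyz t m p' s' -> exists c : k, p' = c *: p /\ s' = c *: s) ->
  ((vY t m p s == 0) = (p.[0] == 0)) * ((s.[-1] == 0) = (p.[0] == 0)).
Proof.
move=> h n0 uniq; have [h1 h2 h3 h4 h5] := dsyz_rot h.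
have [c [e1 e2]] := uniq _ _ h1.
have c0 : c != 0.
  apply/negP => /eqP c0; rewrite c0 !scale0r in e1 e2.
  by move: n0; have [-> ->] := h5 e1 e2; rewrite eqxx.
have e3 : s.[-1] == 0 = (p.[0] == 0).
  have := congr1 (fun x : k => x == 0) h2.
  by rewrite e1 hornerZ !mulf_eq0 (negPf c0) signr_eq0.
split; last exact: e3.
by rewrite -e3 -h4 e2 hornerZ mulf_eq0 (negPf c0).
Qed.
End Rotation.

(** * Expansion in a basis and values at the three points *)

Section Structure.
Variable k : fieldType.
Implicit Types (c p q r s : {poly k}) (t m : nat).

(** Cramer's rule. The coefficients are minors for Y^t, whose degree bound at Y = 1 is too large by
    t; multiplied by X^t they become minors with the same degree bound, which gains t. *)
Lemma dbasis_expand t m1 p1 s1 m2 p2 s2 (kap : k) m p s :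
  dbasis t m1 p1 s1 m2 p2 s2 kap -> dsyz t m p s ->
  exists c1 c2, [/\ p = c1 * p1 + c2 * p2, s = c1 * s1 + c2 * s2,
    (size c1 <= m.+1 - m1)%N & (size c2 <= m.+1 - m2)%N].
Proof.
move=> [hm [a1 a2 a3] [b1 b2 b3] k0 det] [d1 d2 d3].
have sz c u v q1 q2 n : c * 'X^t = q1 * u - q2 * v -> (m + n + 1 <= t + (m.+1 - (t - n)))%N ->
    (size q1 <= m.+1)%N -> (size u <= n.+1)%N -> (size q2 <= n.+1)%N -> (size v <= m.+1)%N ->
    (size (kap^-1 *: c) <= m.+1 - (t - n))%N.
  move=> e le l1 l2 l3 l4; rewrite fsizeZ ?invr_eq0 //.
  have [->|c0] := eqVneq c 0; first by rewrite size_poly0.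
  have : (size (c * 'X^t)%R <= m + n + 1)%N.
    rewrite e; apply: leq_trans (size_polyD _ _) _; rewrite size_polyN geq_max addn1 -addnS.
    by rewrite size_mul_le //= mulrC size_mul_le.
  by rewrite fsizeM ?expf_neq0 ?polyX_eq0 // size_polyXn; lia.
exists (kap^-1 *: (s * p2 - s2 * p)), (kap^-1 *: (s1 * p - s * p1)).
have kk x : x = kap^-1 *: (x * kap%:P) by rewrite [x * _]mulrC mul_polyC scalerA mulVf ?scale1r.
split.
- rewrite [LHS]kk -det -!scalerAl -scalerDr; congr (_ *: _); ring.
- rewrite [LHS]kk -det -!scalerAl -scalerDr; congr (_ *: _); ring.
- have -> : (m1 = t - m2)%N by lia.
  apply: (sz _ s2 s (qof t p s) (qof t p2 s2)) => //; last by lia.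
  by rewrite /qof; ring.
- have -> : (m2 = t - m1)%N by lia.
  rewrite -[s1 * p - _]opprK scalerN size_polyN.
  apply: (sz _ s1 s (qof t p s) (qof t p1 s1)) => //; last by lia.
  by rewrite /qof; ring.
Qed.

(** At each point one of the minors X^t, Y^t, Z^t is nonzero. Where Y vanishes, the minor for Y^t
    gives nothing, and the top coefficient of the one for X^t is used. *)
Lemma dbasis_nondegenerate t m1 p1 s1 m2 p2 s2 (kap : k) :
  dbasis t m1 p1 s1 m2 p2 s2 kap ->
  [/\ (p1.[0] != 0) || (p2.[0] != 0), (vY t m1 p1 s1 != 0) || (vY t m2 p2 s2 != 0)
    & (s1.[-1] != 0) || (s2.[-1] != 0)].
Proof.
move=> [hm [a1 a2 a3] [b1 b2 b3] k0 det]; split; rewrite -negb_and; apply: contra k0 => /andP[/eqP e1 /eqP e2].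
- have := congr1 (fun q => q.[0]) det; rewrite !hornerE e1 e2 !mulr0 subr0 => <-.
  by rewrite eqxx.
- have e : kap%:P * 'X^t = qof t p1 s1 * s2 - qof t p2 s2 * s1.
    by rewrite -det /qof; ring.
  have := congr1 (fun q => q`_t) e.
  have c1 := coefM_top a3 b2; have c2 := coefM_top b3 a2.
  rewrite [(m2 + m1)%N]addnC in c2; rewrite hm in c1 c2.
  rewrite mul_polyC coefZ coefXn eqxx mulr1 coefB c1 c2 -/(vY _ _ _ _) -/(vY _ _ _ _).
  by rewrite e1 e2 !mul0r subr0 => ->.
- have := congr1 (fun q => q.[-1]) det; rewrite !hornerE e1 e2 !mul0r subr0 => <-.
  by rewrite eqxx.
Qed.

Lemma dbasis_neq0 t m1 p1 s1 m2 p2 s2 (kap : k) :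
  dbasis t m1 p1 s1 m2 p2 s2 kap -> (p1 != 0) || (s1 != 0).
Proof.
move=> [_ _ _ k0 det]; rewrite -negb_and; apply: contra k0 => /andP[/eqP e1 /eqP e2].
by move: det; rewrite e1 e2 mul0r mulr0 subr0 => /eqP; rewrite eq_sym polyC_eq0.
Qed.

(* [split_basis]: one of the generators lies in the syzygies of
   (X^(t+1), Y^(t+1), Z^(t+1)). [even_type] and [odd_type] are the two normal forms of
   a basis when there is no such generator. *)
Definition split_basis t : Prop := exists m1 p1 s1 m2 p2 s2 (kap : k),
  dbasis t m1 p1 s1 m2 p2 s2 kap /\ [/\ p1.[0] = 0, vY t m1 p1 s1 = 0 & s1.[-1] = 0].

Definition even_type t : Prop := exists m p1 s1 p2 s2 (kap : k),
  [/\ dbasis t m p1 s1 m p2 s2 kap,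
      [/\ p1.[0] = 0, vY t m p2 s2 = 0 & s1.[-1] + s2.[-1] = 0]
    & [/\ p2.[0] != 0, vY t m p1 s1 != 0 & s1.[-1] != 0]].

Definition odd_type t : Prop := exists m p1 s1 p2 s2 (kap : k),
  [/\ dbasis t m p1 s1 m.+1 p2 s2 kap,
      [/\ p1.[0] != 0, vY t m p1 s1 != 0 & s1.[-1] != 0]
    & [/\ p2.[0] = 0, vY t m.+1 p2 s2 = 0 & s2.[-1] = - s1.[-1]]].

Lemma par_trans (a b x y z w : k) : (a != 0) || (b != 0) ->
  a * y = b * x -> a * w = b * z -> x * w = y * z.
Proof.
have [->|a0] := eqVneq a 0.
  rewrite /= !mul0r => b0 /esym/eqP; rewrite mulf_eq0 (negPf b0) => /eqP -> /esym/eqP.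
  by rewrite mulf_eq0 (negPf b0) => /eqP ->; rewrite !mulr0 mul0r.
move=> _ e1 e2; apply: (mulfI a0).
by rewrite mulrCA e2 mulrA [a * (_ * _)]mulrA e1; ring.
Qed.

Lemma dbasis_uniq t m1 p1 s1 m2 p2 s2 (kap : k) :
  dbasis t m1 p1 s1 m2 p2 s2 kap -> (m1 < m2)%N ->
  forall p s, dsyz t m1 p s -> exists c : k, p = c *: p1 /\ s = c *: s1.
Proof.
move=> hb lt p s /(dbasis_expand hb) [c1 [c2 [-> -> h1 h2]]].
have c20 : c2 = 0 by apply/eqP; rewrite -size_poly_leq0 (leq_trans h2) //; lia.
exists c1`_0; rewrite c20 !mul0r !addr0 -!mul_polyC -size1_polyC // (leq_trans h1) //.
lia.
Qed.

Lemma dsyz_lincomb t m p1 s1 p2 s2 (a b : k) : dsyz t m p1 s1 -> dsyz t m p2 s2 ->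
  dsyz t m (a%:P * p1 + b%:P * p2) (a%:P * s1 + b%:P * s2).
Proof.
move=> h1 h2; have [] // := @dsyz_comb _ t m m m a%:P b%:P p1 s1 p2 s2 h1 h2;
  by rewrite ?subnn ?size_polyC_leq1.
Qed.

Lemma dbasis_comb t m p1 s1 p2 s2 (kap a b a' b' : k) :
  dbasis t m p1 s1 m p2 s2 kap -> a * b' - a' * b != 0 ->
  dbasis t m (a%:P * p1 + b%:P * p2) (a%:P * s1 + b%:P * s2)
           m (a'%:P * p1 + b'%:P * p2) (a'%:P * s1 + b'%:P * s2) ((a * b' - a' * b) * kap).
Proof.
move=> [hm h1 h2 k0 det] d0; split=> //.
- exact: dsyz_lincomb.
- exact: dsyz_lincomb.
- by rewrite mulf_neq0.
- by rewrite polyCM -det !(polyCB, polyCM); ring.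
Qed.

Lemma vY_comb t m p1 s1 p2 s2 (a b : k) : dsyz t m p1 s1 -> dsyz t m p2 s2 ->
  vY t m (a%:P * p1 + b%:P * p2) (a%:P * s1 + b%:P * s2) = a * vY t m p1 s1 + b * vY t m p2 s2.
Proof. by move=> _ _; rewrite /vY qofD coefD !coefCM. Qed.

(** Degree m carries a plane of syzygies with three nonzero functionals, the values at the points.
    Rotation permutes their kernels cyclically: if two of these lines coincide, all three do and
    span a split generator; otherwise they are pairwise distinct and can be normalized. *)
Lemma even_case t m p1 s1 p2 s2 (kap : k) : dbasis t m p1 s1 m p2 s2 kap ->
  split_basis t \/ even_type t.
Proof.
move=> hb; have [hm h1 h2 k0 det] := hb.
have [nX nY nZ] := dbasis_nondegenerate hb.
pose P (a b : k) := a%:P * p1 + b%:P * p2; pose S (a b : k) := a%:P * s1 + b%:P * s2.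
have PX a b : (P a b).[0] = a * p1.[0] + b * p2.[0] by rewrite /P !hornerE.
have SZ a b : (S a b).[-1] = a * s1.[-1] + b * s2.[-1] by rewrite /S !hornerE.
have VY a b : vY t m (P a b) (S a b) = a * vY t m p1 s1 + b * vY t m p2 s2 by exact: vY_comb.
have sy a b : dsyz t m (P a b) (S a b).
  exact: dsyz_lincomb.
have lin p s : dsyz t m p s -> exists a b, p = P a b /\ s = S a b.
  move=> /(dbasis_expand hb) [c1 [c2 [-> -> l1 l2]]].
  exists c1`_0, c2`_0; rewrite /P /S -!size1_polyC //; [move: l2|move: l1];
    by rewrite subSn // subnn.
have PSn a b : (P a b != 0) || (S a b != 0) -> (a != 0) || (b != 0).
  rewrite -!negb_and; apply: contra => /andP[/eqP -> /eqP ->].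
  by rewrite /P /S !mul0r addr0 eqxx.
have PSn' a b : (a != 0) || (b != 0) -> (P a b != 0) || (S a b != 0).
  move=> n; rewrite -negb_and; apply/negP => /andP[/eqP e1 /eqP e2].
  have : a%:P * kap%:P = 0.
    rewrite -det (_ : a%:P * _ = S a b * p2 - s2 * P a b); last by rewrite /P /S; ring.
    by rewrite e1 e2 mul0r mulr0 subrr.
  have : b%:P * kap%:P = 0.
    rewrite -det (_ : b%:P * _ = s1 * P a b - S a b * p1); last by rewrite /P /S; ring.
    by rewrite e1 e2 mul0r mulr0 subrr.
  move=> /eqP; rewrite mulf_eq0 !polyC_eq0 (negPf k0) orbF => /eqP b0 /eqP.
  by rewrite mulf_eq0 !polyC_eq0 (negPf k0) orbF => a0; move: n; rewrite a0 b0 eqxx.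
have rotP a b : (a != 0) || (b != 0) -> exists a' b', [/\ (a' != 0) || (b' != 0),
    a * s1.[-1] + b * s2.[-1] = 0 -> a' * p1.[0] + b' * p2.[0] = 0,
    a * p1.[0] + b * p2.[0] = 0 -> a' * vY t m p1 s1 + b' * vY t m p2 s2 = 0
  & a * vY t m p1 s1 + b * vY t m p2 s2 = 0 -> a' * s1.[-1] + b' * s2.[-1] = 0].
  move=> n; have [r1 r2 r3 r4 r5] := dsyz_rot (sy a b).
  have [a' [b' [e1 e2]]] := lin _ _ r1; exists a', b'; split.
  - apply: PSn; rewrite -e1 -e2 -negb_and; apply/negP => /andP[/eqP z1 /eqP z2].
    by have [z3 z4] := r5 z1 z2; move: (PSn' _ _ n); rewrite z3 z4 eqxx.
  - by move=> z; rewrite -PX -e1 r2 SZ z mulr0.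
  - by move=> z; rewrite -VY -e1 -e2 r3 PX z mulr0.
  - by move=> z; rewrite -SZ -e2 r4 VY z.
move: (p1.[0]) (p2.[0]) (vY t m p1 s1) (vY t m p2 s2) (s1.[-1]) (s2.[-1]) nX nY nZ PX SZ VY rotP
  => x1 x2 y1 y2 z1 z2 nX nY nZ PX SZ VY rotP.
have done_split a b : (a != 0) || (b != 0) -> a * x1 + b * x2 = 0 -> a * y1 + b * y2 = 0 ->
    a * z1 + b * z2 = 0 -> split_basis t.
  move=> n zx zy zz; have [a0|a0] := eqVneq a 0.
    have b0 : b != 0 by move: n; rewrite a0 eqxx.
    have hb' := @dbasis_comb t m p1 s1 p2 s2 kap a b 1 0 hb.
    exists m, (P a b), (S a b), m, (P 1 0), (S 1 0), ((a * 0 - 1 * b) * kap).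
    by split; [apply: hb'; rewrite mulr0 mul1r sub0r oppr_eq0|rewrite PX SZ VY].
  have hb' := @dbasis_comb t m p1 s1 p2 s2 kap a b 0 1 hb.
  exists m, (P a b), (S a b), m, (P 0 1), (S 0 1), ((a * 1 - 0 * b) * kap).
  by split; [apply: hb'; rewrite mulr1 mul0r subr0|rewrite PX SZ VY].
have kerX : x2 * x1 + - x1 * x2 = 0 by ring.
have n2 (u v : k) : (u != 0) || (v != 0) -> (v != 0) || (- u != 0) by rewrite oppr_eq0 orbC.
(* a vector killed by two of the three functionals is killed by the third one *)
have third (a b u1 u2 v1 v2 : k) : (v1 != 0) || (v2 != 0) ->
    a * v1 + b * v2 = 0 ->
    (exists a' b', [/\ (a' != 0) || (b' != 0), a' * v1 + b' * v2 = 0 & a' * u1 + b' * u2 = 0]) ->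
    a * u1 + b * u2 = 0.
  move=> nv e1 [a' [b' [n' e2 e3]]].
  have f1 : v1 * a = - v2 * b by apply/eqP; rewrite -subr_eq0 -e1; apply/eqP; ring.
  have f2 : v1 * a' = - v2 * b' by apply/eqP; rewrite -subr_eq0 -e2; apply/eqP; ring.
  have nv' : (v1 != 0) || (- v2 != 0) by rewrite oppr_eq0.
  have g : a' * b = b' * a by rewrite mulrC [b' * a]mulrC; exact: par_trans nv' f1 f2.
  have h : a' * u1 = b' * - u2 by apply/eqP; rewrite -subr_eq0 -e3; apply/eqP; ring.
  by rewrite (par_trans n' g h) mulrN addNr.
have nKX := n2 _ _ nX; have nKY := n2 _ _ nY.
have kerY : y2 * y1 + - y1 * y2 = 0 by ring.
have [a' [b' [na r1 r2 r3]]] := rotP _ _ nKX.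
have [c' [d' [nc q1 q2 q3]]] := rotP _ _ nKY.
have [d0|d0] := eqVneq (x2 * y1 + - x1 * y2) 0.
  left; apply: (done_split _ _ nKX kerX d0).
  apply: (third _ _ _ _ y1 y2 nY d0); exists a', b'; split=> //; [exact: r2|exact: r3].
have [e0|e0] := eqVneq (x2 * z1 + - x1 * z2) 0.
  left; apply: (done_split _ _ nKX kerX _ e0).
  apply: (third _ _ _ _ x1 x2 nX kerX); exists a', b'; split=> //; [exact: r1|exact: r2].
have [f0|f0] := eqVneq (y2 * z1 + - y1 * z2) 0.
  left; apply: (done_split _ _ nKY _ kerY f0).
  apply: (third _ _ _ _ z1 z2 nZ f0); exists c', d'; split=> //; [exact: q3|exact: q1].
(* The basis vectors span the kernels of the values at X = 0 and Y = 0; c scales the second so that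
   their sum lies in the third kernel. *)
right; pose c := - (x2 * z1 + - x1 * z2) / (y2 * z1 + - y1 * z2).
have c0 : c != 0 by rewrite mulf_neq0 ?invr_eq0 ?oppr_eq0.
exists m, (P x2 (- x1)), (S x2 (- x1)), (P (c * y2) (c * - y1)), (S (c * y2) (c * - y1)).
exists ((x2 * (c * - y1) - (c * y2) * - x1) * kap).
split; rewrite ?PX ?SZ ?VY.
- apply: dbasis_comb => //; rewrite (_ : _ - _ = c * - (x2 * y1 + - x1 * y2)); last by ring.
  by rewrite mulf_neq0 ?oppr_eq0.
- split; first exact: kerX.
    by rewrite (_ : _ + _ = c * (y2 * y1 + - y1 * y2)) ?kerY ?mulr0 //; ring.
  rewrite (_ : c * y2 * z1 + _ = c * (y2 * z1 + - y1 * z2)); last by ring.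
  by rewrite /c divfK // subrr.
split=> //; rewrite (_ : _ + _ = c * - (x2 * y1 + - x1 * y2)); last by ring.
by rewrite mulf_neq0 ?oppr_eq0.
Qed.
End Structure.

(** * Normal forms of bases and the gap criterion for rigidity *)

Section Trichotomy.
Variable k : fieldType.
Implicit Types (c p q r s : {poly k}) (t m : nat).

Lemma dbasis_shear t m1 p1 s1 m2 p2 s2 (kap : k) q :
  dbasis t m1 p1 s1 m2 p2 s2 kap -> (m1 <= m2)%N -> (size q <= (m2 - m1).+1)%N ->
  dbasis t m1 p1 s1 m2 (q * p1 + 1 * p2) (q * s1 + 1 * s2) kap /\
  vY t m2 (q * p1 + 1 * p2) (q * s1 + 1 * s2) = q`_(m2 - m1) * vY t m1 p1 s1 + vY t m2 p2 s2.
Proof.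
move=> [hm h1 h2 k0 det] le sq.
have [|d e] := dsyz_comb h1 h2 le (leqnn m2) sq (c2 := 1); first by rewrite subnn size_poly1.
split; last by rewrite e subnn coef1 eqxx mul1r.
split=> //.
by rewrite -det; ring.
Qed.

Lemma dbasis_scale t m1 p1 s1 m2 p2 s2 (kap x : k) : x != 0 ->
  dbasis t m1 p1 s1 m2 p2 s2 kap ->
  dbasis t m1 p1 s1 m2 (x%:P * p2) (x%:P * s2) (x * kap).
Proof.
move=> x0 [hm h1 h2 k0 det]; split=> //; last by rewrite polyCM -det; ring.
  by have := dsyz_lincomb x 0 h2 h2; rewrite !polyC0 !mul0r !addr0.
by rewrite mulf_neq0.
Qed.

(** For m1 < m2 the first generator vanishes at all points or at none. In the second case add to the
    other generator q times the first, q a form of degree m2 - m1. Degree at least 2 suffices to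
    cancel all three values; degree 1 cancels two, and a surviving third one is normalized in
    [odd_type]. *)
Lemma structure_trichotomy t : [\/ split_basis k t, even_type k t | odd_type k t].
Proof.
have [m1 [p1 [s1 [m2 [p2 [s2 [kap [hb le]]]]]]]] := dbasis_exists k t.
have [em|nem] := eqVneq m1 m2.
  by rewrite -em in hb; have [?|?] := even_case hb; [constructor 1|constructor 2].
have lt : (m1 < m2)%N by rewrite ltn_neqAle nem.
have [hm h1 h2 k0 det] := hb.
have [sY sZ] := dsyz_symmetric h1 (dbasis_neq0 hb) (dbasis_uniq hb lt).
have [x0|x0] := eqVneq p1.[0] 0.
  constructor 1; exists m1, p1, s1, m2, p2, s2, kap; split=> //.
  by split=> //; apply/eqP; rewrite ?sY ?sZ x0 eqxx.
have y0 : vY t m1 p1 s1 != 0 by rewrite sY.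
have z0 : s1.[-1] != 0 by rewrite sZ.
pose a := - p2.[0] / p1.[0]; pose c := - vY t m2 p2 s2 / vY t m1 p1 s1.
have aE : a * p1.[0] + p2.[0] = 0 by rewrite /a divfK // addNr.
have cE : c * vY t m1 p1 s1 + vY t m2 p2 s2 = 0 by rewrite /c divfK // addNr.
have [e1|d2] := eqVneq m2 m1.+1.
  have em : (m2 - m1 = 1)%N by rewrite e1 subSnn.
  pose q := a%:P + c%:P * 'X.
  have sq : (size q <= (m2 - m1).+1)%N by rewrite em /q addrC size_MXaddC; case: ifP => // _; rewrite ltnS size_polyC_leq1.
  have [hb' ey] := dbasis_shear hb le sq.
  have q1 : q`_(m2 - m1) = c by rewrite em /q coefD coefC coefCM coefX /= mulr1 add0r.
  rewrite q1 cE in ey.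
  set p' := q * p1 + 1 * p2 in hb' ey; set s' := q * s1 + 1 * s2 in hb' ey.
  have ex : p'.[0] = 0 by rewrite /p' /q !hornerE.
  have [ez|ez] := eqVneq s'.[-1] 0.
    constructor 1; exists m2, p', s', m1, p1, s1, (- kap); split=> //.
    exact: dbasis_swap.
  constructor 3; pose x := - s1.[-1] / s'.[-1].
  have nx : x != 0 by rewrite mulf_neq0 ?oppr_eq0 ?invr_eq0.
  have hb'' := dbasis_scale nx hb'; rewrite e1 in hb'' ey.
  exists m1, p1, s1, (x%:P * p'), (x%:P * s'), (x * kap); split=> //.
  split; first by rewrite hornerCM ex mulr0.
    have := vY_comb x 0 (m := m1.+1) (t := t) (p1 := p') (s1 := s') (p2 := p') (s2 := s').
    rewrite !polyC0 !mul0r !addr0 ey mulr0; apply; by case: hb'; rewrite e1.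
  by rewrite hornerCM /x divfK.
pose d := (m2 - m1)%N; have d_gt1 : (1 < d)%N by rewrite /d; lia.
(* The coefficients a and c fix q at X = 0 and Y = 0; b solves q(-1) = - s2(-1) / s1(-1). *)
pose b := a + c * (-1) ^+ d + s2.[-1] / s1.[-1].
pose q := a%:P + b%:P * 'X + c%:P * 'X^d.
have qN : q.[-1] * s1.[-1] + s2.[-1] = 0.
  rewrite /q !hornerE /= /b.
  by rewrite (_ : _ + _ = s2.[-1] - s2.[-1] / s1.[-1] * s1.[-1]); [rewrite divfK ?subrr|ring].
have sq : (size q <= d.+1)%N.
  apply/leq_sizeP => j hj; rewrite /q !coefD !coefCM coefC coefX coefXn.
  have -> : (j == 0 :> nat) = false by apply/eqP; lia.
  have -> : (j == 1 :> nat) = false by apply/eqP; lia.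
  have -> : (j == d :> nat) = false by apply/eqP; lia.
  by rewrite /= !mulr0 !addr0.
have qd : q`_d = c.
  rewrite /q !coefD !coefCM coefC coefX coefXn eqxx.
  have -> : (d == 0 :> nat) = false by apply/eqP; lia.
  have -> : (d == 1 :> nat) = false by apply/eqP; lia.
  by rewrite /= mulr0 !add0r mulr1.
have [hb' ey] := dbasis_shear hb le sq; rewrite qd cE in ey.
constructor 1; exists m2, (q * p1 + 1 * p2), (q * s1 + 1 * s2), m1, p1, s1, (- kap).
split; first exact: dbasis_swap.
split=> //; last by rewrite mul1r hornerD hornerM qN.
by rewrite /q !hornerE /= expr0n eqn0Ngt (ltnW d_gt1) /= !mulr0 !addr0.
Qed.

(** As m1 + m2 = t, either the vanishing generator has 2 m1 <= t + 1, which is a gap of at least 2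
    at t + 1, or the other one has 2 m2 <= t - 2, which is a gap of at least 2 at t. *)
Lemma split_basis_gapge t : split_basis k t -> gapge k t t t 2 \/ gapge k t.+1 t.+1 t.+1 2.
Proof.
move=> [m1 [p1 [s1 [m2 [p2 [s2 [kap [hb [x y z]]]]]]]]].
have [hm h1 h2 _ _] := hb.
have [le|lt] := leqP (2 * m1) t.+1.
  right; have := @dsyz_gapge k t m1 p1 s1 true true true 2 h1 (dbasis_neq0 hb).
  by rewrite !addn1; apply=> //; lia.
left; have := @dsyz_gapge k t m2 p2 s2 false false false 2 h2 (dbasis_neq0 (dbasis_swap hb)).
by rewrite !addn0; apply=> //; lia.
Qed.

(** After multiplication by a power of X the syzygy is a constant combination a, b of the basis. Its
    values at X = 0, Y = 0, Z = 0 vanish only if b, a, a - b do, respectively, so two zeros are one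
    too many. *)
Lemma even_type_small t m p s (i j l : bool) : even_type k t -> (2 <= i + j + l)%N ->
  dsyz t m p s -> (2 * m <= t)%N ->
  (i -> p.[0] = 0) -> (j -> vY t m p s = 0) -> (l -> s.[-1] = 0) -> p = 0 /\ s = 0.
Proof.
move=> [m0 [p1 [s1 [p2 [s2 [kap [hb [x1 y2 z12] [x2 y1 z1]]]]]]]] ijl h le hi hj hl.
have [hm h1 h2 k0 det] := hb.
have lem : (m <= m0)%N by lia.
have [h' eY] := dsyz_shift (m0 - m) h; rewrite subnKC // in h' eY.
have [c1 [c2 [ep es l1 l2]]] := dbasis_expand hb h'.
rewrite subSn // subnn in l1 l2.
move: (size1_polyC l1) (size1_polyC l2) ep es; move: (c1`_0) (c2`_0) => a b -> -> ep es.
suff [a0 b0] : a = 0 /\ b = 0.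
  move: ep es; rewrite a0 b0 !mul0r !addr0 => /eqP; rewrite mulf_eq0 expf_eq0 polyX_eq0 andbF.
  by move=> /eqP -> /eqP; rewrite mulf_eq0 expf_eq0 polyX_eq0 andbF => /eqP.
have z2 : s2.[-1] = - s1.[-1] by apply/eqP; rewrite -subr_eq0 opprK addrC z12.
have fX : i -> b = 0.
  move=> /hi pz; have := congr1 (fun q => q.[0]) ep.
  rewrite !hornerE pz x1 !mulr0 add0r => /esym/eqP.
  by rewrite mulf_eq0 (negPf x2) orbF => /eqP.
have fY : j -> a = 0.
  move=> /hj pz; move: eY; rewrite pz ep es vY_comb // y2 mulr0 addr0 => /eqP.
  by rewrite mulf_eq0 (negPf y1) orbF => /eqP.
have fZ : l -> a = b.
  move=> /hl pz; have := congr1 (fun q => q.[-1]) es.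
  rewrite !hornerE pz z2 !mulr0 mulrN -mulrBl => /esym/eqP.
  by rewrite mulf_eq0 (negPf z1) orbF subr_eq0 => /eqP.
move: ijl fX fY fZ; clear.
case: i; case: j; case: l => //= _ fX fY fZ.
- by rewrite fX // fY.
- by rewrite fX // fY.
- by rewrite fZ // fX.
- by rewrite -fZ // fY.
Qed.

Lemma odd_type_small t m p s (i j l : bool) : odd_type k t -> (1 <= i + j + l)%N ->
  dsyz t m p s -> (2 * m <= t)%N ->
  (i -> p.[0] = 0) -> (j -> vY t m p s = 0) -> (l -> s.[-1] = 0) -> p = 0 /\ s = 0.
Proof.
move=> [m0 [p1 [s1 [p2 [s2 [kap [hb [x1 y1 z1] _]]]]]]] ijl h le hi hj hl.
have [hm h1 h2 k0 det] := hb.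
have lem : (m <= m0)%N by lia.
have [h' eY] := dsyz_shift (m0 - m) h; rewrite subnKC // in h' eY.
have [a [ep es]] := dbasis_uniq hb (ltnSn m0) h'.
suff a0 : a = 0.
  move: ep es; rewrite a0 !scale0r => /eqP; rewrite mulf_eq0 expf_eq0 polyX_eq0 andbF.
  by move=> /eqP -> /eqP; rewrite mulf_eq0 expf_eq0 polyX_eq0 andbF => /eqP.
case: i ijl hi => [_ /(_ isT) pz|].
  have := congr1 (fun q => q.[0]) ep; rewrite !hornerE pz mulr0 => /esym/eqP.
  by rewrite mulf_eq0 (negPf x1) orbF => /eqP.
case: j hj => [/(_ isT) pz _ _|_].
  move: eY; rewrite pz ep es; have := vY_comb a 0 h1 h1; rewrite polyC0 !mul0r !addr0 !mul_polyC => -> /eqP.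
  by rewrite mulf_eq0 (negPf y1) orbF => /eqP.
case: l hl => [/(_ isT) pz _ _|_ //].
have := congr1 (fun q => q.[-1]) es; rewrite !hornerE pz mulr0 => /esym/eqP.
by rewrite mulf_eq0 (negPf z1) orbF => /eqP.
Qed.

(** The coefficient c1 is a linear form that vanishes at X = 0 and Y = 0, where the second generator
    does not contribute, so c1 = 0. The value at Z = 0 then kills the other coefficient. *)
Lemma odd_type_vanish t m p s : odd_type k t -> dsyz t m p s -> (2 * m <= t.+1)%N ->
  p.[0] = 0 -> vY t m p s = 0 -> s.[-1] = 0 -> p = 0 /\ s = 0.
Proof.
move=> [m0 [p1 [s1 [p2 [s2 [kap [hb [x1 y1 z1] [x2 y2 z2]]]]]]]] h le hx hy hz.
have [hm h1 h2 k0 det] := hb.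
have lem : (m <= m0.+1)%N by lia.
have [h' eY] := dsyz_shift (m0.+1 - m) h; rewrite subnKC // in h' eY.
have [c1 [c2 [ep es l1 l2]]] := dbasis_expand hb h'.
have {}l1 : (size c1 <= 2)%N by apply: leq_trans l1 _; clear; lia.
have {}l2 : (size c2 <= 1)%N by apply: leq_trans l2 _; clear; lia.
move: (size1_polyC l2) ep es; move: (c2`_0) => b eb ep es.
suff [a0 b0] : c1 = 0 /\ b = 0.
  move: ep es; rewrite eb a0 b0 !mul0r !addr0 => /eqP; rewrite mulf_eq0 expf_eq0 polyX_eq0 andbF.
  by move=> /eqP -> /eqP; rewrite mulf_eq0 expf_eq0 polyX_eq0 andbF => /eqP.
have c10 : c1.[0] = 0.
  have := congr1 (fun q => q.[0]) ep; rewrite !hornerE hx x2 !mulr0 addr0 => /esym/eqP.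
  by rewrite mulf_eq0 (negPf x1) orbF => /eqP.
have c11 : c1`_1 = 0.
  have [||_] := dsyz_comb h1 h2 (leqnSn m0) (leqnn m0.+1) (c1 := c1) (c2 := c2).
  - by rewrite subSnn.
  - by rewrite subnn.
  rewrite -ep -es eY hy y2 mulr0 addr0 subSnn => /esym/eqP.
  by rewrite mulf_eq0 (negPf y1) orbF => /eqP.
have c1z : c1 = 0.
  apply/polyP => [[|[|j]]]; rewrite coef0 -?horner_coef0 //.
  by rewrite nth_default // (leq_trans l1).
split=> //; have := congr1 (fun q => q.[-1]) es.
rewrite c1z eb !hornerE hz z2 !mulr0 => /esym/eqP.
by rewrite mulrN oppr_eq0 mulf_eq0 (negPf z1) orbF => /eqP.
Qed.

Definition rigid t := even_type k t \/ odd_type k t.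

Lemma type_parity t : (even_type k t -> ~~ odd t) /\ (odd_type k t -> odd t).
Proof.
split; move=> [m [p1 [s1 [p2 [s2 [kap [[hm _ _ _ _] _ _]]]]]]]; first by rewrite -hm addnn odd_double.
by rewrite -hm addnS addnn /= odd_double.
Qed.

Lemma dsyz_absurd p s : (p != 0) || (s != 0) -> p = 0 /\ s = 0 -> False.
Proof. by move=> n [e1 e2]; rewrite e1 e2 eqxx in n. Qed.

Lemma rigidP t : rigid t <-> ~ gapge k t t t 2 /\ ~ gapge k t.+1 t.+1 t.+1 2.
Proof.
split; last first.
  by move=> [n1 n2]; case: (structure_trichotomy t) => [/split_basis_gapge []|?|?] //; [left|right].
have g0 : gapge k t t t 2 -> gapge k (t + false) (t + false) (t + false) 2 by rewrite addn0.
have g1 : gapge k t.+1 t.+1 t.+1 2 -> gapge k (t + true) (t + true) (t + true) 2 by rewrite addn1.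
have below m0 p1 s1 m1 p2 s2 kap m p s : dbasis t m0 p1 s1 m1 p2 s2 kap ->
    dsyz t m p s -> (m < m0)%N -> (m < m1)%N -> p = 0 /\ s = 0.
  move=> hb h l0 l1; have [c1 [c2 [-> -> z1 z2]]] := dbasis_expand hb h.
  have -> : c1 = 0 by apply/eqP; rewrite -size_poly_leq0 (leq_trans z1) //; lia.
  have -> : c2 = 0 by apply/eqP; rewrite -size_poly_leq0 (leq_trans z2) //; lia.
  by rewrite !mul0r addr0.
case=> ht; split.
- move=> /g0/gapge_dsyz [m [p [s [h n le _]]]]; apply: dsyz_absurd n _.
  have [m0 [p1 [s1 [p2 [s2 [kap [hb _ _]]]]]]] := ht; have [hm _ _ _ _] := hb.
  by apply: (below _ _ _ _ _ _ _ _ _ _ hb h); move: hm le; clear; lia.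
- move=> /g1/gapge_dsyz [m [p [s [h n le [hx hy hz]]]]]; apply: dsyz_absurd n _.
  apply: (@even_type_small t m p s true true true ht) => //.
  have := (type_parity t).1 ht; move: le; clear; lia.
- move=> /g0/gapge_dsyz [m [p [s [h n le _]]]]; apply: dsyz_absurd n _.
  have [m0 [p1 [s1 [p2 [s2 [kap [hb _ _]]]]]]] := ht; have [hm _ _ _ _] := hb.
  by apply: (below _ _ _ _ _ _ _ _ _ _ hb h); move: hm le; clear; lia.
- move=> /g1/gapge_dsyz [m [p [s [h n le [hx hy hz]]]]]; apply: dsyz_absurd n _.
  apply: (@odd_type_vanish t m p s ht h _ (hx isT) (hy isT) (hz isT)).
  by move: le; clear; lia.
Qed.

(** A gap of i + j + l at this corner amounts to a syzygy of degree at most t / 2 with that many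
    zeros. By parity this is sharper than the bounds on the diagonal. *)
Lemma rigid_even_edge t (i j l : bool) : rigid t -> ~~ odd t -> (2 <= i + j + l)%N ->
  ~ gapge k (t + i) (t + j) (t + l) (i + j + l).
Proof.
case=> [ht _ ijl|/(type_parity t).2 -> //].
move=> /gapge_dsyz [m [p [s [h n le [hx hy hz]]]]]; apply: dsyz_absurd n _.
by apply: (@even_type_small t m p s i j l ht) => //; move: le; clear; lia.
Qed.

Lemma rigid_odd_edge t (i j l : bool) : rigid t -> odd t -> (1 <= i + j + l)%N ->
  ~ gapge k (t + i) (t + j) (t + l) (i + j + l).
Proof.
case=> [/(type_parity t).1 /negPf -> //|ht _ ijl].
move=> /gapge_dsyz [m [p [s [h n le [hx hy hz]]]]]; apply: dsyz_absurd n _.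
by apply: (@odd_type_small t m p s i j l ht) => //; move: le; clear; lia.
Qed.

Lemma gapge_odd t : odd t -> gapge k t t t 1.
Proof.
move=> ot; have [m1 [p1 [s1 [m2 [p2 [s2 [kap [hb le]]]]]]]] := dbasis_exists k t.
have [hm h1 _ _ _] := hb.
have := @dsyz_gapge k t m1 p1 s1 false false false 1 h1 (dbasis_neq0 hb).
by rewrite !addn0; apply=> //; move: hm le ot; clear; lia.
Qed.
End Trichotomy.

(** * The sets S_c *)

(** Arithmetic shared by both bands, split by the number of flags set. The tightest case has all
    three set and would give 2 p + 2 <= 3 j; this is the origin of the bound on j. *)
Lemma band_arith p M a1 a2 a3 j d1 d2 d3 (f1 f2 f3 : bool) :
  (2 + d1 + d2 + d3 <= p * M)%N -> (M <= a1 + a2 + a3 + (f1 || f2 || f3))%N ->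
  (p * a1 + (if f1 then p else 2 * j) <= d1 + j)%N ->
  (p * a2 + (if f2 then p else 2 * j) <= d2 + j)%N ->
  (p * a3 + (if f3 then p else 2 * j) <= d3 + j)%N -> (3 * j < 2 * p + 2)%N -> False.
Proof.
move=> h1 hM h2 h3 h4 hj; have := leq_trans h1 (leq_mul (leqnn p) hM).
rewrite !mulnDr; move: (p * a1)%N (p * a2)%N (p * a3)%N h2 h3 h4 => A B C; clear h1 hM.
by case: f1; case: f2; case: f3 => /=; rewrite ?muln1 ?muln0; lia.
Qed.

Section Rigidity.
Variable k : fieldType.
Local Notation rigid := (rigid k).
Local Notation gapge := (gapge k).

Lemma gapge_parity t M : ~~ odd (t + M) -> gapge t t t M.+1 -> gapge t t t M.+2.
Proof.
move=> e [d [A [B [h n le]]]]; exists d, A, B; split=> //; lia.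
Qed.

(** On the cube between (t, t, t) and (t+1, t+1, t+1) the gap is 0 at the lower corner, by parity,
    and at most 1 at the other corners. For odd t the upper corner takes that role. *)
Lemma rigid_up_corner t (i j l : bool) : rigid t -> ~~ odd t ->
  ~ gapge (t + i) (t + j) (t + l) (1 + (i || j || l)).
Proof.
move=> ht et; have [n0 n1] := (rigidP k t).1 ht.
have n01 : ~ gapge t t t 1 by move=> /gapge_parity h; apply/n0/h; rewrite addn0.
have e2 := @rigid_even_edge k t i j l ht et; move: e2.
case: i; case: j; case: l => //=; rewrite ?addn0 ?addn1 => e2 h //;
  try (by apply: e2); apply: n01; apply: gapge_lipschitz h; lia.
Qed.

Lemma rigid_dn_corner t (i j l : bool) : rigid t -> odd t ->
  ~ gapge (t + i) (t + j) (t + l) (1 + ~~ (i && j && l)).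
Proof.
move=> ht et; have [n0 n1] := (rigidP k t).1 ht.
have n11 : ~ gapge t.+1 t.+1 t.+1 1 by move=> /gapge_parity h; apply/n1/h; rewrite addn0 /= et.
have e2 := @rigid_odd_edge k t i j l ht et; move: e2.
case: i; case: j; case: l => //=; rewrite ?addn0 ?addn1 => e2 h //;
  try (by apply: e2 => //; apply: gapge_le h); apply: n11; apply: gapge_lipschitz h; lia.
Qed.

Section Char.
Variable p : nat.
Hypothesis pcharp : p \in [pchar k].

(** Descent produces (u, v, w) with a large gap M. Comparison with the nearest corner of the cube at
    t, by the Lipschitz property, bounds M from above. *)
Lemma band_up t j : rigid t -> ~~ odd t -> (3 * j < 2 * p + 2)%N ->
  ~ gapge (p * t + j) (p * t + j) (p * t + j) 2.
Proof.
move=> ht et hj /(gapge_descent pcharp (leqnn 2)) [u [v [w [M [h hM]]]]].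
(* The distance from x to the nearer of t and t + 1. *)
pose a (x : nat) := (if t < x then x - t.+1 else t - x)%N.
have ha x : (p * a x + (if t < x then p else 2 * j) <=
    ((p * t + j - p * x) + (p * x - (p * t + j))) + j)%N.
  rewrite /a; case: ltnP => lt.
    have e : (p * x = p * (x - t.+1) + p * t + p)%N by rewrite -mulnDr -mulnSr; congr (_ * _)%N; lia.
    by rewrite e; move: (p * (x - t.+1))%N (p * t)%N => X Y; clear; lia.
  have e : (p * t = p * (t - x) + p * x)%N by rewrite -mulnDr subnK.
  by rewrite e; move: (p * (t - x))%N (p * x)%N => X Y; clear; lia.
apply: (@band_arith p M (a u) (a v) (a w) j _ _ _ (t < u)%N (t < v)%N (t < w)%N hM _ (ha u) (ha v) (ha w) hj).
rewrite leqNgt; apply/negP => lt.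
apply: (@rigid_up_corner t (t < u)%N (t < v)%N (t < w)%N ht et).
apply: gapge_lipschitz h; move: lt; rewrite /a; clear.
by case: (ltnP t u) => h1; case: (ltnP t v) => h2; case: (ltnP t w) => h3 /=; lia.
Qed.

Lemma band_dn t j : rigid t -> odd t -> (3 * j < 2 * p + 2)%N -> (j <= p * t.+1)%N ->
  ~ gapge (p * t.+1 - j) (p * t.+1 - j) (p * t.+1 - j) 2.
Proof.
move=> ht et hj le /(gapge_descent pcharp (leqnn 2)) [u [v [w [M [h hM]]]]].
pose a (x : nat) := (if t < x then x - t.+1 else t - x)%N.
have ha x : (p * a x + (if ~~ (t < x) then p else 2 * j) <=
    ((p * t.+1 - j - p * x) + (p * x - (p * t.+1 - j))) + j)%N.
  rewrite /a; case: ltnP => lt /=.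
    have e : (p * x = p * (x - t.+1) + p * t.+1)%N by rewrite -mulnDr subnK.
    by rewrite e; move: (p * (x - t.+1))%N (p * t.+1)%N le => X Y; clear; lia.
  have e : (p * t.+1 = p * (t - x) + p * x + p)%N by rewrite -mulnDr subnK // mulnSr.
  by rewrite e; move: (p * (t - x))%N (p * x)%N => X Y; clear; lia.
apply: (@band_arith p M (a u) (a v) (a w) j _ _ _ (~~ (t < u))%N (~~ (t < v))%N (~~ (t < w))%N hM _ (ha u) (ha v) (ha w) hj).
rewrite leqNgt; apply/negP => lt.
apply: (@rigid_dn_corner t (t < u)%N (t < v)%N (t < w)%N ht et).
apply: gapge_lipschitz h; move: lt; rewrite /a; clear.
by case: (ltnP t u) => h1; case: (ltnP t v) => h2; case: (ltnP t w) => h3 /=; lia.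
Qed.

Lemma gapge_near t m x M : gapge t t t m ->
  (M + 3 * ((x - p * t) + (p * t - x)) <= p * m)%N -> gapge x x x M.
Proof.
move=> /(gapge_frobenius pcharp) h le; apply: gapge_lipschitz h; lia.
Qed.
End Char.

Lemma rigid0 : rigid 0.
Proof.
apply/rigidP; split=> [[d [A [B [_ _]]]]|[d [A [B [[h1 h2 h3 h4] n le]]]]]; first by lia.
have d0 : d = 0%N by lia.
rewrite d0 in h3 h4; have B0 : B = 0 by apply/eqP; rewrite -size_poly_leq0.
move: n; rewrite B0 eqxx orbF => A0; have := fdvdp_leq A0 h1; rewrite size_polyXn.
by move/leq_trans/(_ h3).
Qed.

Lemma not_rigid t : gapge t t t 2 \/ gapge t.+1 t.+1 t.+1 2 -> ~ rigid t.
Proof. by move=> h /rigidP [n0 n1]; case: h. Qed.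

Lemma char2_rigid t : 2 \in [pchar k] -> (t = 0%N <-> rigid t).
Proof.
move=> ch; split=> [->|]; first exact: rigid0.
(* Doubling an odd x doubles a gap of at least 1; doubling an even x doubles a gap already at least
   2. One of t, t + 1 is even. *)
have ev : forall x, (0 < x)%N -> gapge (2 * x) (2 * x) (2 * x) 2.
  elim/ltn_ind => x IH x0; have [o|e] := boolP (odd x).
    by apply: (gapge_near ch (gapge_odd k o)); lia.
  have h : gapge x x x 2.
    have -> : x = (2 * x./2)%N by rewrite mul2n; lia.
    by apply: IH; lia.
  by apply: (gapge_near ch h); lia.
case: t => // t r; exfalso; apply: (not_rigid _ r).
have [o|e] := boolP (odd t.+1).
  right; have -> : t.+2 = (2 * (t.+2./2))%N by rewrite mul2n; lia.
  by apply: ev; lia.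
left; have -> : t.+1 = (2 * (t.+1./2))%N by rewrite mul2n; lia.
by apply: ev; lia.
Qed.

(** The induction carries more: for even t also t + 1 is rigid. The upper band of a then covers 3a,
    ..., 3a + 2 and the lower band of a + 1 covers 3a + 4, ..., 3a + 6. The four numbers in the rule
    are those whose successor lies in the same band. *)
Lemma char3_rigid t : 3 \in [pchar k] -> (S3 t <-> rigid t).
Proof.
move=> ch; split.
  suff : S3 t -> rigid t /\ (~~ odd t -> rigid t.+1) by move=> h /h [].
  elim=> [|a m _ [ra ra'] ea hm].
    split=> [|_]; first exact: rigid0.
    have [n0 n1] := (rigidP k 0).1 rigid0; apply/rigidP; split=> // h.
    by have := @band_up 3 ch 0 2 rigid0 isT isT; rewrite muln0 add0n; apply.
  have {}ra' := ra' ea.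
  have up j : (j <= 2)%N -> ~ gapge (3 * a + j) (3 * a + j) (3 * a + j) 2.
    by move=> hj; apply: band_up => //; lia.
  have dn j : (j <= 2)%N -> ~ gapge (3 * a.+2 - j) (3 * a.+2 - j) (3 * a.+2 - j) 2.
    by move=> hj; apply: band_dn => //; lia.
  have g0 : ~ gapge (3 * a) (3 * a) (3 * a) 2 by have := up 0%N isT; rewrite addn0.
  have g1 : ~ gapge (3 * a).+1 (3 * a).+1 (3 * a).+1 2 by have := up 1%N isT; rewrite addn1.
  have g2 : ~ gapge (3 * a).+2 (3 * a).+2 (3 * a).+2 2 by have := up 2%N isT; rewrite addn2.
  have g4 : ~ gapge (3 * a + 4) (3 * a + 4) (3 * a + 4) 2.
    by have := dn 2%N isT; have -> : (3 * a.+2 - 2 = 3 * a + 4)%N by lia.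
  have g5 : ~ gapge (3 * a + 4).+1 (3 * a + 4).+1 (3 * a + 4).+1 2.
    by have := dn 1%N isT; have -> : (3 * a.+2 - 1 = (3 * a + 4).+1)%N by lia.
  have g6 : ~ gapge (3 * a + 4).+2 (3 * a + 4).+2 (3 * a + 4).+2 2.
    by have := dn 0%N isT; have -> : (3 * a.+2 - 0 = (3 * a + 4).+2)%N by lia.
  move: hm; rewrite !inE => /or4P [] /eqP ->.
  - by split=> [|_]; apply/rigidP.
  - by rewrite addn1; split=> [|]; [apply/rigidP|move: ea; clear; lia].
  - by split=> [|_]; apply/rigidP.
  - have -> : (3 * a + 5 = (3 * a + 4).+1)%N by lia.
    by split=> [|]; [apply/rigidP|move: ea; clear; lia].
(* The bound 3 reproduces itself: the gap becomes 9 at 3 (2b + 1), and moving by 2 along the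
   diagonal costs at most 6. In the middle residue class mod 6 the odd gap at 2b + 1 already triples
   to 3. *)
have far x : ~~ odd x -> ~ S3 x -> gapge x.+1 x.+1 x.+1 3.
  elim/ltn_ind: x => x IH ex nx.
  have [b [e|[e|e]]] : exists b, (x = 3 * (2 * b) \/ x = 3 * (2 * b) + 2 \/ x = 3 * (2 * b) + 4)%N.
    by exists (x %/ 6)%N; have := divn_eq x 6; have := ltn_pmod x (isT : 0 < 6)%N; move: ex; clear; lia.
  - have n2 : ~ S3 (2 * b).
      by move=> h; apply: nx; rewrite e; apply: (S3_step h); rewrite ?inE ?eqxx //; clear; lia.
    have b0 : (0 < b)%N by rewrite lt0n; apply/eqP => b0; apply: n2; rewrite b0; exact: S3_0.
    have h := IH (2 * b)%N _ _ n2; apply: (@gapge_near 3 ch (2 * b).+1 3); [apply: h|]; move: e b0; clear; lia.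
  - by apply: (@gapge_near 3 ch (2 * b).+1 1); [apply: gapge_odd|]; move: e; clear; lia.
  - have n2 : ~ S3 (2 * b).
      move=> h; apply: nx; rewrite e; apply: (S3_step h); first by clear; lia.
      by rewrite !inE eqxx !orbT.
    have h := IH (2 * b)%N _ _ n2; apply: (@gapge_near 3 ch (2 * b).+1 3); [apply: h|]; move: e; clear; lia.
move=> r; apply: Classical_Prop.NNPP => nt; apply: not_rigid r.
have [o|ev] := boolP (odd t); last by right; apply: gapge_le (far _ ev nt).
have [b [e|[e|e]]] : exists b, (t = 3 * (2 * b) + 1 \/ t = 3 * (2 * b) + 3 \/ t = 3 * (2 * b) + 5)%N.
  by exists (t %/ 6)%N; have := divn_eq t 6; have := ltn_pmod t (isT : 0 < 6)%N; move: o; clear; lia.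
- left; have n2 : ~ S3 (2 * b).
    by move=> h; apply: nt; rewrite e; apply: (S3_step h); rewrite ?inE ?eqxx ?orbT //; clear; lia.
  apply: (@gapge_near 3 ch (2 * b).+1 3); first by apply: far => //; clear; lia.
  by move: e; clear; lia.
- left; apply: (@gapge_near 3 ch (2 * b).+1 1); first by apply: gapge_odd; clear; lia.
  by move: e; clear; lia.
- left; have n2 : ~ S3 (2 * b).
    by move=> h; apply: nt; rewrite e; apply: (S3_step h); rewrite ?inE ?eqxx ?orbT //; clear; lia.
  apply: (@gapge_near 3 ch (2 * b).+1 3); first by apply: far => //; clear; lia.
  by move: e; clear; lia.
Qed.

Lemma pi_p_bounds p : prime p -> (3 < p)%N ->
  [/\ odd p, (0 < pi_p p)%N & (p = 3 * pi_p p + 1 \/ p = 3 * pi_p p + 2)%N].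
Proof.
move=> pr p3; have [p2|op] := even_prime pr; first by rewrite p2 in p3.
have n3 : ~~ (3 %| p)%N.
  by rewrite dvdn_prime2 //; apply/eqP => e; rewrite -e in p3.
by split=> //; rewrite /pi_p; move: n3 p3; clear; lia.
Qed.

(** The induction also carries rigidity of t - 1 for even t > 0, which supplies the part of the band
    below p t, while t itself supplies the part above. With w = pi_p the band reaches 2 w + 1 on
    both sides. *)
Lemma charp_rigid p t : p \in [pchar k] -> (3 < p)%N -> (Sp p t <-> rigid t).
Proof.
move=> ch p3; have [op pi0 pE] := pi_p_bounds (pcharf_prime ch) p3.
have [w ew] : exists w, w = pi_p p by exists (pi_p p).
rewrite -ew in pi0 pE; rename pi0 into w0.
have Spb m : (m <= 2 * w)%N -> Sp p m by rewrite ew; exact: Sp_base.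
have Sps a m : Sp p a -> ~~ odd a -> (p * a <= m + 2 * w + 1)%N ->
  (m <= p * a + 2 * w)%N -> Sp p m by rewrite ew; exact: Sp_step.
have band a : rigid a -> ~~ odd a -> ((0 < a)%N -> rigid a.-1) -> forall x,
    (p * a <= x + 2 * w + 1)%N -> (x <= p * a + 2 * w + 1)%N -> ~ gapge x x x 2.
  move=> ra ea ra' x l1 l2; have [le|lt] := leqP (p * a) x.
    rewrite -(subnKC le); apply: band_up => //; move: l2 le pE; clear; lia.
  have a0 : (0 < a)%N by case: a {ra ea ra' l1 l2} lt => //; rewrite muln0.
  have ex : x = (p * a.-1.+1 - (p * a - x))%N by rewrite prednK // subKn // ltnW.
  rewrite ex; apply: band_dn => //; first exact: ra'.
  - by move: ea a0; clear; case: a => //= a; rewrite negbK.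
  - by move: l1 lt pE; move: (p * a)%N => y; clear; lia.
  - by rewrite prednK // leq_subr.
have step a m : rigid a -> ~~ odd a -> ((0 < a)%N -> rigid a.-1) ->
    (p * a <= m + 2 * w + 1)%N -> (m <= p * a + 2 * w)%N ->
    rigid m /\ (~~ odd m -> (0 < m)%N -> rigid m.-1).
  move=> ra ea ra' l1 l2; have bd := band a ra ea ra'.
  have evpa : ~~ odd (p * a) by rewrite oddM (negPf ea) andbF.
  split=> [|em m0]; apply/rigidP; split; apply: bd;
    move: (p * a)%N evpa l1 l2 => y; [..|move: em m0|move: em m0|move: em m0|move: em m0]; clear; lia.
split.
  suff : Sp p t -> rigid t /\ (~~ odd t -> (0 < t)%N -> rigid t.-1) by move=> h /h [].
  elim=> [m|a m _ [ra ra'] ea]; rewrite -ew.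
    move=> le; apply: (step 0%N) => //; [exact: rigid0|rewrite muln0; lia|rewrite muln0; lia].
  by apply: step => //; exact: ra'.
have far : forall x, ~ Sp p x -> (~~ odd x -> gapge x x x 2) /\
    (gapge x x x 2 \/ gapge x.+1 x.+1 x.+1 2).
  elim/ltn_ind => x IH nx.
  (* Division by 2 p locates x in the interval around p (2b), or else near p (2b + 1). In the first
     case 2b is outside S_p and its gap is at least 2; in the second the gap at 2b + 1 is odd.
     Parity excludes the extreme positions where the Lipschitz bound just fails for even x;
     otherwise x or x + 1 avoids them. *)
  have p0 : (0 < 2 * p)%N by lia.
  have := divn_eq (x + 2 * w + 1) (2 * p); have := ltn_pmod (x + 2 * w + 1) p0.
  move: (_ %/ _)%N (_ %% _)%N => b rho lrho eb.
  have e1 : (p * (2 * b) = b * (2 * p))%N by rewrite mulnCA mulnC [(p * b)%N]mulnC mulnA mulnC [(b * p)%N]mulnC; lia.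
  have eb1 : (b * (2 * p) = 2 * (p * b))%N by rewrite mulnCA [(b * p)%N]mulnC.
  have e2 : (p * (2 * b).+1 = p * (2 * b) + p)%N by rewrite mulnSr.
  have evb : ~~ odd (2 * b) by rewrite mul2n odd_double.
  have [le|gt] := leqP rho (4 * w + 1).
    have nb : ~ Sp p (2 * b).
      by move=> h; apply: nx; apply: (Sps (2 * b)%N) => //; rewrite e1; move: eb le lrho; clear; lia.
    have b0 : (0 < b)%N.
      by rewrite lt0n; apply/eqP => b0; apply: nb; rewrite b0; apply: Spb.
    have lt : (2 * b < x)%N.
      have : (4 * b <= p * b)%N by rewrite leq_mul2r p3 orbT.
      have : (p * 1 <= p * b)%N by rewrite leq_mul2l b0 orbT.
      by move: eb eb1 pE w0 lrho; move: (p * b)%N (b * (2 * p))%N => X Y; clear; lia.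
    have g := (IH _ lt nb).1 evb.
    have near y : ((y - p * (2 * b)) + (p * (2 * b) - y) <= 2 * w)%N -> gapge y y y 2.
      move=> hy; apply: (gapge_near ch g); move: hy pE; clear; lia.
    split; first by move=> ex; apply: near; rewrite e1 eb1; move: eb eb1 ex le lrho; move: (p * b)%N (b * (2 * p))%N => X Y; clear; lia.
    have [h|h] : ((x - p * (2 * b)) + (p * (2 * b) - x) <= 2 * w \/ (x.+1 - p * (2 * b)) + (p * (2 * b) - x.+1) <= 2 * w)%N.
      by rewrite e1; move: eb le lrho; move: (b * (2 * p))%N => Y; clear; lia.
    - by left; apply: near.
    - by right; apply: near.
  have near y : (2 + 3 * ((y - p * (2 * b).+1) + (p * (2 * b).+1 - y)) <= p)%N -> gapge y y y 2.
    move=> hy; apply: (gapge_near ch (@gapge_odd k (2 * b).+1 evb)); move: hy; clear; lia.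
  split=> [ex|].
    by apply: near; rewrite e2 e1 eb1; move: eb eb1 ex gt lrho pE op; move: (p * b)%N (b * (2 * p))%N => X Y; clear; lia.
  have [h|h] : (2 + 3 * ((x - p * (2 * b).+1) + (p * (2 * b).+1 - x)) <= p \/ 2 + 3 * ((x.+1 - p * (2 * b).+1) + (p * (2 * b).+1 - x.+1)) <= p)%N.
    by rewrite e2 e1; move: eb gt lrho pE op; move: (b * (2 * p))%N => Y; clear; lia.
  - by left; apply: near.
  - by right; apply: near.
by move=> r; apply: Classical_Prop.NNPP => /far [_] /not_rigid.
Qed.

Lemma S_rigid c t :
  (if c == 0%N then [pchar k] =i pred0 else c \in [pchar k]) -> (S c t <-> rigid t).
Proof.
rewrite /S; case: eqP => [_ ch|c0 ch].
  by split=> // _; apply/rigidP; split; exact: char0_gapge.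
have := pcharf_prime ch; case: eqP => [e2 _|n2]; first by rewrite e2 in ch; exact: char2_rigid.
case: eqP => [e3 _|n3 pr]; first by rewrite e3 in ch; exact: char3_rigid.
by apply: charp_rigid => //; move: (prime_gt1 pr) n2 n3; clear; lia.
Qed.
End Rigidity.

(** * Projective resolutions *)

Section Kernel.
Variables (R : comNzRingType) (B C : lmodType R) (d : {linear B -> C}).

Definition kerp : {pred B} := [pred b | d b == 0].

Lemma kerp_closed : submod_closed kerp.
Proof.
split=> [|a u v]; rewrite !inE ?linear0 // linearP => /eqP -> /eqP ->.
by rewrite scaler0 addr0.
Qed.

HB.instance Definition _ := GRing.isSubmodClosed.Build R B kerp kerp_closed.

Record ker := Ker { ker_val : B; ker_valP : ker_val \in kerp }.

HB.instance Definition _ := [isSub for ker_val].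
HB.instance Definition _ := [Choice of ker by <:].
HB.instance Definition _ := [SubChoice_isSubLmodule of ker by <:].
End Kernel.

Section Linear.
Variables (R : comNzRingType).

Definition mklin (U V : lmodType R) (f : U -> V) (hf : linear f) : {linear U -> V} :=
  HB.pack f (GRing.isLinear.Build R U V *:%R f hf).

Lemma lift_exact (P A B C : lmodType R) (g : {linear A -> B}) (d : {linear B -> C})
  (h : {linear P -> B}) : projective P -> (forall b, d b = 0 <-> exists a, g a = b) ->
  (forall x, d (h x) = 0) -> exists h' : {linear P -> A}, forall x, g (h' x) = h x.
Proof.
move=> pP ex dh.
have gk a : g a \in kerp d by rewrite inE; apply/eqP/ex; exists a.
have hk x : h x \in kerp d by rewrite inE dh.
have gl : linear (fun a => Ker (gk a) : ker d) by move=> a u v; apply: val_inj; exact: linearP.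
have hl : linear (fun a => Ker (hk a) : ker d) by move=> a u v; apply: val_inj; exact: linearP.
have [b|h' e] := pP _ _ (mklin gl) (mklin hl).
  have /eqP/ex [a ea] : d (val b) == 0 by have := valP b; rewrite inE.
  by exists a; apply: val_inj.
by exists h' => x; have := congr1 val (e x).
Qed.

Lemma projective_regular : projective (R^o : lmodType R).
Proof.
move=> A B g h sg; have [a ea] := sg (h 1).
have l : linear (fun r : R^o => (r : R) *: a) by move=> x u v; rewrite scalerDl scalerA.
by exists (mklin l) => r /=; rewrite linearZ ea -linearZ /= [_ *: _]mulr1.
Qed.

Lemma projective_prod (P Q : lmodType R) : projective P -> projective Q ->
  projective ((P * Q)%type : lmodType R).
Proof.
move=> pP pQ A B g h sg.
have l1 : linear (fun p : P => h (p, 0)).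
  by move=> a u v; rewrite -linearP; congr (h _); apply: injective_projections; rewrite //= scaler0 addr0.
have l2 : linear (fun q : Q => h (0, q)).
  by move=> a u v; rewrite -linearP; congr (h _); apply: injective_projections; rewrite //= scaler0 addr0.
have [h1 e1] := pP _ _ g (mklin l1) sg; have [h2 e2] := pQ _ _ g (mklin l2) sg.
have l : linear (fun x : P * Q => h1 x.1 + h2 x.2).
  by move=> a u v; rewrite /= !linearP scalerDr addrACA.
exists (mklin l) => -[p q] /=; rewrite linearD e1 e2 /= -linearD; congr (h _).
by apply: injective_projections; rewrite /= ?addr0 ?add0r.
Qed.

Lemma projective_zero (P : lmodType R) : (forall x : P, x = 0) -> projective P.
Proof.
move=> z A B g h sg.
have l : linear (fun _ : P => 0 : A) by move=> a u v; rewrite scaler0 addr0.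
by exists (mklin l) => p /=; rewrite (z p) !linear0.
Qed.

Section Homotopy.
Variables (M : lmodType R) (F : nat -> lmodType R).
Variables (dF : forall i, {linear F i.+1 -> F i}) (eF : {linear F 0 -> M}).
Hypotheses (pF : forall i, projective (F i)) (sF : forall m, exists x, eF x = m).
Hypotheses (xF0 : forall x, eF x = 0 <-> exists y, dF 0 y = x).
Hypotheses (xF : forall i x, dF i x = 0 <-> exists y, dF i.+1 y = x).

(* A resolution of length n and F are homotopy equivalent, so the identity of F is
   null-homotopic in degrees above n. *)
Lemma finite_pd_contractible : finite_pd M ->
  exists n, forall i, (n <= i)%N -> exists (h : {linear F i.+1 -> F i.+2})
    (h' : {linear F i -> F i.+1}), forall x, x = dF i.+1 (h x) + h' (dF i x).
Proof.
move=> [n [P [dP [eP [pP zP sP xP0 xP]]]]]; exists n => i lei.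
have dFF j x : dF j (dF j.+1 x) = 0 by apply/xF; exists x.
have dPP j x : dP j (dP j.+1 x) = 0 by apply/xP; exists x.
(* Comparison maps f: F -> P and g: P -> F over M, and a homotopy h from g f to the identity. Above
   degree n the map f is zero, so the negated homotopy contracts the identity. *)
suff [f0 [f1 [g0 [g1 [h0 [h1 [_ _ H]]]]]]] : exists (f0 : {linear F i -> P i})
    (f1 : {linear F i.+1 -> P i.+1}) (g0 : {linear P i -> F i}) (g1 : {linear P i.+1 -> F i.+1})
    (h0 : {linear F i -> F i.+1}) (h1 : {linear F i.+1 -> F i.+2}),
    [/\ forall x, dP i (f1 x) = f0 (dF i x), forall x, dF i (g1 x) = g0 (dP i x)
      & forall x, dF i.+1 (h1 x) = g1 (f1 x) - x - h0 (dF i x)].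
  exists (\- h1), (\- h0) => x /=; rewrite linearN H (zP _ _ (f1 x)) ?ltnS // linear0 sub0r.
  by rewrite opprD !opprK addrK.
elim: i {lei} => [|i [f0 [f1 [g0 [g1 [h0 [h1 [ef eg eh]]]]]]]].
  have eFd x : eF (dF 0 x) = 0 by apply/xF0; exists x.
  have ePd x : eP (dP 0 x) = 0 by apply/xP0; exists x.
  have [f0 ef0] := @pF 0%N _ _ eP eF sP; have [g0 eg0] := pP 0%N _ _ eF eP sF.
  have [x|f1 ef1] := lift_exact (h := f0 \o dF 0) (@pF 1%N) xP0; first by rewrite /= ef0.
  have [x|g1 eg1] := lift_exact (h := g0 \o dP 0) (pP 1%N) xF0; first by rewrite /= eg0.
  have [x|h0 eh0] := lift_exact (h := (g0 \o f0) \- idfun) (@pF 0%N) xF0.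
    by rewrite /= linearB /= eg0 ef0 subrr.
  have [x|h1 eh1] := lift_exact (h := (g1 \o f1) \- idfun \- (h0 \o dF 0)) (@pF 1%N) (@xF 0%N).
    by rewrite /= !linearB /= eg1 /= ef1 /= eh0 /= subrr.
  by exists f0, f1, g0, g1, h0, h1; split.
have [x|f2 ef2] := lift_exact (h := f1 \o dF i.+1) (@pF i.+2) (xP i).
  by rewrite /= ef dFF linear0.
have [x|g2 eg2] := lift_exact (h := g1 \o dP i.+1) (pP i.+2) (@xF i).
  by rewrite /= eg dPP linear0.
have [x|h2 eh2] := lift_exact (h := (g2 \o f2) \- idfun \- (h1 \o dF i.+1)) (@pF i.+2) (@xF i.+1).
  by rewrite /= !linearB /= eg2 /= ef2 /= eh dFF linear0 subr0 subrr.
by exists f1, f2, g1, g2, h1, h2; split.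
Qed.
End Homotopy.
End Linear.

(** * Regular elements and Cramer's rule *)

Section CrossProduct.
Variable R : comNzRingType.

Definition reg (u : R) := forall a, u * a = 0 -> a = 0.
(** That is, v is a nonzerodivisor modulo u; together with [reg u] it makes u, v a regular
    sequence. *)
Definition cop (u v : R) := forall a b, u * a = v * b -> exists c, b = u * c.

Lemma reg_cancel (u a b : R) : reg u -> u * a = u * b -> a = b.
Proof.
by move=> ru h; apply/eqP; rewrite -subr_eq0; apply/eqP/ru; rewrite mulrBr h subrr.
Qed.

Lemma regM u v : reg u -> reg v -> reg (u * v).
Proof. by move=> ru rv a; rewrite -mulrA => /ru/rv. Qed.

Lemma regX u i : reg u -> reg (u ^+ i).
Proof.
move=> ru; elim: i => [|i IH]; first by move=> a; rewrite expr0 mul1r.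
by rewrite exprS; apply: regM.
Qed.

Lemma copX u v i j : reg u -> cop u v -> cop (u ^+ i) (v ^+ j).
Proof.
move=> ru cuv; have cj : cop u (v ^+ j).
  elim: j => [|j IH] a b; first by rewrite expr0 mul1r => <-; exists a.
  by rewrite exprS -mulrA => /cuv [c e]; apply: (IH c b).
elim: i => [|i IH] a b; first by exists b; rewrite expr0 mul1r.
rewrite exprS -mulrA => e; have [c ec] := cj _ _ e.
have [|d ed] := IH a c; last by exists d; rewrite ec ed mulrA.
by apply/eqP; rewrite -subr_eq0; apply/eqP/ru; rewrite mulrBr e ec mulrCA subrr.
Qed.

(* Cramer's rule: the cross product of a vector orthogonal to g with either
   member of the pair is proportional to g. *)
Lemma cross_basis (g1 g2 g3 u1 u2 u3 v1 v2 v3 a1 a2 a3 : R) :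
  g1 = u2 * v3 - u3 * v2 -> g2 = u3 * v1 - u1 * v3 -> g3 = u1 * v2 - u2 * v1 ->
  reg g1 -> cop g1 g2 -> a1 * g1 + a2 * g2 + a3 * g3 = 0 ->
  exists b c, [/\ a1 = b * u1 + c * v1, a2 = b * u2 + c * v2 & a3 = b * u3 + c * v3].
Proof.
move=> e1 e2 e3 rg cg h.
have [|b eb] := cg (a3 * v1 - a1 * v3) (a2 * v3 - a3 * v2).
  apply/eqP; rewrite -subr_eq0; apply/eqP.
  transitivity (- v3 * (a1 * g1 + a2 * g2 + a3 * g3)); last by rewrite h mulr0.
  by rewrite e1 e2 e3; ring.
have [|c ec] := cg (u3 * a1 - u1 * a3) (u2 * a3 - u3 * a2).
  apply/eqP; rewrite -subr_eq0; apply/eqP.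
  transitivity (u3 * (a1 * g1 + a2 * g2 + a3 * g3)); last by rewrite h mulr0.
  by rewrite e1 e2 e3; ring.
exists b, c; split; apply/eqP; rewrite -subr_eq0; apply/eqP/rg.
- transitivity (a1 * g1 - (g1 * b) * u1 - (g1 * c) * v1); first by ring.
  rewrite -eb -ec -[RHS]h e2 e3; ring.
- transitivity (a2 * g1 - (g1 * b) * u2 - (g1 * c) * v2); first by ring.
  by rewrite -eb -ec e1; ring.
- transitivity (a3 * g1 - (g1 * b) * u3 - (g1 * c) * v3); first by ring.
  by rewrite -eb -ec e1; ring.
Qed.

Lemma cross_free (g1 u2 u3 v2 v3 b c : R) : g1 = u2 * v3 - u3 * v2 -> reg g1 ->
  b * u2 + c * v2 = 0 -> b * u3 + c * v3 = 0 -> b = 0 /\ c = 0.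
Proof.
move=> e1 rg h2 h3; split; apply: rg; rewrite e1.
  transitivity ((b * u2 + c * v2) * v3 - (b * u3 + c * v3) * v2); first by ring.
  by rewrite h2 h3 !mul0r subrr.
transitivity ((b * u3 + c * v3) * u2 - (b * u2 + c * v2) * u3); first by ring.
by rewrite h2 h3 !mul0r subrr.
Qed.
End CrossProduct.

Section Resolutions.
Variables (R : comNzRingType) (g1 g2 g3 : R).
Local Notation Q := (@Quotient.quot R (ideal3 g1 g2 g3)).
Local Notation R1 := (R^o : lmodType R).
Local Notation R2 := ((R^o * R^o)%type : lmodType R).
Local Notation R3 := ((R^o * R^o * R^o)%type : lmodType R).
Local Notation R4 := ((R^o * R^o * R^o * R^o)%type : lmodType R).
Local Notation Z0 := ('rV[R]_0 : lmodType R).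

Definition dot3 (U : R3) (a1 a2 a3 : R) : R := U.1.1 * a1 + U.1.2 * a2 + U.2 * a3.

Lemma aug_linear : linear (fun r : R1 => \pi_Q r : (Q : lmodType R)).
Proof.
move=> a u v; rewrite pi_addr; congr (_ + _); apply: Qpi_eq.
by rewrite -[a *: u]/(a * (u : R)) -mulrBr; apply: ideal3M; rewrite -opprB rpredN repr_pi_in.
Qed.

Definition aug : {linear R1 -> Q} := mklin aug_linear.

Lemma aug_surj m : exists x, aug x = m.
Proof. by exists (repr m); rewrite /= reprK. Qed.

Lemma dot3_linear a1 a2 a3 : linear (fun U : R3 => dot3 U a1 a2 a3 : R1).
Proof.
move=> r [[u1 u2] u3] [[v1 v2] v3]; rewrite /dot3 /= -[_ *: _ in RHS]/(r * _).
by rewrite -![_ *: _]/(r * _); ring.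
Qed.

Definition d0 : {linear R3 -> R1} := mklin (dot3_linear g1 g2 g3).

Lemma aug_exact x : aug x = 0 <-> exists y, d0 y = x.
Proof.
split.
  rewrite /= -[0](raddf0 (\pi_Q)) => /eqP; rewrite -Quotient.idealrBE subr0.
  by move=> /pboolP [a [b [c ->]]]; exists (a, b, c).
move=> [[[a b] c] <-] /=; rewrite -[RHS](raddf0 (\pi_Q)).
by apply: Qpi_eq; rewrite subr0; apply/pboolP; exists a, b, c.
Qed.

Lemma proj2 : projective R2.
Proof. by apply: projective_prod; exact: projective_regular. Qed.
Lemma proj3 : projective R3.
Proof. by apply: projective_prod; [exact: proj2|exact: projective_regular]. Qed.
Lemma proj4 : projective R4.
Proof. by apply: projective_prod; [exact: proj3|exact: projective_regular]. Qed.

Lemma rV0_eq0 (x : Z0) : x = 0. Proof. exact: thinmx0. Qed.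

Lemma zero_linear (U V : lmodType R) : linear (fun _ : U => 0 : V).
Proof. by move=> a u v; rewrite scaler0 addr0. Qed.

Section HilbertBurch.
Variables u1 u2 u3 v1 v2 v3 : R.
Hypotheses (e1 : g1 = u2 * v3 - u3 * v2) (e2 : g2 = u3 * v1 - u1 * v3)
  (e3 : g3 = u1 * v2 - u2 * v1) (rg : reg g1) (cg : cop g1 g2).

Lemma hb_linear : linear (fun x : R2 =>
  (x.1 * u1 + x.2 * v1, x.1 * u2 + x.2 * v2, x.1 * u3 + x.2 * v3) : R3).
Proof.
move=> r [a b] [c d]; congr (_, _, _) => /=; rewrite -![_ *: _]/(r * _); ring.
Qed.

Definition hbP (i : nat) : lmodType R :=
  match i with 0%N => R1 | 1%N => R3 | 2%N => R2 | _ => Z0 end.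

Definition hbd (i : nat) : {linear hbP i.+1 -> hbP i} :=
  match i with
  | 0%N => d0
  | 1%N => mklin hb_linear
  | _.+2 => mklin (@zero_linear Z0 _)
  end.

Lemma hilbert_burch_finite_pd : finite_pd (Q : lmodType R).
Proof.
exists 2%N, hbP, hbd, aug; split.
- case=> [|[|[|i]]]; [exact: projective_regular|exact: proj3|exact: proj2|].
  by apply: projective_zero => x; exact: rV0_eq0.
- by case=> [|[|[|i]]] // _ x; exact: rV0_eq0.
- exact: aug_surj.
- exact: aug_exact.
case=> [|[|i]] /=.
- move=> [[a1 a2] a3]; rewrite /dot3 /=; split.
    move=> h; have [b [c [-> -> ->]]] := cross_basis e1 e2 e3 rg cg h.
    by exists (b, c).
  by move=> [[b c] [<- <- <-]] /=; rewrite e1 e2 e3; ring.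
- move=> [b c]; split; last by move=> [y <-]; congr (_, _, _) => /=; rewrite !mul0r addr0.
  by case=> /= h1 h2 h3; exists 0; have [-> ->] := cross_free e1 rg h2 h3.
- by move=> x; split=> [_|_]; [exists 0; rewrite [RHS]rV0_eq0|].
Qed.
End HilbertBurch.

Section Koszul.
(* phi a b (V, s) = (a x V - s b, V . b): for a . b = f this is a matrix
   factorization, phi b a (phi a b x) = - f x. *)
Definition phi (a1 a2 a3 b1 b2 b3 : R) (x : R4) : R4 :=
  (a2 * x.1.2 - a3 * x.1.1.2 - x.2 * b1, a3 * x.1.1.1 - a1 * x.1.2 - x.2 * b2,
   a1 * x.1.1.2 - a2 * x.1.1.1 - x.2 * b3, x.1.1.1 * b1 + x.1.1.2 * b2 + x.1.2 * b3).

Lemma phi_linear a1 a2 a3 b1 b2 b3 : linear (phi a1 a2 a3 b1 b2 b3 : R4 -> R4).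
Proof.
move=> r [[[x1 x2] x3] x0] [[[y1 y2] y3] y0]; congr (_, _, _, _) => /=;
  rewrite -![_ *: _]/(r * _); ring.
Qed.

Variables a1 a2 a3 b1 b2 b3 : R.
Variable tau : {linear R3 -> R3}.
Variable mI : R -> Prop.
Hypotheses (ab : a1 * b1 + a2 * b2 + a3 * b3 = 0) (ra : reg a1).
Hypothesis exab : forall x, phi a1 a2 a3 b1 b2 b3 x = 0 -> exists y, phi b1 b2 b3 a1 a2 a3 y = x.
Hypothesis exba : forall x, phi b1 b2 b3 a1 a2 a3 x = 0 -> exists y, phi a1 a2 a3 b1 b2 b3 y = x.
Hypothesis exK : forall U : R3, dot3 U a1 a2 a3 = 0 -> exists x, (phi a1 a2 a3 b1 b2 b3 x).1 = U.
Hypotheses (tau_syz : forall U, dot3 U a1 a2 a3 = 0 -> dot3 (tau U) g1 g2 g3 = 0)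
  (tau_onto : forall u, dot3 u g1 g2 g3 = 0 -> exists U, dot3 U a1 a2 a3 = 0 /\ tau U = u)
  (tau_inj : forall U, dot3 U a1 a2 a3 = 0 -> tau U = 0 -> U = 0).
Hypotheses (mD : forall x y, mI x -> mI y -> mI (x + y)) (mM : forall x y, mI y -> mI (x * y)).
Hypothesis (m1 : ~ mI 1).
Hypotheses (ma : [/\ mI a1, mI a2 & mI a3]) (mb : [/\ mI b1, mI b2 & mI b3]).

Definition kF (i : nat) : lmodType R :=
  match i with 0%N => R1 | 1%N => R3 | _ => R4 end.

Lemma rho_linear : linear (fun x : R4 => tau (phi a1 a2 a3 b1 b2 b3 x).1).
Proof. by move=> r x y; rewrite (phi_linear a1 a2 a3 b1 b2 b3) /= linearP. Qed.

Definition kd (i : nat) : {linear kF i.+1 -> kF i} :=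
  match i with
  | 0%N => d0
  | 1%N => mklin rho_linear
  | j.+2 => if odd j then mklin (phi_linear a1 a2 a3 b1 b2 b3)
            else mklin (phi_linear b1 b2 b3 a1 a2 a3)
  end.

Lemma phi_dot x : dot3 (phi a1 a2 a3 b1 b2 b3 x).1 a1 a2 a3 = 0.
Proof.
transitivity (- x.2 * (a1 * b1 + a2 * b2 + a3 * b3)); last by rewrite ab mulr0.
by rewrite /dot3 /=; ring.
Qed.

Lemma phi_phi (c1 c2 c3 d1 d2 d3 : R) x : c1 * d1 + c2 * d2 + c3 * d3 = 0 ->
  phi d1 d2 d3 c1 c2 c3 (phi c1 c2 c3 d1 d2 d3 x) = 0.
Proof.
move=> cd.
have z y : - y * (c1 * d1 + c2 * d2 + c3 * d3) = 0 by rewrite cd mulr0.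
case: x => [[[x1 x2] x3] x0]; congr (_, _, _, _) => /=.
- by rewrite -(z x1); ring.
- by rewrite -(z x2); ring.
- by rewrite -(z x3); ring.
- by rewrite -(z x0); ring.
Qed.

(** Regularity of a1 recovers the last entry from the first three, so dropping it does not enlarge
    the kernel where the periodic part meets R^3. *)
Lemma phi_first x : (phi a1 a2 a3 b1 b2 b3 x).1 = 0 -> phi a1 a2 a3 b1 b2 b3 x = 0.
Proof.
case: x => [[[x1 x2] x3] x0] [h1 h2 h3]; congr (_, _, _, _) => //=; rewrite /= in h1 h2 h3.
apply: ra; transitivity (b2 * (a1 * x2 - a2 * x1 - x0 * b3) - b3 * (a3 * x1 - a1 * x3 - x0 * b2)
    + x1 * (a1 * b1 + a2 * b2 + a3 * b3)); first by ring.
by rewrite h2 h3 ab !mulr0 subrr addr0.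
Qed.

(** The periodic differentials have all entries in the proper ideal [mI]. A null-homotopy of the
    identity would put 1 into [mI]. *)
Lemma koszul_pd_infinite : pd_infinite (Q : lmodType R).
Proof.
move=> fin.
have ba : b1 * a1 + b2 * a2 + b3 * a3 = 0 by rewrite -ab; ring.
have pK i : projective (kF i).
  by case: i => [|[|i]]; [exact: projective_regular|exact: proj3|exact: proj4].
have xK i (x : kF i.+1) : kd i x = 0 <-> exists y, kd i.+1 y = x.
  case: i x => [|[|i]].
  - move=> x; split=> [h|[y <-]]; last exact: tau_syz (phi_dot y).
    by have [U [/exK [y <-] <-]] := tau_onto h; exists y.
  - move=> x; split=> [h|[y <-]].
      have /phi_first/exab [y <-] := tau_inj (phi_dot x) h.
      by exists y.
    rewrite -[kd 1 _]/(tau (phi a1 a2 a3 b1 b2 b3 (phi b1 b2 b3 a1 a2 a3 y)).1) phi_phi //.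
    exact: linear0.
  - rewrite /=; case: (odd i) => x; split=> [|[y <-]] /=; try exact: phi_phi.
      by move/exab.
    by move/exba.
have [n contr] := finite_pd_contractible pK aug_surj aug_exact xK fin.
(* The shift by 2 places every module and differential involved in the periodic part. *)
have [h [h' e]] := contr (n.+2) (leq_trans (leqnSn n) (leqnSn _)).
pose mF (x : R4) := [/\ mI x.1.1.1, mI x.1.1.2, mI x.1.2 & mI x.2].
have mr x y : mI x -> mI (x * y) by rewrite mulrC; exact: mM.
have mN x : mI x -> mI (- x) by rewrite -mulN1r; exact: mM.
have mphi (c1 c2 c3 d1 d2 d3 : R) x : [/\ mI c1, mI c2 & mI c3] -> [/\ mI d1, mI d2 & mI d3] ->
    mF (phi c1 c2 c3 d1 d2 d3 x).
  move=> [p1 p2 p3] [q1 q2 q3]; split; rewrite /=; do ?apply: mD; do ?apply: mN;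
  by [apply: mr|apply: mM].
have mkd x : mF (kd n.+2 x) by rewrite /=; case: (odd n); exact: mphi.
have mkd' x : mF (kd n.+3 x) by rewrite [kd _]/=; case: ifP => _; exact: mphi.
have mh' (x : R4) : mF x -> mF (h' x).
  move: x => [[[x1 x2] x3] x0] [/= k1 k2 k3 k0].
  have -> : ((x1, x2, x3, x0) : R4) = x1 *: ((1, 0, 0, 0) : R4) + x2 *: ((0, 1, 0, 0) : R4)
     + x3 *: ((0, 0, 1, 0) : R4) + x0 *: ((0, 0, 0, 1) : R4).
    by congr (_, _, _, _); rewrite /= -![_ *: _]/(_ * _); ring.
  by rewrite !linearD !linearZ; split; rewrite /=; do ?apply: mD; apply: mr.
have [h1 _ _ _] := mkd' (h (1, 0, 0, 0)).
have [h2 _ _ _] := mh' _ (mkd (1, 0, 0, 0)).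
apply: m1; have /(congr1 (fun x : R4 => x.1.1.1)) /= := e (1, 0, 0, 0).
by move=> ->; apply: mD.
Qed.
End Koszul.
End Resolutions.

(** * From the syzygies of the powers of x^n to those of x^N *)

Section SyzygyTransfer.
Variable R : comNzRingType.
Local Notation R3 := ((R^o * R^o * R^o)%type : lmodType R).

(* xr, xs stand for x^r, x^(n-r) and xt for x^(n theta); (P1, Q1, S1) and
   (P2, Q2, S2) form a basis of the syzygies of (xt, yt, zt). *)
Variables xr yr zr xs ys zs xt yt zt P1 Q1 S1 P2 Q2 S2 kap kap' : R.
Hypotheses (rx : reg xr) (ry : reg yr) (rz : reg zr) (rxt : reg xt) (cxt : cop xt yt).
Hypothesis (kapE : kap' * kap = 1).
Hypotheses (e1 : kap * xt = Q1 * S2 - S1 * Q2) (e2 : kap * yt = S1 * P2 - P1 * S2)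
  (e3 : kap * zt = P1 * Q2 - Q1 * P2).

Lemma kap_inj a : kap * a = 0 -> a = 0.
Proof. by move=> h; rewrite -[a]mul1r -kapE -mulrA h mulr0. Qed.

Lemma syz_span A1 A2 A3 : A1 * xt + A2 * yt + A3 * zt = 0 -> exists a b,
  [/\ A1 = a * P1 + b * P2, A2 = a * Q1 + b * Q2 & A3 = a * S1 + b * S2].
Proof.
move=> h.
have f u : u = kap' * (kap * u) by rewrite mulrA kapE mul1r.
have := @cross_basis R xt yt zt (kap' * P1) (kap' * Q1) (kap' * S1) P2 Q2 S2 A1 A2 A3 _ _ _ rxt cxt h.
case.
- by rewrite (f xt) e1; ring.
- by rewrite (f yt) e2; ring.
- by rewrite (f zt) e3; ring.
by move=> a [b [-> -> ->]]; exists (a * kap'), b; rewrite !mulrA.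
Qed.

Lemma syz_free a b : a * Q1 + b * Q2 = 0 -> a * S1 + b * S2 = 0 -> a = 0 /\ b = 0.
Proof.
apply: cross_free e1 _ => c; rewrite -mulrA => /kap_inj; exact: rxt.
Qed.

Lemma syz_rel a b : (a * P1 + b * P2) * xt + (a * Q1 + b * Q2) * yt + (a * S1 + b * S2) * zt = 0.
Proof.
apply: kap_inj; transitivity ((a * P1 + b * P2) * (kap * xt) + (a * Q1 + b * Q2) * (kap * yt)
  + (a * S1 + b * S2) * (kap * zt)); first by ring.
by rewrite e1 e2 e3; ring.
Qed.

Lemma aligned_finite_pd : finite_pd (@Quotient.quot R (ideal3 xt yt zt) : lmodType R).
Proof.
have f u : u = kap' * (kap * u) by rewrite mulrA kapE mul1r.
apply: (@hilbert_burch_finite_pd R _ _ _ (kap' * P1) (kap' * Q1) (kap' * S1) P2 Q2 S2) => //.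
- by rewrite (f xt) e1; ring.
- by rewrite (f yt) e2; ring.
- by rewrite (f zt) e3; ring.
Qed.

Let g1 := xt * xr. Let g2 := yt * yr. Let g3 := zt * zr.

(** The new basis divides the first generator componentwise by xr, yr, zr, and multiplies the second
    by xr yr zr before the same division. *)
Lemma split_finite_pd p1 q1 s1 :
  P1 = xr * xs * p1 -> Q1 = yr * ys * q1 -> S1 = zr * zs * s1 -> reg g1 -> cop g1 g2 ->
  finite_pd (@Quotient.quot R (ideal3 g1 g2 g3) : lmodType R).
Proof.
move=> eP eQ eS rg cg; have f u : u = kap' * (kap * u) by rewrite mulrA kapE mul1r.
apply: (@hilbert_burch_finite_pd R _ _ _ (kap' * (xs * p1)) (kap' * (ys * q1)) (kap' * (zs * s1))
  (yr * zr * P2) (xr * zr * Q2) (xr * yr * S2)) => //.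
- by rewrite /g1 (f xt) e1 eQ eS; ring.
- by rewrite /g2 (f yt) e2 eP eS; ring.
- by rewrite /g3 (f zt) e3 eP eQ; ring.
Qed.

Section Even.
Variables p1 q2 s3 : R.
Hypotheses (eP1 : P1 = xr * xs * p1) (eQ2 : Q2 = yr * ys * q2) (eS : S1 + S2 = zr * zs * s3).
Hypotheses (dX : forall a b, a * P2 = xr * b -> exists c, a = xr * c)
  (dY : forall a b, a * Q1 = yr * b -> exists c, a = yr * c)
  (dZ : forall a b, a * S1 = zr * b -> exists c, a = zr * c).

(** A combination a, b of the basis is a syzygy of (g1, g2, g3), up to the factors xr, yr, zr,
    exactly when xr | b, yr | a and zr | a - b. With b = xr U1 and a = - yr U2 the last condition
    says that U is a syzygy of (xr, yr, zr). *)
Definition tau_even_fun (U : R3) : R3 :=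
  (U.1.1 * P2 - yr * U.1.2 * xs * p1, xr * U.1.1 * ys * q2 - U.1.2 * Q1,
   U.2 * S1 + xr * U.1.1 * zs * s3).

Lemma tau_even_linear : linear tau_even_fun.
Proof.
move=> r [[u1 u2] u3] [[v1 v2] v3]; congr (_, _, _) => /=; rewrite -![_ *: _]/(r * _); ring.
Qed.

Lemma tau_even_scale U : dot3 U xr yr zr = 0 ->
  let a := - yr * U.1.2 in let b := xr * U.1.1 in
  [/\ xr * (tau_even_fun U).1.1 = a * P1 + b * P2, yr * (tau_even_fun U).1.2 = a * Q1 + b * Q2,
      zr * (tau_even_fun U).2 = a * S1 + b * S2 & zr * U.2 = a - b].
Proof.
case: U => [[u1 u2] u3]; rewrite /dot3 /= => h.
have ez : zr * u3 = - yr * u2 - xr * u1.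
  by apply/eqP; rewrite -subr_eq0; apply/eqP; rewrite -[RHS]h; ring.
split=> //; first by rewrite eP1; ring.
  by rewrite eQ2; ring.
have -> : S2 = zr * zs * s3 - S1 by rewrite -eS; ring.
transitivity ((zr * u3) * S1 + zr * (xr * u1 * zs * s3)); first by ring.
by rewrite ez; ring.
Qed.

Lemma tau_even : exists tau : {linear R3 -> R3},
  [/\ forall U, dot3 U xr yr zr = 0 -> dot3 (tau U) g1 g2 g3 = 0,
      forall u, dot3 u g1 g2 g3 = 0 -> exists U, dot3 U xr yr zr = 0 /\ tau U = u
    & forall U, dot3 U xr yr zr = 0 -> tau U = 0 -> U = 0].
Proof.
exists (mklin tau_even_linear); split.
- move=> U /tau_even_scale [h1 h2 h3 _].
  have := syz_rel (- yr * U.1.2) (xr * U.1.1); rewrite -h1 -h2 -h3 => <-.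
  by rewrite /dot3 /g1 /g2 /g3 /=; ring.
- move=> [[u1 u2] u3]; rewrite /dot3 /g1 /g2 /g3 /= => h.
  have [|a [b [f1 f2 f3]]] := @syz_span (xr * u1) (yr * u2) (zr * u3).
    by rewrite -[RHS]h; ring.
  have [|b' eb] := dX (a := b) (b := u1 - a * xs * p1).
    by rewrite mulrBr f1 eP1; ring.
  have [|a' ea] := dY (a := a) (b := u2 - b * ys * q2).
    by rewrite mulrBr f2 eQ2; ring.
  have [|c' ec] := dZ (a := a - b) (b := u3 - b * zs * s3).
    have eS2 : S2 = zr * zs * s3 - S1 by rewrite -eS; ring.
    by rewrite mulrBr f3 eS2; ring.
  exists (b', - a', c').
  have d : dot3 (b', - a', c') xr yr zr = 0.
    rewrite /dot3 /=; transitivity (xr * b' - yr * a' + zr * c'); first by ring.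
    by rewrite -eb -ea -ec; ring.
  have [h1 h2 h3 _] := tau_even_scale d; rewrite /= in h1 h2 h3.
  split=> //; congr (_, _, _) => /=.
  + by apply: (reg_cancel rx); rewrite h1 f1 ea eb; ring.
  + by apply: (reg_cancel ry); rewrite h2 f2 ea eb; ring.
  + by apply: (reg_cancel rz); rewrite h3 f3 ea eb; ring.
- move=> U d tU; have [h1 h2 h3 h4] := tau_even_scale d.
  have t0 : tau_even_fun U = 0 by exact: tU.
  rewrite t0 !mulr0 in h2 h3.
  have [a0 b0] := syz_free (esym h2) (esym h3).
  case: U {d tU h1 h2 h3 t0} h4 a0 b0 => [[u1 u2] u3] /= h4 a0 b0; congr (_, _, _).
  + exact: rx.
  + by apply: ry; rewrite -[LHS]opprK -mulNr a0 oppr0.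
  + by apply: rz; rewrite h4 a0 b0 subr0.
Qed.
End Even.

Section Odd.
Variables p2 q2 s3 : R.
Hypotheses (eP2 : P2 = xr * xs * p2) (eQ2 : Q2 = yr * ys * q2)
  (eS : S2 + yr * ys * S1 = zr * zs * s3).
Hypotheses (dX : forall a b, a * P1 = xr * b -> exists c, a = xr * c)
  (dY : forall a b, a * Q1 = yr * b -> exists c, a = yr * c)
  (dZ : forall a b, a * S1 = zr * b -> exists c, a = zr * c).
Hypotheses (cyx : cop yr xr) (cyz : cop yr zr).

(** Here the conditions are xr | a, yr | a and zr | a - b yr ys. With a = xr yr U1 and b = - U2 the
    factor yr cancels from the last one, which leaves a syzygy of (xr, ys, zr); hence the exponents
    r, n - r, r. *)
Definition tau_odd_fun (U : R3) : R3 :=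
  (yr * U.1.1 * P1 - U.1.2 * xs * p2, xr * U.1.1 * Q1 - U.1.2 * ys * q2,
   - (yr * U.2 * S1) - U.1.2 * zs * s3).

Lemma tau_odd_linear : linear tau_odd_fun.
Proof.
move=> r [[u1 u2] u3] [[v1 v2] v3]; congr (_, _, _) => /=; rewrite -![_ *: _]/(r * _); ring.
Qed.

Lemma tau_odd_scale U : dot3 U xr ys zr = 0 ->
  let a := xr * yr * U.1.1 in let b := - U.1.2 in
  [/\ xr * (tau_odd_fun U).1.1 = a * P1 + b * P2, yr * (tau_odd_fun U).1.2 = a * Q1 + b * Q2,
      zr * (tau_odd_fun U).2 = a * S1 + b * S2 & zr * (yr * U.2) = b * yr * ys - a].
Proof.
case: U => [[u1 u2] u3]; rewrite /dot3 /= => h.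
have ez : zr * u3 = - (xr * u1 + ys * u2).
  by apply/eqP; rewrite -subr_eq0; apply/eqP; rewrite -[RHS]h; ring.
split; first by rewrite eP2; ring.
- by rewrite eQ2; ring.
- have -> : S2 = zr * zs * s3 - yr * ys * S1 by rewrite -eS; ring.
  transitivity (- (yr * (zr * u3) * S1) - zr * (u2 * zs * s3)); first by ring.
  by rewrite ez; ring.
- by rewrite mulrCA ez; ring.
Qed.

Lemma tau_odd : exists tau : {linear R3 -> R3},
  [/\ forall U, dot3 U xr ys zr = 0 -> dot3 (tau U) g1 g2 g3 = 0,
      forall u, dot3 u g1 g2 g3 = 0 -> exists U, dot3 U xr ys zr = 0 /\ tau U = u
    & forall U, dot3 U xr ys zr = 0 -> tau U = 0 -> U = 0].
Proof.
exists (mklin tau_odd_linear); split.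
- move=> U /tau_odd_scale [h1 h2 h3 _].
  have := syz_rel (xr * yr * U.1.1) (- U.1.2); rewrite -h1 -h2 -h3 => <-.
  by rewrite /dot3 /g1 /g2 /g3 /=; ring.
- move=> [[u1 u2] u3]; rewrite /dot3 /g1 /g2 /g3 /= => h.
  have [|a [b [f1 f2 f3]]] := @syz_span (xr * u1) (yr * u2) (zr * u3).
    by rewrite -[RHS]h; ring.
  have [|a1 ea1] := dX (a := a) (b := u1 - b * xs * p2).
    by rewrite mulrBr f1 eP2; ring.
  have [|a2 ea2] := dY (a := a) (b := u2 - b * ys * q2).
    by rewrite mulrBr f2 eQ2; ring.
  have [|a' ea'] := cyx (a := a2) (b := a1); first by rewrite -ea1 -ea2.
  have [|e ee] := dZ (a := a - b * yr * ys) (b := u3 - b * zs * s3).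
    have eS2 : S2 = zr * zs * s3 - yr * ys * S1 by rewrite -eS; ring.
    by rewrite mulrBr f3 eS2; ring.
  have [|c' ec] := cyz (a := xr * a' - b * ys) (b := e).
    by rewrite -ee ea1 ea'; ring.
  have d : dot3 (a', - b, - c') xr ys zr = 0.
    apply: ry; rewrite /dot3 /=; transitivity (xr * (yr * a') - b * yr * ys - zr * (yr * c')); first by ring.
    by rewrite -ea' -ec -ee -ea1 subrr.
  exists (a', - b, - c').
  have [h1 h2 h3 _] := tau_odd_scale d; rewrite /= in h1 h2 h3.
  have ea : a = xr * yr * a' by rewrite ea1 ea' mulrA.
  split=> //; congr (_, _, _) => /=.
  + by apply: (reg_cancel rx); rewrite h1 f1 ea; ring.
  + by apply: (reg_cancel ry); rewrite h2 f2 ea; ring.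
  + by apply: (reg_cancel rz); rewrite h3 f3 ea; ring.
- move=> U d tU; have [h1 h2 h3 h4] := tau_odd_scale d.
  have t0 : tau_odd_fun U = 0 by exact: tU.
  rewrite t0 !mulr0 in h2 h3.
  have [a0 b0] := syz_free (esym h2) (esym h3).
  case: U {d tU h1 h2 h3 t0} h4 a0 b0 => [[u1 u2] u3] /= h4 a0 b0; congr (_, _, _).
  + by apply: ry; apply: rx; rewrite mulrA.
  + by rewrite -[LHS]opprK b0 oppr0.
  + by apply: ry; apply: rz; rewrite h4 a0 b0 !mul0r subr0.
Qed.
End Odd.
End SyzygyTransfer.

(** * The ring of the Fermat curve *)

Section MatrixFactorization.
Variables (P R : comNzRingType) (f : {rmorphism P -> R}) (F : P).
Hypotheses (fsurj : forall r, exists p, f p = r)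
  (fker : forall p, f p = 0 -> exists q, p = q * F) (regF : reg F).

(** Lift x to y over P. Then phi a b y = F w, and applying phi b a gives - F y = F (phi b a w);
    cancelling F shows that x is the image of - w. *)
Lemma mf_exact (a1 a2 a3 b1 b2 b3 : P) x : a1 * b1 + a2 * b2 + a3 * b3 = F ->
  phi (f a1) (f a2) (f a3) (f b1) (f b2) (f b3) x = 0 ->
  exists y, phi (f b1) (f b2) (f b3) (f a1) (f a2) (f a3) y = x.
Proof.
move=> eF; case: x => [[[x1 x2] x3] x0].
have [y1 <-] := fsurj x1; have [y2 <-] := fsurj x2; have [y3 <-] := fsurj x3.
have [y0 <-] := fsurj x0; rewrite /phi /= -!rmorphM -!rmorphB -!rmorphD /=.
case=> /fker [w1 h1] /fker [w2 h2] /fker [w3 h3] /fker [w0 h0].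
exists (- f w1, - f w2, - f w3, - f w0) => /=.
rewrite !mulrN !mulNr !opprK -!rmorphM.
have g1 : y1 = - (b2 * w3) + b3 * w2 + w0 * a1.
  apply: (reg_cancel regF); transitivity (- (b2 * (w3 * F)) + b3 * (w2 * F) + (w0 * F) * a1); last by ring.
  by rewrite -?h1 -?h2 -?h3 -h0 -eF; ring.
have g2 : y2 = - (b3 * w1) + b1 * w3 + w0 * a2.
  apply: (reg_cancel regF); transitivity (- (b3 * (w1 * F)) + b1 * (w3 * F) + (w0 * F) * a2); last by ring.
  by rewrite -?h1 -?h2 -?h3 -h0 -eF; ring.
have g3 : y3 = - (b1 * w2) + b2 * w1 + w0 * a3.
  apply: (reg_cancel regF); transitivity (- (b1 * (w2 * F)) + b2 * (w1 * F) + (w0 * F) * a3); last by ring.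
  by rewrite -?h1 -?h2 -?h3 -h0 -eF; ring.
have g0 : y0 = - (w1 * a1) - w2 * a2 - w3 * a3.
  apply: (reg_cancel regF); transitivity (- ((w1 * F) * a1) - (w2 * F) * a2 - (w3 * F) * a3); last by ring.
  by rewrite -h1 -h2 -h3 -eF; ring.
by rewrite g1 g2 g3 g0 !(rmorphD, rmorphB, rmorphN).
Qed.
End MatrixFactorization.

(** * Regular sequences modulo a monic polynomial *)

Section PolyRegular.
Variable A : idomainType.
Implicit Types (u v : A) (p q a b F : {poly A}).

Lemma polyC_dvd u p : (forall i, exists c, p`_i = u * c) -> exists q, p = u%:P * q.
Proof.
elim/poly_ind: p => [|p c IH] h; first by exists 0; rewrite mulr0.
have [|q eq] := IH.
  by move=> i; have := h i.+1; rewrite coefD coefMX coefC /= addr0.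
have := h 0%N; rewrite coefD coefMX coefC /= add0r => -[d ->].
by exists (q * 'X + d%:P); rewrite eq polyCM mulrDr mulrA.
Qed.

Lemma cop_polyC u v : cop u v -> cop u%:P v%:P.
Proof.
move=> cuv a b e; apply: polyC_dvd => i; apply: (cuv a`_i).
by have := congr1 (fun p : {poly A} => p`_i) e; rewrite !coefCM.
Qed.

Lemma idomain_reg u : u != 0 -> reg u.
Proof. by move=> u0 a /eqP; rewrite mulf_eq0 (negPf u0) => /eqP. Qed.

Lemma root0_factor p : p.[0] = 0 -> exists q, p = q * 'X.
Proof.
move=> h; have /factor_theorem [q ->] : root p 0 by rewrite rootE h.
by exists q; rewrite subr0.
Qed.

Section ModMonic.
Variables (F : {poly A}).
Hypothesis mF : F \is monic.

Lemma monic_division a : exists q r, a = q * F + r /\ (size r < size F)%N.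
Proof.
exists (a %/ F), (a %% F); split; first exact: (Pdiv.IdomainMonic.divp_eq mF).
by rewrite ltn_modpN0 // monic_neq0.
Qed.

Lemma monic_small q r : r = q * F -> (size r < size F)%N -> r = 0.
Proof.
have [->|q0] := eqVneq q 0; first by rewrite mul0r.
move=> ->; rewrite size_Mmonic //; move: q0; rewrite -size_poly_gt0.
by case: (size q) => // m _; rewrite addSn /= ltnNge leq_addl.
Qed.

(** Remainders modulo a monic F form a free module over the coefficients, and multiplication by a
    constant keeps a remainder a remainder. *)
Lemma reg_mod_monic u a q : u != 0 -> u%:P * a = q * F -> exists q', a = q' * F.
Proof.
move=> u0; have [q1 [r [-> sr]]] := monic_division a; move=> e; exists q1.
suff -> : r = 0 by rewrite addr0.
have /monic_small h : u%:P * r = (q - u%:P * q1) * F.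
  by rewrite mulrBl -e; ring.
have /eqP : u%:P * r = 0.
  by apply: h; rewrite mul_polyC; apply: leq_ltn_trans (size_scale_leq _ _) sr.
by rewrite mulf_eq0 polyC_eq0 (negPf u0) => /eqP.
Qed.

Lemma cop_mod_monic u v a b q : cop u v -> u%:P * a - v%:P * b = q * F ->
  exists c q', b = u%:P * c + q' * F.
Proof.
move=> cuv; have [q1 [r [-> sr]]] := monic_division a.
have [q2 [s [-> ss]]] := monic_division b; move=> e.
have /monic_small h : u%:P * r - v%:P * s = (q - u%:P * q1 + v%:P * q2) * F.
  by rewrite mulrDl mulrBl -e; ring.
have z : u%:P * r - v%:P * s = 0.
  apply: h; rewrite !mul_polyC; apply: leq_ltn_trans (size_polyD _ _) _.
  rewrite size_polyN gtn_max; apply/andP; split;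
    by [apply: leq_ltn_trans (size_scale_leq _ _) sr|apply: leq_ltn_trans (size_scale_leq _ _) ss].
have [|c ec] := cop_polyC cuv (a := r) (b := s); first by apply/eqP; rewrite -subr_eq0 z.
by exists c, q2; rewrite ec addrC.
Qed.
End ModMonic.

(** Split w1 and w2 at degree l. The low parts satisfy a relation between u and v alone, which
    coprimality solves; the high parts are absorbed by X^l. *)
Lemma koszul_exact u v l (w1 w2 w3 : {poly A}) : reg u -> cop u v ->
  w1 * u%:P + w2 * v%:P + w3 * 'X^l = 0 -> exists V1 V2 V3,
  [/\ w1 = v%:P * V3 - 'X^l * V2, w2 = 'X^l * V1 - u%:P * V3 & w3 = u%:P * V2 - v%:P * V1].
Proof.
move=> ru cuv h.
pose t1 := take_poly l w1; pose d1 := drop_poly l w1.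
pose t2 := take_poly l w2; pose d2 := drop_poly l w2.
have f1 : w1 = t1 + d1 * 'X^l by rewrite poly_take_drop.
have f2 : w2 = t2 + d2 * 'X^l by rewrite poly_take_drop.
have e : (u%:P * t1 + v%:P * t2) + (u%:P * d1 + v%:P * d2 + w3) * 'X^l = 0.
  by rewrite -[RHS]h f1 f2; ring.
have s : (size (u%:P * t1 + v%:P * t2)%R <= l)%N.
  rewrite !mul_polyC; apply: leq_trans (size_polyD _ _) _; rewrite geq_max.
  by rewrite !(leq_trans (size_scale_leq _ _)) ?size_take_poly.
have := congr1 (drop_poly l) e; rewrite drop_polyDMXn // drop_poly0r => e3.
rewrite e3 mul0r addr0 in e.
have [|c ec] := cop_polyC cuv (a := - t1) (b := t2).
  by rewrite mulrN; apply/eqP; rewrite eq_sym -addr_eq0 addrC e.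
have et : t1 = - (v%:P * c).
  have rP : reg u%:P.
    by move=> a ha; apply/polyP => i; rewrite coef0; apply: ru; rewrite -coefCM ha coef0.
  apply: (reg_cancel rP); apply/eqP; rewrite -subr_eq0; apply/eqP.
  by rewrite -[RHS]e ec; ring.
exists d2, (- d1), (- c); split.
- by rewrite f1 et; ring.
- by rewrite f2 ec; ring.
- by apply/eqP; rewrite -subr_eq0; apply/eqP; rewrite -[RHS]e3; ring.
Qed.
End PolyRegular.

(** * Forms in x^n and y^n from univariate polynomials *)

Section Homogenization.
Variables (k : fieldType) (A : comNzRingType) (io : {rmorphism k -> A}) (X Y : A).
Implicit Types (p q : {poly k}) (m : nat).

Definition hm m p : A := \sum_(i < m.+1) io p`_i * X ^+ i * Y ^+ (m - i).

Lemma hmD m p q : hm m (p + q) = hm m p + hm m q.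
Proof.
by rewrite /hm -big_split; apply: eq_bigr => i _; rewrite coefD rmorphD !mulrDl.
Qed.

Lemma hmCM m c p : hm m (c%:P * p) = io c * hm m p.
Proof.
by rewrite /hm mulr_sumr; apply: eq_bigr => i _; rewrite coefCM rmorphM -!mulrA.
Qed.

Lemma hmN m p : hm m (- p) = - hm m p.
Proof.
by rewrite -mulN1r -polyC1 -polyCN hmCM rmorphN1 mulN1r.
Qed.

Lemma hm_mulX m p : hm m.+1 (p * 'X) = X * hm m p.
Proof.
rewrite /hm big_ord_recl coefMX /= rmorph0 !mul0r add0r mulr_sumr.
by apply: eq_bigr => i _; rewrite coefMX /= subSS exprS; ring.
Qed.

Lemma hm_up m p : (size p <= m.+1)%N -> hm m.+1 p = Y * hm m p.
Proof.
move=> sp; rewrite /hm big_ord_recr /= nth_default // rmorph0 !mul0r addr0 mulr_sumr.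
by apply: eq_bigr => i _; rewrite subSn -1?ltnS // exprS; ring.
Qed.

Lemma hm_upn m j p : (size p <= m.+1)%N -> hm (m + j) p = Y ^+ j * hm m p.
Proof.
move=> sp; elim: j => [|j IH]; first by rewrite addn0 mul1r.
by rewrite addnS hm_up ?IH ?exprS ?mulrA // (leq_trans sp) // ltnS leq_addr.
Qed.

Lemma hmC c : hm 0 c%:P = io c.
Proof. by rewrite /hm big_ord1 coefC /= expr0 !mulr1. Qed.

Lemma hmM m l p q : (size p <= m.+1)%N -> (size q <= l.+1)%N ->
  hm (m + l) (p * q) = hm m p * hm l q.
Proof.
elim: m p => [|m IH] p sp sq.
  by rewrite [p]size1_polyC // hmCM hmC.
have [p' [c ep]] : exists p' c, p = p' * 'X + c%:P.
  by elim/poly_ind: p {sp} => [|p' c _]; [exists 0, 0; rewrite mul0r addr0|exists p', c].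
have sp' : (size p' <= m.+1)%N.
  move: sp; rewrite ep size_MXaddC; case: ifP => // /andP[/eqP -> _].
  by rewrite size_poly0.
have -> : p * q = (p' * q) * 'X + c%:P * q by rewrite ep; ring.
rewrite hmD hmCM addSn hm_mulX IH // ep hmD hm_mulX.
have -> : hm m.+1 c%:P = Y ^+ m.+1 * io c.
  by rewrite -[m.+1]add0n hm_upn ?hmC // size_polyC_leq1.
by rewrite -addSn addnC hm_upn //; ring.
Qed.

Lemma hm_mz t : hm t (mz k ^+ t) = (- (X + Y)) ^+ t.
Proof.
elim: t => [|t IH]; first by rewrite !expr0 -polyC1 hmC rmorph1.
rewrite !exprS -[t.+1]add1n hmM ?IH ?size_mzX //; last by rewrite -[mz k]expr1 size_mzX.
congr (_ * _); rewrite /mz xp1E hmN hmD -['X]mul1r hm_mulX -polyC1 hmC.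
by rewrite -[1%N]add0n hm_upn ?size_polyC_leq1 // hmC rmorph1; ring.
Qed.

Lemma hm_Xn t : hm t 'X^t = X ^+ t.
Proof.
elim: t => [|t IH]; first by rewrite !expr0 -polyC1 hmC rmorph1.
by rewrite exprSr hm_mulX IH exprS.
Qed.

Lemma hm_cst t c : hm t c%:P = io c * Y ^+ t.
Proof. by rewrite -[t]add0n hm_upn ?size_polyC_leq1 // hmC mulrC. Qed.

(** With X = x^n, Y = y^n and X + Y = - z^n, a zero at one of the three points becomes divisibility
    by x^n, y^n or z^n, and a nonzero value becomes coprimality. The same holds for the two
    companions below. *)
Lemma hm_at_X m p : (size p <= m.+1)%N -> exists e, hm m p = io p.[0] * Y ^+ m + X * e.
Proof.
move=> sp; rewrite /hm big_ord_recl /= expr0 mulr1 subn0 horner_coef0.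
exists (\sum_(i < m) io p`_i.+1 * X ^+ i * Y ^+ (m - i.+1)); congr (_ + _).
by rewrite mulr_sumr; apply: eq_bigr => i _; rewrite /= exprS; ring.
Qed.

Lemma hm_at_Y m p : exists e, hm m p = io p`_m * X ^+ m + Y * e.
Proof.
rewrite /hm big_ord_recr /= subnn expr0 mulr1.
exists (\sum_(i < m) io p`_i * X ^+ i * Y ^+ (m - i.+1)); rewrite addrC; congr (_ + _).
by rewrite mulr_sumr; apply: eq_bigr => i _; rewrite -(subnSK (ltn_ord i)) exprS; ring.
Qed.

Lemma hm_at_Z m p : (size p <= m.+1)%N ->
  exists e, hm m p = io p.[-1] * Y ^+ m + (X + Y) * e.
Proof.
move=> sp; have /factor_theorem [q eq] : root (p - p.[-1]%:P) (-1).
  by rewrite rootE !hornerE subrr.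
have ep : p = q * xp1 k + p.[-1]%:P by rewrite /xp1 -eq subrK.
rewrite {1}ep hmD hm_cst addrC; case: m sp => [|m] sp.
  have q0 : q = 0.
    apply/eqP/negPn/negP => q0; have := size_polyC_leq1 p.[-1].
    have : (size (p - p.[-1]%:P)%R <= 1)%N.
      by rewrite (leq_trans (size_polyD _ _)) // size_polyN geq_max sp size_polyC_leq1.
    rewrite eq fsizeM ?polyXsubC_eq0 // size_XsubC; move: q0; rewrite -fsize_gt0.
    by move: (size q) => s; clear; lia.
  by exists 0; rewrite q0 mul0r mulr0 -polyC0 hmC rmorph0.
exists (hm m q); congr (_ + _).
have sq : (size q <= m.+1)%N.
  have [->|q0] := eqVneq q 0; first by rewrite size_poly0.
  have : (size (p - p.[-1]%:P)%R <= m.+2)%N.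
    by rewrite (leq_trans (size_polyD _ _)) // size_polyN geq_max sp (leq_trans (size_polyC_leq1 _)).
  by rewrite eq fsizeM ?polyXsubC_eq0 // size_XsubC addn2.
have -> : q * xp1 k = q * 'X + q by rewrite xp1E; ring.
by rewrite hmD hm_mulX hm_up // mulrDl.
Qed.
End Homogenization.

(** * The ring R, given abstractly by a surjection with kernel generated by F *)

Section Fermat.
Variables (k : fieldType) (n : nat).
Hypothesis n_gt0 : (0 < n)%N.
Local Notation F := (Fpoly k n).
Variables (R : comNzRingType) (pr : {rmorphism P3 k -> R}).
Hypotheses (pr_surj : forall r, exists p, pr p = r)
  (pr_eq0 : forall p, pr p = 0 <-> exists q, p = q * F).
Local Notation x := (pr (varx k)).
Local Notation y := (pr (vary k)).
Local Notation z := (pr (varz k)).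

Lemma prD (p q : P3 k) : pr (p + q) = pr p + pr q. Proof. exact: raddfD. Qed.
Lemma prB (p q : P3 k) : pr (p - q) = pr p - pr q. Proof. exact: raddfB. Qed.
Lemma prN (p : P3 k) : pr (- p) = - pr p. Proof. exact: raddfN. Qed.
Lemma prM (p q : P3 k) : pr (p * q) = pr p * pr q. Proof. exact: rmorphM. Qed.
Lemma pr1 : pr (1 : P3 k) = 1. Proof. exact: rmorph1. Qed.
Lemma prX (p : P3 k) m : pr (p ^+ m) = pr p ^+ m. Proof. exact: rmorphXn. Qed.

Lemma F_monic : F \is monic.
Proof. by rewrite Fpoly_monic_form // monicXnaddC. Qed.

Lemma F_reg : reg F.
Proof. by apply: idomain_reg; rewrite monic_neq0 ?F_monic. Qed.

Lemma F_at0 : F.[0] = 'X%:P ^+ n + 'X ^+ n.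
Proof. by rewrite Fpoly_monic_form // hornerD hornerXn hornerC expr0n eqn0Ngt n_gt0 add0r. Qed.

Lemma F_at00 : F.[0].[0] = 'X ^+ n.
Proof.
by rewrite F_at0 hornerD hornerXn -polyC_exp hornerC expr0n eqn0Ngt n_gt0 addr0.
Qed.

Lemma fermat : x ^+ n + y ^+ n + z ^+ n = 0.
Proof.
rewrite -!prX -!prD; apply/pr_eq0; exists 1.
by rewrite mul1r /Fpoly eqn0Ngt n_gt0 /=.
Qed.

Lemma reg_constant (u : {poly {poly k}}) : u != 0 -> reg (pr u%:P).
Proof.
move=> u0 r; have [p <-] := pr_surj r; rewrite -prM => /pr_eq0 [q e].
by apply/pr_eq0; apply: (reg_mod_monic F_monic u0 e).
Qed.

Lemma reg_x : reg x. Proof. by apply: reg_constant; rewrite polyC_eq0 polyX_eq0. Qed.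
Lemma reg_y : reg y. Proof. by apply: reg_constant; rewrite polyX_eq0. Qed.

Lemma F0_neq0 : F.[0] != 0.
Proof.
apply/eqP => e; have := F_at00; rewrite e horner0 => /esym/eqP.
by rewrite expf_eq0 polyX_eq0 andbF.
Qed.

(** Unlike x and y, z is the variable in which F is monic, so the argument with remainders does not
    apply; instead F at z = 0 is the nonzero polynomial x^n + y^n. *)
Lemma reg_z : reg z.
Proof.
move=> r; have [p <-] := pr_surj r; rewrite -prM => /pr_eq0 [q e].
have /eqP := congr1 (fun s : P3 k => s.[0]) e; rewrite !hornerM hornerX mul0r eq_sym.
rewrite mulf_eq0 (negPf F0_neq0) orbF => /eqP /root0_factor [q' eq].
apply/pr_eq0; exists q'; apply: (@mulfI _ (varz k)); first by rewrite polyX_eq0.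
by rewrite e eq; rewrite /varz; ring.
Qed.

Lemma cop_xy0 : cop ('X%:P : {poly {poly k}}) 'X.
Proof.
move=> a b e; have /eqP := congr1 (fun s : {poly {poly k}} => s.[0]) e.
rewrite !hornerM hornerX mul0r hornerC mulf_eq0 polyX_eq0 => /eqP /root0_factor [a' ea].
exists a'; apply: (@mulfI _ 'X); first by rewrite polyX_eq0.
by rewrite -e ea; ring.
Qed.

Lemma cop_xy : cop x y.
Proof.
move=> a b; have [p ep] := pr_surj a; have [q eq] := pr_surj b; subst a b.
rewrite -!prM => /eqP; rewrite -subr_eq0 -prB => /eqP /pr_eq0 [s e].
have [c [q' eb]] := cop_mod_monic F_monic cop_xy0 e.
exists (pr c); rewrite eb prD prM -[RHS]addr0; congr (_ + _).
by apply/pr_eq0; exists q'.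
Qed.

Lemma cop_zy : cop z y.
Proof.
move=> a b; have [p ep] := pr_surj a; have [q eq] := pr_surj b; subst a b.
rewrite -!prM => /eqP; rewrite -subr_eq0 -prB => /eqP /pr_eq0 [s e].
have e0 := congr1 (fun s : P3 k => s.[0]) e.
rewrite hornerM hornerD hornerN !hornerM hornerX mul0r add0r hornerC in e0.
have /eqP := congr1 (fun s : {poly {poly k}} => s.[0]) e0.
rewrite hornerN !hornerM hornerX mul0r oppr0 F_at00 eq_sym mulf_eq0 expf_eq0 polyX_eq0 andbF orbF.
move=> /eqP /root0_factor [s' es].
have eq0 : q.[0] = - s' * F.[0].
  apply: (@mulfI _ 'X); first by rewrite polyX_eq0.
  by rewrite -[LHS]opprK e0 es; ring.
have [|d ed] := @root0_factor _ (q + s'%:P * F).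
  by rewrite hornerD hornerM hornerC eq0; ring.
exists (pr d); rewrite -prM; apply/eqP; rewrite -subr_eq0 -prB; apply/eqP/pr_eq0.
by exists (- s'%:P); rewrite /varz mulrC -ed; ring.
Qed.

Lemma cop_swap (u v : R) : reg u -> cop u v -> cop v u.
Proof.
move=> ru cuv a b e; have [c ec] := cuv _ _ (esym e); exists c.
by apply: (reg_cancel ru); rewrite -e ec; ring.
Qed.

(** The ideal (x, y, z) of R; it is proper because F has no constant term. *)
Definition mI (r : R) : Prop := exists p, r = pr p /\ p.[0].[0].[0] = 0.

Lemma mI_D u v : mI u -> mI v -> mI (u + v).
Proof.
by move=> [p [-> hp]] [q [-> hq]]; exists (p + q); rewrite prD !hornerD hp hq addr0.
Qed.

Lemma mI_M u v : mI v -> mI (u * v).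
Proof.
move=> [q [-> hq]]; have [p <-] := pr_surj u; exists (p * q).
by rewrite prM !hornerM hq mulr0.
Qed.

Lemma mI_1 : ~ mI 1.
Proof.
move=> [p [e hp]]; have /pr_eq0 [q eq] : pr (p - 1) = 0 by rewrite prB -e pr1 subrr.
have /eqP := congr1 (fun s : P3 k => s.[0].[0].[0]) eq.
rewrite !(hornerD, hornerN, hornerM, hornerC) hp F_at00 hornerXn expr0n eqn0Ngt n_gt0 mulr0.
by rewrite sub0r oppr_eq0 oner_eq0.
Qed.

Lemma mI_X u i : (0 < i)%N -> mI u -> mI (u ^+ i).
Proof. by case: i => // i _ hu; rewrite exprSr; apply: mI_M. Qed.

Lemma mI_x : mI x. Proof. by exists (varx k); rewrite /varx !hornerE. Qed.
Lemma mI_y : mI y. Proof. by exists (vary k); rewrite /vary !hornerE. Qed.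
Lemma mI_z : mI z. Proof. by exists (varz k); rewrite /varz !hornerE. Qed.

Section Koszul.
Variables i j l : nat.
Hypotheses (hi : (0 < i < n)%N) (hj : (0 < j < n)%N) (hl : (0 < l < n)%N).

Lemma F_split : varx k ^+ i * varx k ^+ (n - i) + vary k ^+ j * vary k ^+ (n - j)
  + varz k ^+ l * varz k ^+ (n - l) = F.
Proof.
move: hi hj hl => /andP[_ /ltnW h1] /andP[_ /ltnW h2] /andP[_ /ltnW h3].
by rewrite -!exprD !subnKC // /Fpoly eqn0Ngt n_gt0 /=.
Qed.

Lemma fermat_pd_infinite (g1 g2 g3 : R)
  (tau : {linear (R^o * R^o * R^o)%type -> (R^o * R^o * R^o)%type}) :
  [/\ forall U, dot3 U (x ^+ i) (y ^+ j) (z ^+ l) = 0 -> dot3 (tau U) g1 g2 g3 = 0,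
      forall u, dot3 u g1 g2 g3 = 0 -> exists U, dot3 U (x ^+ i) (y ^+ j) (z ^+ l) = 0 /\ tau U = u
    & forall U, dot3 U (x ^+ i) (y ^+ j) (z ^+ l) = 0 -> tau U = 0 -> U = 0] ->
  pd_infinite (@Quotient.quot R (ideal3 g1 g2 g3) : lmodType R).
Proof.
move=> [t1 t2 t3].
have eF := F_split.
have eF' : varx k ^+ (n - i) * varx k ^+ i + vary k ^+ (n - j) * vary k ^+ j
  + varz k ^+ (n - l) * varz k ^+ l = F by rewrite -F_split; ring.
have prF : pr F = 0 by apply/pr_eq0; exists 1; rewrite mul1r.
have ker p : pr p = 0 -> exists q, p = q * F by move/pr_eq0.
have hi' : (0 < i)%N && (0 < n - i)%N by rewrite subn_gt0.
have hj' : (0 < j)%N && (0 < n - j)%N by rewrite subn_gt0.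
have hl' : (0 < l)%N && (0 < n - l)%N by rewrite subn_gt0.
move: hi' hj' hl' => /andP[i1 i2] /andP[j1 j2] /andP[l1 l2].
apply: (@koszul_pd_infinite R g1 g2 g3 (x ^+ i) (y ^+ j) (z ^+ l)
  (x ^+ (n - i)) (y ^+ (n - j)) (z ^+ (n - l)) tau mI).
- by rewrite -!prX -!prM -!prD eF.
- by apply: regX; exact: reg_x.
- rewrite -!prX => X.
  by apply: (mf_exact pr_surj ker F_reg); rewrite -eF.
- rewrite -!prX => X.
  by apply: (mf_exact pr_surj ker F_reg); rewrite -eF'.
- move=> [[u1 u2] u3]; rewrite /dot3 /=.
  have [p1 <-] := pr_surj u1; have [p2 <-] := pr_surj u2; have [p3 <-] := pr_surj u3.
  rewrite -!prX -!prM -!prD => /ker [q eq].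
  have [|||V1 [V2 [V3 [w1 w2 w3]]]] := @koszul_exact _ ('X%:P ^+ i) ('X ^+ j) l
    (p1 - q * varx k ^+ (n - i)) (p2 - q * vary k ^+ (n - j)) (p3 - q * varz k ^+ (n - l)).
  + by apply: idomain_reg; rewrite expf_neq0 // polyC_eq0 polyX_eq0.
  + by apply: copX; [apply: idomain_reg; rewrite polyC_eq0 polyX_eq0|exact: cop_xy0].
  + rewrite !polyC_exp -/(varx k) -/(vary k) -/(varz k).
    transitivity (p1 * varx k ^+ i + p2 * vary k ^+ j + p3 * varz k ^+ l - q * F).
      by rewrite -F_split; ring.
    by rewrite eq subrr.
  rewrite !polyC_exp -/(varx k) -/(vary k) -/(varz k) in w1 w2 w3.
  exists (pr V1, pr V2, pr V3, - pr q) => /=.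
  have f1 : p1 = vary k ^+ j * V3 - varz k ^+ l * V2 + q * varx k ^+ (n - i) by rewrite -w1 subrK.
  have f2 : p2 = varz k ^+ l * V1 - varx k ^+ i * V3 + q * vary k ^+ (n - j) by rewrite -w2 subrK.
  have f3 : p3 = varx k ^+ i * V2 - vary k ^+ j * V1 + q * varz k ^+ (n - l) by rewrite -w3 subrK.
  by congr (_, _, _); rewrite ?f1 ?f2 ?f3 !(prD, prN, prM, prX); ring.
- exact: t1.
- exact: t2.
- exact: t3.
- exact: mI_D.
- exact: mI_M.
- exact: mI_1.
- by split; apply: mI_X => //; [exact: mI_x|exact: mI_y|exact: mI_z].
- by split; apply: mI_X => //; [exact: mI_x|exact: mI_y|exact: mI_z].
Qed.
End Koszul.

Definition io : {rmorphism k -> R} := pr \o polyC \o polyC \o polyC.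
Local Notation H := (hm io (x ^+ n) (y ^+ n)).

Lemma zn : z ^+ n = - (x ^+ n + y ^+ n).
Proof. by apply/eqP; rewrite -addr_eq0 addrC fermat. Qed.

(** Modulo u^n, W is a unit constant times a power of v, hence coprime to u^r for r <= n. *)
Lemma div_by (u v W e : R) (c : k) r m a b : (r <= n)%N -> reg u -> cop u v -> c != 0 ->
  W = io c * (v ^+ n) ^+ m + u ^+ n * e -> a * W = u ^+ r * b -> exists d, a = u ^+ r * d.
Proof.
move=> rn ru cuv c0 -> h.
have [|d ed] := copX (i := r) (j := (n * m)%N) ru cuv (a := b - u ^+ (n - r) * e * a) (b := io c * a).
  rewrite mulrBr -h; have -> : u ^+ n = u ^+ r * u ^+ (n - r) by rewrite -exprD subnKC.
  by rewrite exprM; ring.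
by exists (io c^-1 * d); rewrite mulrCA -ed mulrA -rmorphM mulVf // rmorph1 mul1r.
Qed.

(** The three minors of the basis, homogenized in degree m1 + m2 = t; the one for Z^t uses x^n + y^n
    = - z^n. *)
Lemma dbasis_cross t m1 p1 s1 m2 p2 s2 (kap : k) : dbasis t m1 p1 s1 m2 p2 s2 kap ->
  let q1 := qof t p1 s1 in let q2 := qof t p2 s2 in
  [/\ io kap * x ^+ (n * t) = H m1 q1 * H m2 s2 - H m1 s1 * H m2 q2,
      io kap * y ^+ (n * t) = H m1 s1 * H m2 p2 - H m1 p1 * H m2 s2
    & io kap * z ^+ (n * t) = H m1 p1 * H m2 q2 - H m1 q1 * H m2 p2].
Proof.
move=> [hm0 [a1 a2 a3] [b1 b2 b3] k0 det] q1 q2.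
have hN p q : H t (p - q) = H t p - H t q by rewrite hmD hmN.
split; rewrite exprM.
- have e : kap%:P * 'X^t = q1 * s2 - s1 * q2 by rewrite -det /q1 /q2 /qof; ring.
  by rewrite -!hmM // hm0 -hN -e hmCM hm_Xn.
- have e : kap%:P = s1 * p2 - p1 * s2 by rewrite -det; ring.
  by rewrite -!hmM // hm0 -hN -e hm_cst.
- have e : kap%:P * mz k ^+ t = p1 * q2 - q1 * p2 by rewrite -det /q1 /q2 /qof; ring.
  rewrite -!hmM // hm0 -hN -e hmCM hm_mz; congr (_ * _ ^+ _).
  by rewrite -zn.
Qed.

Lemma io_unit (kap : k) : kap != 0 -> io kap^-1 * io kap = 1.
Proof. by move=> k0; rewrite -rmorphM mulVf // rmorph1. Qed.

Lemma finite_aligned t : finite_pd (@Quotient.quot R (ideal3 (x ^+ (n * t)) (y ^+ (n * t)) (z ^+ (n * t))) : lmodType R).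
Proof.
have [m1 [p1 [s1 [m2 [p2 [s2 [kap [hb _]]]]]]]] := dbasis_exists k t.
have [e1 e2 e3] := dbasis_cross hb; have [_ _ _ k0 _] := hb.
apply: aligned_finite_pd (io_unit k0) e1 e2 e3.
- exact: regX reg_x.
- exact: copX reg_x cop_xy.
Qed.

Lemma finite_split t r : (r <= n)%N -> split_basis k t ->
  finite_pd (@Quotient.quot R (ideal3 (x ^+ (t * n + r)) (y ^+ (t * n + r)) (z ^+ (t * n + r))) : lmodType R).
Proof.
move=> rn [m1 [p1 [s1 [m2 [p2 [s2 [kap [hb [vx vy vz]]]]]]]]].
have [e1 e2 e3] := dbasis_cross hb; have [_ [a1 a2 a3] _ k0 _] := hb.
have [a ea] := hm_at_X io (x ^+ n) (y ^+ n) a1; rewrite vx rmorph0 mul0r add0r in ea.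
have [b eb] := hm_at_Y io (x ^+ n) (y ^+ n) m1 (qof t p1 s1).
rewrite -/(vY _ _ _ _) vy rmorph0 mul0r add0r in eb.
have [c ec] := hm_at_Z io (x ^+ n) (y ^+ n) a2; rewrite vz rmorph0 mul0r add0r in ec.
rewrite -[x ^+ n + _]opprK -zn mulNr -mulrN in ec.
have sp u : u ^+ n = u ^+ r * u ^+ (n - r) :> R by rewrite -exprD subnKC.
have st u : u ^+ (t * n + r) = u ^+ (n * t) * u ^+ r :> R by rewrite -exprD mulnC.
have {}ea : H m1 p1 = x ^+ r * x ^+ (n - r) * a by rewrite ea sp.
have {}eb : H m1 (qof t p1 s1) = y ^+ r * y ^+ (n - r) * b by rewrite eb sp.
have {}ec : H m1 s1 = z ^+ r * z ^+ (n - r) * - c by rewrite ec sp.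
rewrite !st; apply: (split_finite_pd (io_unit k0) e1 e2 e3 ea eb ec); rewrite -!st.
- exact: regX reg_x.
- exact: copX reg_x cop_xy.
Qed.

Lemma infinite_rigid t r : (0 < r < n)%N -> rigid k t ->
  pd_infinite (@Quotient.quot R (ideal3 (x ^+ (t * n + r)) (y ^+ (t * n + r)) (z ^+ (t * n + r))) : lmodType R).
Proof.
move=> hr; have /andP[r0 rn] := hr; have ln := ltnW rn.
have sp u : u ^+ n = u ^+ r * u ^+ (n - r) :> R by rewrite -exprD subnKC.
have st u : u ^+ (t * n + r) = u ^+ (n * t) * u ^+ r :> R by rewrite -exprD mulnC.
have rx := regX (i := r) reg_x; have ry := regX (i := r) reg_y; have rz := regX (i := r) reg_z.
have rxt := regX (i := (n * t)%N) reg_x; have cxt := copX (i := (n * t)%N) (j := (n * t)%N) reg_x cop_xy.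
have cyx := cop_swap reg_x cop_xy; have cyz := cop_swap reg_z cop_zy.
case=> [[m [p1 [s1 [p2 [s2 [kap [hb [x1 y2 z12] [x2 y1 z1]]]]]]]]|
        [m [p1 [s1 [p2 [s2 [kap [hb [x1 y1 z1] [x2 y2 z2]]]]]]]]];
  have [e1 e2 e3] := dbasis_cross hb; have [_ [a1 a2 a3] [b1 b2 b3] k0 _] := hb.
- have [a ea] := hm_at_X io (x ^+ n) (y ^+ n) a1; rewrite x1 rmorph0 mul0r add0r in ea.
  have [b eb] := hm_at_Y io (x ^+ n) (y ^+ n) m (qof t p2 s2).
  rewrite -/(vY _ _ _ _) y2 rmorph0 mul0r add0r in eb.
  have sz : (size (s1 + s2)%R <= m.+1)%N.
    by rewrite (leq_trans (size_polyD _ _)) // geq_max a2 b2.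
  have [c ec] := hm_at_Z io (x ^+ n) (y ^+ n) sz.
  rewrite hornerD z12 rmorph0 mul0r add0r hmD -[x ^+ n + _]opprK -zn mulNr -mulrN in ec.
  have [a' ea'] := hm_at_X io (x ^+ n) (y ^+ n) b1.
  have [b' eb'] := hm_at_Y io (x ^+ n) (y ^+ n) m (qof t p1 s1).
  have [c' ec'] := hm_at_Z io (x ^+ n) (y ^+ n) a2.
  rewrite -[x ^+ n + _]opprK -zn mulNr -mulrN in ec'.
  have {}ea : H m p1 = x ^+ r * x ^+ (n - r) * a by rewrite ea sp.
  have {}eb : H m (qof t p2 s2) = y ^+ r * y ^+ (n - r) * b by rewrite eb sp.
  have {}ec : H m s1 + H m s2 = z ^+ r * z ^+ (n - r) * - c by rewrite ec sp.
  have [tau ht] := tau_even rx ry rz rxt cxt (io_unit k0) e1 e2 e3 ea eb ec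
    (fun _ _ => div_by ln reg_x cop_xy x2 ea') (fun _ _ => div_by ln reg_y cyx y1 eb')
    (fun _ _ => div_by ln reg_z cop_zy z1 ec').
  by rewrite !st; apply: (fermat_pd_infinite hr hr hr ht).
- have [a ea] := hm_at_X io (x ^+ n) (y ^+ n) b1; rewrite x2 rmorph0 mul0r add0r in ea.
  have [b eb] := hm_at_Y io (x ^+ n) (y ^+ n) m.+1 (qof t p2 s2).
  rewrite -/(vY _ _ _ _) y2 rmorph0 mul0r add0r in eb.
  have sz : (size (s2 + s1)%R <= m.+2)%N.
    by rewrite (leq_trans (size_polyD _ _)) // geq_max b2 ltnW.
  have [c ec] := hm_at_Z io (x ^+ n) (y ^+ n) sz.
  rewrite hornerD z2 addNr rmorph0 mul0r add0r hmD (hm_up io (x ^+ n) (y ^+ n) a2) -[x ^+ n + _]opprK -zn mulNr -mulrN in ec.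
  have [a' ea'] := hm_at_X io (x ^+ n) (y ^+ n) a1.
  have [b' eb'] := hm_at_Y io (x ^+ n) (y ^+ n) m (qof t p1 s1).
  have [c' ec'] := hm_at_Z io (x ^+ n) (y ^+ n) a2.
  rewrite -[x ^+ n + _]opprK -zn mulNr -mulrN in ec'.
  have {}ea : H m.+1 p2 = x ^+ r * x ^+ (n - r) * a by rewrite ea sp.
  have {}eb : H m.+1 (qof t p2 s2) = y ^+ r * y ^+ (n - r) * b by rewrite eb sp.
  have {}ec : H m.+1 s2 + y ^+ r * y ^+ (n - r) * H m s1 = z ^+ r * z ^+ (n - r) * - c.
    by rewrite -!sp ec.
  have [tau ht] := tau_odd rx ry rz rxt cxt (io_unit k0) e1 e2 e3 ea eb ec
    (fun _ _ => div_by ln reg_x cop_xy x1 ea') (fun _ _ => div_by ln reg_y cyx y1 eb')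
    (fun _ _ => div_by ln reg_z cop_zy z1 ec') (copX (i := r) (j := r) reg_y cyx) (copX (i := r) (j := r) reg_y cyz).
  have hr' : (0 < n - r < n)%N by rewrite subn_gt0 rn /= ltn_subrL r0.
  by rewrite !st; apply: (fermat_pd_infinite hr hr' hr ht).
Qed.

Lemma fermat_pd_infiniteP t r N (X Y Z : R) : (r < n)%N -> N = (t * n + r)%N ->
  x ^+ N = X -> y ^+ N = Y -> z ^+ N = Z ->
  pd_infinite (@Quotient.quot R (ideal3 X Y Z) : lmodType R) <-> rigid k t /\ (1 <= r)%N.
Proof.
move=> rn -> <- <- <-; split; last by move=> [ht r0]; apply: infinite_rigid => //; rewrite r0.
move=> inf; have [r0|r0] := posnP r.
  by case: inf; rewrite r0 addn0 mulnC; exact: finite_aligned.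
split=> //; case: (structure_trichotomy k t) => [hs|he|ho]; [|by left|by right].
by case: inf; apply: finite_split => //; exact: ltnW.
Qed.
End Fermat.

Section Instance.
Variables (k : fieldType) (n : nat).

Definition Rring : comNzRingType := Rkn k n.

Definition Rpr : {rmorphism P3 k -> Rring} := \pi_(Rkn k n).

Lemma Rpr_surj r : exists p, Rpr p = r.
Proof. by exists (repr r); exact: reprK. Qed.

Lemma Rpr_eq0 p : Rpr p = 0 <-> exists q, p = q * Fpoly k n.
Proof.
rewrite -[0](raddf0 Rpr); split.
  by move=> /eqP; rewrite -Quotient.idealrBE subr0 => /pboolP.
by move=> h; apply/eqP; rewrite -Quotient.idealrBE subr0; apply/pboolP.
Qed.

Lemma Rpr_x N : Rpr (varx k) ^+ N = xR k n ^+ N. Proof. by []. Qed.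
Lemma Rpr_y N : Rpr (vary k) ^+ N = yR k n ^+ N. Proof. by []. Qed.
Lemma Rpr_z N : Rpr (varz k) ^+ N = zR k n ^+ N. Proof. by []. Qed.
End Instance.

Unset Implicit Arguments.

Theorem theorem6p2 (k : fieldType) (c : nat) (n N theta r : nat) :
  (if c == 0%N then [pchar k] =i pred0 else c \in [pchar k]) ->
  (0 < n)%N -> (0 < N)%N ->
  N = (theta * n + r)%N -> (r <= n - 1)%N ->
  pd_infinite (Qkn k n N) <-> (S c theta /\ (1 <= r)%N).
Proof.
move=> ch n0 _ eN rn.
have lt : (r < n)%N by rewrite -(subnK n0) addn1 ltnS.
have main := @fermat_pd_infiniteP k n n0 (Rring k n) (Rpr k n) (@Rpr_surj k n) (@Rpr_eq0 k n)
  theta r N _ _ _ lt eN (Rpr_x k n N) (Rpr_y k n N) (Rpr_z k n N).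
have sr := S_rigid theta ch.
apply: iff_trans main _.
by split=> -[/sr h r1].
Qed.
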